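(* Let $\mathbf{c}=(c_1,\dots,c_n)$ be a weak solution of the Maxwell--Stefan system on $\mathbb{T}^3\times(0,\infty)$ with initial data $\mathbf{c}^0$, such that moreover, for every $i\in\{1,\dots,n\}$, $c_i\in C([0,\infty);L^2(\mathbb{T}^3))$ and $\sqrt{c_i}\,u_i\in L^2(\mathbb{T}^3\times(0,T))$ for every $T>0$. Then $\mathbf{c}$ is a renormalized solution of the Maxwell--Stefan system with initial data $\mathbf{c}^0$.
   Context: $\mathbb{T}^3$ is the 3-dimensional torus, $n\ge 2$, and $D_{ij}=D_{ji}>0$ ($i\neq j$) are given constants. The Maxwell--Stefan system for concentrations $\mathbf{c}=(c_1,\dots,c_n)$ and velocities $u_i(x,t)\in\mathbb{R}^3$, with fluxes $J_i=c_iu_i$, is $$\partial_t c_i+\nabla\cdot(c_iu_i)=0,\qquad i=1,\dots,n,$$ together with the constrained linear system $$-\sum_{j\neq i}\frac{c_jJ_i-c_iJ_j}{D_{ij}}=\nabla c_i\quad (i=1,\dots,n),\qquad \sum_{i=1}^nJ_i=0, \qquad (\ast)$$ and initial conditions $c_i(x,0)=c_i^0(x)$. The initial data always satisfy $0\le c_i^0\in L^\infty(\mathbb{T}^3)$, $\sum_{i=1}^nc_i^0=1$, and $H(\mathbf{c}^0)=\int_{\mathbb{T}^3}\sum_ic_i^0(\ln c_i^0-1)\,dx<+\infty$. Weak solution: $\mathbf{c}$ (with velocities $u_i$) is a weak solution if for all $i$: (i) $0\le c_i\le1$ and $\sum_ic_i=1$; (ii) $\nabla\sqrt{c_i}\in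 L^2(\mathbb{T}^3\times(0,T))$ and $\sqrt{c_i}\,u_i\in L^2(\mathbb{T}^3\times(0,T))$ for every $T>0$; (iii) for every $\phi_i\in C_c^\infty(\mathbb{T}^3\times[0,\infty))$, $$\int_{\mathbb{T}^3}c_i^0(x)\phi_i(x,0)\,dx+\int_0^\infty\!\!\int_{\mathbb{T}^3}c_i\,\partial_t\phi_i\,dx\,dt+\int_0^\infty\!\!\int_{\mathbb{T}^3}c_iu_i\cdot\nabla\phi_i\,dx\,dt=0,$$ and $J_i=c_iu_i$ satisfies $(\ast)$; (iv) $\lim_{t\to0}\int_{\mathbb{T}^3}|c_i(x,t)-c_i^0(x)|\,dx=0$. Renormalized solution: $\mathbf{c}$ (with velocities $u_i$) is a renormalized solution if for all $i$ conditions (i) and (ii) above hold, and: (iii') for every $\phi_i\in C_c^\infty(\mathbb{T}^3\times[0,\infty))$ and every $\beta\in C^2([0,\infty))$, $$\int_{\mathbb{T}^3}\beta(c_i^0)\phi_i(x,0)\,dx+\int_0^\infty\!\!\int_{\mathbb{T}^3}\beta(c_i)\partial_t\phi_i\,dx\,dt+\int_0^\infty\!\!\int_{\mathbb{T}^3}\sqrt{c_i}\,\beta'(c_i)\sqrt{c_i}\,u_i\cdot\nabla\phi_i\,dx\,dt+2\int_0^\infty\!\!\int_{\mathbb{T}^3}c_i\beta''(c_i)\nabla\sqrt{c_i}\cdot\sqrt{c_i}\,u_i\,\phi_i\,dx\,dt=0,$$ and $J_i=c_iu_i$ satisfies $(\ast)$; (iv') $\lim_{t\to0}\int_{\mathbb{T}^3}|\beta(c_i(x,t))-\beta(c_i^0(x))|\,dx=0$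 for every $\beta\in C^2([0,\infty))$. *)

(* Defs.v *)
From HB Require Import structures.
From mathcomp Require Import all_boot all_order all_algebra.
From mathcomp Require Import all_classical all_reals all_analysis.

Set Implicit Arguments.
Unset Strict Implicit.
Unset Printing Implicit Defensive.

Import Order.TTheory GRing.Theory Num.Theory numFieldNormedType.Exports.

Local Open Scope classical_set_scope.
Local Open Scope ring_scope.

(** The torus T^3 is R^3/Z^3: functions on it are the functions on R^3 that are
    1-periodic in each coordinate, and integrals over it are integrals over the
    fundamental cell [0,1)^3. *)

Notation position R := (R * R * R)%type.
Notation spacetime R := (R * R * R * R)%type.

(** An alias of [m1 \x m2] that carries its sigma-finite structure, so that it
    can be a factor of a further product *)
Section ProductMeasure.
Context (d1 d2 : measure_display) (T1 : measurableType d1)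
  (T2 : measurableType d2) (R : realType)
  (m1 : {sigma_finite_measure set T1 -> \bar R})
  (m2 : {sigma_finite_measure set T2 -> \bar R}).

Definition prod_measure := (m1 \x m2)%E.

Lemma prod_measure_sigma_finite : sigma_finite setT prod_measure.
Proof.
have /sigma_finiteP[F [TF ndF Foo]] := sigma_finiteT m1.
have /sigma_finiteP[G [TG ndG Goo]] := sigma_finiteT m2.
exists (fun n => F n `*` G n).
  rewrite -setXTT TF TG predeqE => -[x y]; split.
    move=> [/= [n _ Fnx] [k _ Gky]]; exists (maxn n k) => //; split.
    - by move: x Fnx; exact/subsetPset/ndF/leq_maxl.
    - by move: y Gky; exact/subsetPset/ndG/leq_maxr.
  by move=> [n _ []/= ? ?]; split; exists n.
move=> k; have [? ?] := Foo k; have [? ?] := Goo k.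
split; first exact: measurableX.
by rewrite /prod_measure product_measure1E// lte_mul_pinfty// ge0_fin_numE.
Qed.

HB.instance Definition _ := Measure.on prod_measure.
HB.instance Definition _ := @Measure_isSigmaFinite.Build _ _ _ prod_measure
  prod_measure_sigma_finite.

End ProductMeasure.

Section Torus.
Variable R : realType.

Definition unit_vector (k : 'I_3) : position R :=
  ((k == 0%N :> nat)%:R, (k == 1%N :> nat)%:R, (k == 2%N :> nat)%:R).

Definition periodic (A : Type) (f : position R -> A) : Prop :=
  forall (k : 'I_3) (x : position R), f (x + unit_vector k) = f x.

Definition periodic_in_space (A : Type) (f : spacetime R -> A) : Prop :=
  forall t : R, periodic (fun x => f (x, t)).

Definition cell : set (position R) := `[0, 1[ `*` `[0, 1[ `*` `[0, 1[.

(** T^3 x I, for a set I of times *)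
Definition cylinder (I : set R) : set (spacetime R) := cell `*` I.

Definition leb3 :=
  prod_measure (prod_measure (@lebesgue_measure R) (@lebesgue_measure R))
    (@lebesgue_measure R).

Definition leb4 := prod_measure leb3 (@lebesgue_measure R).

Definition dot (a b : 'rV[R]_3) : R := \sum_(k < 3) a 0 k * b 0 k.

(** [Some k] is the k-th space direction and [None] the time direction *)
Definition axis (o : option 'I_3) : spacetime R :=
  if o is Some k then (unit_vector k, 0) else (0, 1).

Definition partial (o : option 'I_3) (f : spacetime R -> R) :
    spacetime R -> R :=
  'D_(axis o) f.

Definition dt (f : spacetime R -> R) := partial None f.

Definition grad (f : spacetime R -> R) (z : spacetime R) : 'rV[R]_3 :=
  \row_(k < 3) partial (Some k) f z.

Definition smooth (f : spacetime R -> R) : Prop :=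
  forall s : seq (option 'I_3),
    let g := foldr partial f s in
    continuous g /\ forall o z, derivable g z (axis o).

(** The test functions C_c^oo(T^3 x I), I an interval of times: restrictions
    to T^3 x I of smooth functions on T^3 x R, the restriction having compact
    support in T^3 x I.  Values at times outside I are irrelevant. *)
Definition test_function (I : set R) (phi : spacetime R -> R) : Prop :=
  [/\ smooth phi, periodic_in_space phi &
      exists K : set R, [/\ compact K, K `<=` I &
        forall x t, I t -> ~ K t -> phi (x, t) = 0]].

(** Weak spatial gradient on T^3 x (0,oo) *)
Definition weak_gradient (f : spacetime R -> R)
    (g : spacetime R -> 'rV[R]_3) : Prop :=
  [/\ forall a b, 0 < a ->
        leb4.-integrable (cylinder `[a, b]) (EFin \o f),
      forall a b k, 0 < a ->
        leb4.-integrable (cylinder `[a, b]) (fun z => (g z 0 k)%:E) &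
      forall phi, test_function `]0, +oo[ phi -> forall k : 'I_3,
        \int[leb4]_(z in cylinder `]0, +oo[) (f z * partial (Some k) phi z) =
        - \int[leb4]_(z in cylinder `]0, +oo[) (g z 0 k * phi z)].

(** Membership in L^2(T^3 x (0,T)) for every T > 0 *)
Definition L2_finite_times (g : spacetime R -> 'rV[R]_3) : Prop :=
  forall T, 0 < T -> forall k : 'I_3,
    (fun z => g z 0 k) \_ (cylinder `]0, T[) \in Lfun leb4 2%:E.

(** f \in C([0,oo); L^2(T^3)), for the map t |-> f(.,t) itself (f is the
    continuous representative of its class) *)
Definition continuous_L2 (f : spacetime R -> R) : Prop :=
  (forall t, 0 <= t -> (fun x => f (x, t)) \_ cell \in Lfun leb3 2%:E) /\
  (forall t0, 0 <= t0 ->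
     'N[leb3]_2%:E[EFin \o ((fun x => (f (x, t) - f (x, t0))%R) \_ cell)]%E
       @[t --> within `[0, +oo[ (nbhs t0)] --> 0%E).

(** b \in C^2([0,oo)) with derivatives b1 and b2, one-sided at 0: the
    derivatives on (0,oo) extend continuously to [0,oo).  Values at negative
    arguments are irrelevant. *)
Definition C2_halfline (b b1 b2 : R -> R) : Prop :=
  [/\ {within `[0, +oo[, continuous b},
      {within `[0, +oo[, continuous b1},
      {within `[0, +oo[, continuous b2},
      (forall s : R, 0 < s -> is_derive s (1 : R) b (b1 s)) &
      (forall s : R, 0 < s -> is_derive s (1 : R) b1 (b2 s))].

End Torus.

Arguments cell {R}.
Arguments leb3 {R}.
Arguments leb4 {R}.

Section MaxwellStefan.
Variables (R : realType) (n : nat).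
Implicit Types (D : 'I_n -> 'I_n -> R) (c : 'I_n -> spacetime R -> R)
  (u : 'I_n -> spacetime R -> 'rV[R]_3).

(** Since [ln 0 = 0], the convention 0 ln 0 = 0 is built in *)
Definition entropy (c0 : 'I_n -> position R -> R) : \bar R :=
  (\int[leb3]_(x in cell)
     (\sum_(i < n) c0 i x * (ln (c0 i x) - 1))%:E)%E.

Definition initial_data (c0 : 'I_n -> position R -> R) : Prop :=
  [/\ (forall i, periodic (c0 i)),
      (forall i, c0 i \_ cell \in Lfun leb3 +oo%E),
      (forall i, {ae leb3, forall x, cell x -> 0 <= c0 i x}),
      {ae leb3, forall x, cell x -> \sum_(i < n) c0 i x = 1} &
      (entropy c0 < +oo)%E].

Definition flux c u (i : 'I_n) (z : spacetime R) : 'rV[R]_3 :=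
  c i z *: u i z.

Definition sqrt_conc c (i : 'I_n) (z : spacetime R) : R := Num.sqrt (c i z).

Definition sqrt_flux c u (i : 'I_n) (z : spacetime R) : 'rV[R]_3 :=
  sqrt_conc c i z *: u i z.

Definition flux_relations D c u : Prop :=
  (forall i, exists2 g, weak_gradient (c i) g &
     {ae leb4, forall z, cylinder `]0, +oo[ z ->
        - \sum_(j < n | j != i)
            (D i j)^-1 *: (c j z *: flux c u i z - c i z *: flux c u j z)
        = g z}) /\
  {ae leb4, forall z, cylinder `]0, +oo[ z ->
     \sum_(i < n) flux c u i z = 0}.

Definition volume_fractions c : Prop :=
  [/\ (forall i, measurable_fun (cylinder `]0, +oo[) (c i)),
      (forall i, {ae leb4, forall z, cylinder `]0, +oo[ z ->
         0 <= c i z <= 1}) &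
      {ae leb4, forall z, cylinder `]0, +oo[ z -> \sum_(i < n) c i z = 1}].

Definition weak_solution D (c0 : 'I_n -> position R -> R) c u : Prop :=
  [/\ volume_fractions c,
      forall i,
        (exists2 g, weak_gradient (sqrt_conc c i) g & L2_finite_times g) /\
        L2_finite_times (sqrt_flux c u i),
      forall i phi, test_function `[0, +oo[ phi ->
        \int[leb3]_(x in cell) (c0 i x * phi (x, 0))
        + \int[leb4]_(z in cylinder `]0, +oo[) (c i z * dt phi z)
        + \int[leb4]_(z in cylinder `]0, +oo[)
            dot (flux c u i z) (grad phi z)
        = 0,
      flux_relations D c u &
      forall i,
        (\int[leb3]_(x in cell) `|c i (x, t) - c0 i x|%:E)%E
          @[t --> 0^'+] --> 0%E].

(** [g] is the weak gradient of the square root of the i-th concentration; it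
    is determined up to a null set, so the existential does not weaken the
    renormalized equation. *)
Definition renormalized_solution D (c0 : 'I_n -> position R -> R) c u : Prop :=
  [/\ volume_fractions c,
      forall i,
        L2_finite_times (sqrt_flux c u i) /\
        exists g, [/\ weak_gradient (sqrt_conc c i) g, L2_finite_times g &
          forall phi b b1 b2,
            test_function `[0, +oo[ phi -> C2_halfline b b1 b2 ->
            \int[leb3]_(x in cell) (b (c0 i x) * phi (x, 0))
            + \int[leb4]_(z in cylinder `]0, +oo[) (b (c i z) * dt phi z)
            + \int[leb4]_(z in cylinder `]0, +oo[)
                (sqrt_conc c i z * b1 (c i z)
                 * dot (sqrt_flux c u i z) (grad phi z))
            + 2 * \int[leb4]_(z in cylinder `]0, +oo[)
                (c i z * b2 (c i z) * dot (g z) (sqrt_flux c u i z) * phi z)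
            = 0],
      flux_relations D c u &
      forall i b b1 b2, C2_halfline b b1 b2 ->
        (\int[leb3]_(x in cell) `|b (c i (x, t)) - b (c0 i x)|%:E)%E
          @[t --> 0^'+] --> 0%E].

End MaxwellStefan.

(* Main.v *)
Require Import Defs.
From HB Require Import structures.
From mathcomp Require Import all_boot all_order all_algebra.
From mathcomp Require Import all_classical all_reals all_analysis.
From mathcomp Require Import measurable_realfun ring lra.

(** Fix a species with concentration c, and write r for the root of c, v for
    r u, so that the flux is J = r v, and g for the weak gradient of r, so that
    the gradient of c is G = 2 r g.  All of r, v, g are square integrable up to
    any finite time, and c takes values in [0, 1].  Formally the renormalized
    equation is the conservation law for c multiplied by b'(c) phi.  To make
    this legitimate, mollify: let c_m, J_m, G_m be the averages of c, J, G
    against a smooth kernel h_m (z - w), periodic in space and charging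
    positive times only.

    As a function of z the kernel is a test function, so the weak equations
    say that c_m satisfies the conservation law with flux J_m, and has gradient
    G_m, pointwise ([moll_divergence], [moll_gradient]).  For these functions
    the chain rule and integration by parts on the torus hold
    ([periodic_derivative_integral], [time_derivative_integral]), which gives
    the renormalized equation for b (c_m + 1/(m+1)); the shift is there because
    b is differentiable on the open half-line only
    ([mollified_renormalization]).

    No commutator appears in the limit, because the equation is linear in c
    and J.  The averages converge in L2 ([conv_cvg_L2]), hence J_m G_m
    converges in L1, and b, b', b'' are continuous on the compact range of the
    concentrations; this is enough for every term ([nonlinear_limit]).  The
    L2 convergence rests on [vanishes_average]: the sets whose indicators are
    not blurred by the kernel form a sigma-algebra that contains the
    half-spaces.  The initial term needs the convergence of c_m at time 0 to
    the initial value, which follows from the strong L1 continuity of c at time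
    0, as c_m (., 0) only averages c over times shorter than 1/(m+1)
    ([moll_initial]).  The limit is [renormalization].

    It remains to relate G to g, by the chain rule for the square proved in the
    same way ([gradient_sqr]), and to pass from bounds almost everywhere to
    bounds everywhere by clamping c ([renormalized_equation]).

    For the continuity of b (c) at the initial time, c(., t) must take values
    in [0, 1] for every t > 0 and not only for almost every t, since b is
    arbitrary on the negative numbers.  This is where the continuity of c with
    values in L2 is used ([bounds_at_every_time]).  *)

Set Implicit Arguments.
Unset Strict Implicit.
Unset Printing Implicit Defensive.

Import Order.TTheory GRing.Theory Num.Theory numFieldNormedType.Exports.

Local Open Scope classical_set_scope.
Local Open Scope ring_scope.

(** * Smooth functions of one variable *)
Section SmoothFunctionsOfOneVariable.
Variable R : realType.
Implicit Types f g : R -> R.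

(** Having derivatives of all orders is carried as an iterated existence
    statement: closure under products and compositions is then an induction,
    and no formula for higher derivatives is ever needed. *)
Fixpoint times_derivable (n : nat) (f : R -> R) : Prop :=
  if n is n'.+1 then
    exists2 f' : R -> R, (forall x, is_derive x (1 : R) f (f' x)) &
      times_derivable n' f'
  else True.

Definition smooth1 f := forall n, times_derivable n f.

Lemma times_derivableS n f : times_derivable n.+1 f -> times_derivable n f.
Proof.
elim: n f => [//|n IH] f [f' df /IH nf']; by exists f'.
Qed.

Lemma times_derivable_cst n (a : R) : times_derivable n (fun=> a).
Proof.
by elim: n a => [//|n IH] a; exists (fun=> 0) => // x; exact: is_derive_cst.
Qed.

Lemma times_derivable_id n : times_derivable n id.
Proof.
case: n => [//|n]; exists (fun=> 1); last exact: times_derivable_cst.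
by move=> x; exact: is_derive_id.
Qed.

Lemma times_derivableD n f g : times_derivable n f -> times_derivable n g ->
  times_derivable n (fun x => f x + g x).
Proof.
elim: n f g => [//|n IH] f g [f' df nf'] [g' dg ng'].
exists (fun x => f' x + g' x); last exact: IH.
by move=> x; exact: is_deriveD.
Qed.

(** The product rule involves [f] and [g] themselves as well as their
    derivatives, so the induction uses that an extra derivative can be
    forgotten. *)
Lemma times_derivableM n f g : times_derivable n f -> times_derivable n g ->
  times_derivable n (fun x => f x * g x).
Proof.
elim: n f g => [//|n IH] f g nf ng.
have [f' df nf'] := nf; have [g' dg ng'] := ng.
exists (fun x => f x * g' x + g x * f' x); first by move=> x; exact: is_deriveM.
by apply: times_derivableD; apply: IH => //; exact: times_derivableS.
Qed.

Lemma times_derivable_comp n f g : times_derivable n f -> times_derivable n g ->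
  times_derivable n (f \o g).
Proof.
elim: n f g => [//|n IH] f g [f' df nf'] ng.
have [g' dg ng'] := ng.
exists (fun x => f' (g x) * g' x); first by move=> x; exact: is_derive1_comp.
by apply: times_derivableM => //; apply: IH => //; exact: times_derivableS.
Qed.

Lemma smooth1_cst a : smooth1 (fun=> a : R).
Proof. by move=> n; exact: times_derivable_cst. Qed.

Lemma smooth1_affine a b : smooth1 (fun x => a * x + b).
Proof.
move=> n; apply: times_derivableD; last exact: times_derivable_cst.
by apply: times_derivableM; [exact: times_derivable_cst|exact: times_derivable_id].
Qed.

Lemma smooth1M f g : smooth1 f -> smooth1 g -> smooth1 (fun x => f x * g x).
Proof. by move=> sf sg n; exact: times_derivableM. Qed.

Lemma smooth1_comp f g : smooth1 f -> smooth1 g -> smooth1 (f \o g).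
Proof. by move=> sf sg n; exact: times_derivable_comp. Qed.

(** Sine and cosine are each other's derivatives up to sign, so they are
    treated by one simultaneous induction. *)
Lemma smooth1_cos : smooth1 cos.
Proof.
suff H n : times_derivable n (@cos R) /\ times_derivable n (@sin R).
  by move=> n; have [] := H n.
elim: n => [//|n [IHc IHs]]; split; last first.
  by exists cos => // x; exact: is_derive_sin.
exists (fun x => - sin x); first by move=> x; exact: is_derive_cos.
rewrite (_ : (fun x => - sin x) = fun x => (fun=> -1) x * sin x); last first.
  by apply/funext => x; rewrite mulN1r.
by apply: times_derivableM => //; exact: times_derivable_cst.
Qed.

Lemma smooth1_derive f : smooth1 f ->
  exists2 f', (forall x, is_derive x (1 : R) f (f' x)) & smooth1 f'.
Proof.
move=> sf; have [f' df _] := sf 1%N; exists f' => // n.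
have [f'' df2 nf2] := sf n.+1.
suff -> : f' = f'' by [].
apply/funext => x.
by rewrite -(@derive_val _ _ _ _ _ _ _ (df x)) (@derive_val _ _ _ _ _ _ _ (df2 x)).
Qed.

(** The functions p(1/x) exp(-1/x) for x > 0, extended by zero: this family,
    unlike exp(-1/x) alone, is stable under differentiation. *)
Definition flat (p : {poly R}) (x : R) : R :=
  if 0 < x then p.[x^-1] * expR (- x^-1) else 0.

(** Each monomial is controlled by one term of the exponential series. *)
Lemma expR_dominates_poly (p : {poly R}) :
  exists C, forall s, 0 <= s -> `|p.[s]| * expR (- s) <= C.
Proof.
exists (\sum_(i < size p) `|p`_i| * (i`!%:R)) => s s0.
rewrite horner_coef.
apply: (@le_trans _ _ ((\sum_(i < size p) `|p`_i * s ^+ i|) * expR (- s))).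
  by rewrite ler_pM2r ?expR_gt0// ler_norm_sum.
rewrite mulr_suml; apply: ler_sum => i _.
rewrite normrM -mulrA ler_wpM2l// normrX ger0_norm// expRN.
rewrite ler_pdivrMr ?expR_gt0// mulrC.
case: (i : nat) => [|k].
  by rewrite expr0 fact0 mulr1 (le_trans _ (expR_ge1Dx s))// lerDl.
have := expR_ge1Dxn k s0; rewrite -ler_pdivrMr ?ltr0n ?fact_gt0//.
by apply: le_trans; rewrite lerDr.
Qed.

Lemma flat_bounded p : exists C, forall x, `|flat p x| <= C.
Proof.
have [C hC] := expR_dominates_poly p; exists C => x; rewrite /flat.
case: ifPn => [x0|_].
  by rewrite normrM [`|expR _|]gtr0_norm ?expR_gt0// hC// invr_ge0 ltW.
rewrite normr0; apply: le_trans (hC 0 (lexx _)).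
by rewrite mulr_ge0// expR_ge0.
Qed.

Lemma flat_mulX p x : flat p x = flat (p * 'X) x * x.
Proof.
rewrite /flat; case: ifPn => x0; last by rewrite mul0r.
rewrite hornerM hornerX; set e := expR _; set q := p.[_]; field.
by rewrite gt_eqF.
Qed.

(** Away from 0 this is the chain rule.  At 0 the difference quotient is
    again a function of the family, times x, and the members of the family are
    bounded. *)
Lemma is_derive_flat p x :
  is_derive x (1 : R) (flat p) (flat ('X^2 * (p - p^`())) x).
Proof.
have [x0|x0|->] := ltgtP x 0.
- rewrite [X in is_derive _ _ _ X](_ : _ = 0); last by rewrite /flat lt_gtF.
  apply: (near_eq_is_derive (f := (cst 0 : R -> R))).
  near=> y; rewrite /flat lt_gtF//; near: y; exact: lt_nbhsl.
- pose F := (horner p \o (fun y : R => y^-1)) * (expR \o (fun y : R => - y^-1)).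
  apply: (near_eq_is_derive (f := F)).
    near=> y; rewrite /flat /F ifT//; near: y; exact: lt_nbhsr.
  have dV : is_derive x (1 : R) (fun y : R => y^-1) (- x ^- 2 *: (1 : R)).
    by apply: is_deriveV; rewrite gt_eqF.
  have d1 := is_derive1_comp (is_derive_poly p x^-1) dV.
  have dN : is_derive x (1 : R) (fun y : R => - y^-1) (- (- x ^- 2 *: (1 : R))).
    exact: is_deriveN.
  have d2 := @is_derive1_comp _ _ (fun y : R => - y^-1) _ _ _
    (is_derive_expR (- x^-1)) dN.
  apply: is_derive_eq (is_deriveM d1 d2) _.
  rewrite /flat x0 /= hornerM hornerD hornerN hornerXn /comp.
  rewrite /GRing.scale /=  mulr1 opprK exprVn; ring.
- have [C hC] := flat_bounded (p * 'X * 'X).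
  rewrite [X in is_derive _ _ _ X](_ : _ = 0); last by rewrite /flat ltxx.
  apply/is_derive1_caratheodory; exists (flat (p * 'X)); split.
  + by move=> z; rewrite [flat p 0]/flat ltxx !subr0 flat_mulX.
  + apply/cvgrPdist_le => e e0; near=> y.
    rewrite [flat _ 0]/flat ltxx sub0r normrN flat_mulX normrM.
    apply: (@le_trans _ _ (`|C| * `|y|)).
      by rewrite ler_wpM2r// (le_trans (hC y))// ler_norm.
    have C1 : 0 < `|C| + 1 by rewrite ltr_wpDl.
    apply: (@le_trans _ _ ((`|C| + 1) * `|y|)).
      by rewrite ler_wpM2r// lerDl.
    rewrite -ler_pdivlMl//; near: y.
    by apply: (@nbhs0_le R R); rewrite mulr_gt0 ?invr_gt0.
  + by rewrite /flat ltxx.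
Unshelve. all: end_near. Qed.

Definition bump0 (x : R) : R := flat 1 x.

Lemma smooth1_bump0 : smooth1 bump0.
Proof.
suff H n : forall p, times_derivable n (flat p) by move=> n; exact: H.
elim: n => [//|n IH] p; exists (flat ('X^2 * (p - p^`()))) => // x.
exact: is_derive_flat.
Qed.

Lemma bump0_gt0 x : (0 < bump0 x) = (0 < x).
Proof.
rewrite /bump0 /flat; case: ifPn => x0; last by rewrite ltxx.
by rewrite hornerC mul1r expR_gt0.
Qed.

Lemma bump0_ge0 x : 0 <= bump0 x.
Proof.
rewrite /bump0 /flat; case: ifPn => x0 //.
by rewrite hornerC mul1r expR_ge0.
Qed.

Lemma bump0_neq0 x : bump0 x != 0 -> 0 < x.
Proof. by rewrite -bump0_gt0 lt_neqAle eq_sym bump0_ge0 andbT. Qed.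

End SmoothFunctionsOfOneVariable.

(** * Measurability and integration *)
Section MeasurabilityOfSeparatelyRegularFunctions.
Context d (T : measurableType d) (R : realType).

Lemma measurable_floor_preimage (a : R) (k : int) : 0 < a ->
  measurable [set y : R | Num.floor (a * y) = k].
Proof.
move=> a0; rewrite (_ : [set _ | _] = `[(k%:~R / a), ((k + 1)%:~R / a)[%classic).
  exact: measurable_itv.
apply/seteqP; split => y /=.
  move=> <-; rewrite in_itv/= ler_pdivrMr// ltr_pdivlMr// mulrC.
  exact: floor_itv.
rewrite in_itv/= ler_pdivrMr// ltr_pdivlMr// mulrC => /andP[h1 h2].
by apply: floor_def; rewrite h1 h2.
Qed.

(** Rounding the continuous variable down to a grid gives functions that are
    measurable because they take countably many measurable forms; the grid is
    then refined. *)
Lemma caratheodory_measurable (f : T * R -> R) :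
  (forall y, measurable_fun setT (fun x => f (x, y))) ->
  (forall x, continuous (fun y => f (x, y))) ->
  measurable_fun setT f.
Proof.
move=> mf cf.
pose a n : R := n.+1%:R.
have a0 n : 0 < a n by rewrite ltr0n.
pose rd n (y : R) : R := (Num.floor (a n * y))%:~R / a n.
apply: (measurable_fun_cvg (h := fun n p => f (p.1, rd n p.2))) => [n|[x y] _].
  move=> _ B mB; rewrite setTI.
  rewrite (_ : _ @^-1` _ = \bigcup_(k : int)
     (((fun x => f (x, k%:~R / a n)) @^-1` B) `*`
      [set y : R | Num.floor (a n * y) = k])).
    apply: countable_bigcupT_measurable => [|k]; first exact: countableP.
    apply: measurableX; last exact: measurable_floor_preimage.
    by rewrite -[X in measurable X]setTI; exact: mf.
  apply/seteqP; split => [[x y] /= Bf|[x y] [k _] [/= Bf kE]].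
    by exists (Num.floor (a n * y)).
  by rewrite /rd /= kE.
apply: (continuous_cvg _ (cf x y)).
apply/cvgrPdist_le => e e0; near=> n.
have /andP[h1 h2] := floor_itv (a n * y).
rewrite /rd /= ger0_norm; last by rewrite subr_ge0 ler_pdivrMr ?a0 1?[leRHS]mulrC.
apply: (@le_trans _ _ (a n)^-1).
  rewrite lerBlDr -[X in X + _]mul1r -mulrDl ler_pdivlMr// mulrC.
  by rewrite (le_trans (ltW h2))// intrD addrC.
near: n; have [n0 _ hn] := near_infty_natSinv_lt (PosNum e0).
by exists n0 => // n /hn/ltW.
Unshelve. all: end_near. Qed.

End MeasurabilityOfSeparatelyRegularFunctions.

Section IntegralGeneralities.
Context d (T : measurableType d) (R : realType).
Variable mu : {measure set T -> \bar R}.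

Import HBNNSimple.

Let le_integral_off_null (f g : T -> \bar R) (N : set T) :
  (forall x, 0 <= f x)%E -> (forall x, 0 <= g x)%E ->
  measurable N -> mu N = 0%E -> (forall x, ~ N x -> f x = g x) ->
  (\int[mu]_x f x <= \int[mu]_x g x)%E.
Proof.
move=> f0 g0 mN N0 fg; rewrite [leLHS]ge0_integralTE//.
apply: ge_ereal_sup => _ [h /= hf <-].
pose h' := proj_nnsfun h (measurableC mN).
have -> : sintegral mu h = sintegral mu h'.
  rewrite -!integralT_nnsfun; apply: ae_eq_integral => //.
  - exact/measurable_EFinP.
  - exact/measurable_EFinP.
  exists N; split => // x /= hx; apply: contrapT => Nx; apply: hx => _.
  by congr EFin; rewrite /h' /= mindicE mem_set// mulr1.
rewrite ge0_integralTE//; apply: ereal_sup_ubound; exists h' => //= x.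
have [Nx|Nx] := pselect (N x).
  by rewrite mindicE memNset ?mulr0//; exact.
by rewrite mindicE mem_set// mulr1 -fg.
Qed.

(** Modifying an integrand on a null set is harmless even if it is not
    measurable there: simple functions below it can be cut off on that set. *)
Lemma ae_congr_integral (D : set T) (f g : T -> \bar R) :
  {ae mu, forall x, D x -> f x = g x} ->
  (\int[mu]_(x in D) f x = \int[mu]_(x in D) g x)%E.
Proof.
move=> [N [mN N0 fg]].
have fgN x : ~ N x -> (f \_ D) x = (g \_ D) x.
  move=> Nx; rewrite !patchE; case: ifPn => // /set_mem Dx.
  by apply: contrapT => h; apply: Nx; apply: fg => /= /(_ Dx).
rewrite integral_mkcond [RHS]integral_mkcond integralE [RHS]integralE.
by congr (_ - _)%E; apply/eqP; rewrite eq_le; apply/andP; split;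
  apply: (le_integral_off_null _ _ mN N0) => // x Nx;
  rewrite ?funeposE ?funenegE fgN.
Qed.

Lemma ae_congr_Rintegral (D : set T) (f g : T -> R) :
  {ae mu, forall x, D x -> f x = g x} ->
  \int[mu]_(x in D) f x = \int[mu]_(x in D) g x.
Proof.
move=> fg; rewrite /Rintegral; congr fine; apply: ae_congr_integral.
by apply: filterS fg => x h /h ->.
Qed.

Lemma bounded_integrable (A : set T) (f : T -> R) (C : R) :
  measurable A -> (mu A < +oo)%E -> measurable_fun A f ->
  (forall x, A x -> `|f x| <= C) -> mu.-integrable A (EFin \o f).
Proof.
move=> mA fA mf fC; apply: measurable_bounded_integrable => //.
exists C; split; first exact: num_real.
by move=> M CM x Ax; exact: le_trans (fC _ Ax) (ltW CM).
Qed.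

Lemma EFin_Rintegral (A : set T) (f : T -> R) : measurable A ->
  mu.-integrable A (EFin \o f) ->
  (\int[mu]_(x in A) f x)%:E = (\int[mu]_(x in A) (f x)%:E)%E.
Proof. by move=> mA fi; rewrite fineK//; exact: integrable_fin_num. Qed.

Lemma Rintegral_sum (I : Type) (s : seq I) (A : set T) (f : I -> T -> R) :
  measurable A -> (forall i, mu.-integrable A (EFin \o f i)) ->
  \int[mu]_(x in A) (\sum_(i <- s) f i x) = \sum_(i <- s) \int[mu]_(x in A) f i x
  /\ mu.-integrable A (EFin \o (fun x => \sum_(i <- s) f i x)).
Proof.
move=> mA fi; elim: s => [|i s [IH1 IH2]].
  rewrite big_nil; split.
    under eq_Rintegral do rewrite big_nil.
    by rewrite Rintegral_cst// mul0r.
  rewrite [X in integrable _ _ X](_ : _ = cst 0%E); first exact: integrable0.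
  by apply/funext => x; rewrite /= big_nil.
have -> : (fun x => \sum_(j <- (i :: s)) f j x) =
          (fun x => f i x + \sum_(j <- s) f j x).
  by apply/funext => x; rewrite big_cons.
split; first by rewrite big_cons RintegralD// IH1.
rewrite [X in integrable _ _ X](_ : _ =
  ((EFin \o f i) \+ (EFin \o (fun x => (\sum_(j <- s) f j x)%R)))%E) //.
exact: integrableD.
Qed.

End IntegralGeneralities.

Section BoundedFubini.
Context d1 d2 (T1 : measurableType d1) (T2 : measurableType d2) (R : realType).
Variables (m1 : {sigma_finite_measure set T1 -> \bar R})
  (m2 : {sigma_finite_measure set T2 -> \bar R}).
Variables (A : set T1) (B : set T2).
Hypotheses (mA : measurable A) (mB : measurable B).
Hypotheses (fA : (m1 A < +oo)%E) (fB : (m2 B < +oo)%E).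

Lemma finite_product_measure : ((m1 \x m2)%E (A `*` B) < +oo)%E.
Proof. by rewrite product_measure1E// lte_mul_pinfty// ge0_fin_numE. Qed.

Variables (f : T1 * T2 -> R) (C : R).
Hypotheses (mf : measurable_fun setT f)
  (fC : forall x y, A x -> B y -> `|f (x, y)| <= C).

Let f' := (EFin \o f) \_ (A `*` B).

Let intf : (m1 \x m2)%E.-integrable (A `*` B) (EFin \o f).
Proof.
apply: (@bounded_integrable _ _ _ _ _ _ C).
- exact: measurableX.
- exact: finite_product_measure.
- exact: measurable_funTS.
- by move=> [x y] [Ax By]; exact: fC.
Qed.

Let intf' : (m1 \x m2)%E.-integrable setT f'.
Proof. by apply/(integrable_mkcond (EFin \o f)); [exact: measurableX|]. Qed.

Lemma bounded_Fubini1 :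
  \int[(m1 \x m2)%E]_(z in A `*` B) f z =
  \int[m1]_(x in A) \int[m2]_(y in B) f (x, y).
Proof.
rewrite /Rintegral; congr fine.
rewrite integral_mkcond -(fubini1 intf') [RHS]integral_mkcond.
apply: eq_integral => x _; rewrite /fubini_F patchE.
case: ifPn => [/set_mem Ax|nAx].
  rewrite -EFin_Rintegral//; last first.
    apply: (@bounded_integrable _ _ _ _ _ _ C) => //; last by move=> y; exact: fC.
    by apply: measurable_funTS; exact: measurable_fun_pair2.
  rewrite EFin_Rintegral//; last first.
    apply: (@bounded_integrable _ _ _ _ _ _ C) => //; last by move=> y; exact: fC.
    by apply: measurable_funTS; exact: measurable_fun_pair2.
  rewrite [RHS]integral_mkcond; apply: eq_integral => y _.
  rewrite /f' !patchE; congr (if _ then _ else _).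
  by apply/idP/idP => /set_mem h; apply/mem_set; [case: h|].
rewrite integral0_eq// => y _; rewrite /f' patchE memNset// => -[/= Ax _].
by move/negP: nAx; apply; exact/mem_set.
Qed.

Lemma bounded_Fubini2 :
  \int[(m1 \x m2)%E]_(z in A `*` B) f z =
  \int[m2]_(y in B) \int[m1]_(x in A) f (x, y).
Proof.
rewrite /Rintegral; congr fine.
rewrite integral_mkcond -(fubini2 intf') [RHS]integral_mkcond.
apply: eq_integral => y _; rewrite /fubini_G patchE.
case: ifPn => [/set_mem By|nBy].
  rewrite -EFin_Rintegral//; last first.
    apply: (@bounded_integrable _ _ _ _ _ _ C) => //; last by move=> x Ax; exact: fC.
    by apply: measurable_funTS; exact: measurable_fun_pair1.
  rewrite EFin_Rintegral//; last first.
    apply: (@bounded_integrable _ _ _ _ _ _ C) => //; last by move=> x Ax; exact: fC.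
    by apply: measurable_funTS; exact: measurable_fun_pair1.
  rewrite [RHS]integral_mkcond; apply: eq_integral => x _.
  rewrite /f' !patchE; congr (if _ then _ else _).
  by apply/idP/idP => /set_mem h; apply/mem_set; [case: h|].
rewrite integral0_eq// => x _; rewrite /f' patchE memNset// => -[/= _ By].
by move/negP: nBy; apply; exact/mem_set.
Qed.

End BoundedFubini.

Section ModulusOfContinuity.
Variable R : realType.
Variables (b : R -> R) (p q : R).
Hypotheses (pq : p <= q) (cb : {within `[p, q], continuous b}).

(** A function continuous on a compact interval need not be Lipschitz, but it
    is up to an arbitrarily small error.  The bound is affine in the distance,
    so it can be integrated against an L1 distance. *)
Lemma continuity_modulus (e : R) : 0 < e -> exists2 C : R, 0 <= C &
  forall x y, p <= x <= q -> p <= y <= q -> `|b x - b y| <= e + C * `|x - y|.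
Proof.
move=> e0.
have cbP x : p <= x <= q -> forall r : R, 0 < r -> exists2 d : R, 0 < d &
    forall y, p <= y <= q -> `|x - y| < d -> `|b x - b y| < r.
  move=> xpq r r0.
  have /subspace_continuousP/(_ x) := cb.
  rewrite /= in_itv/= xpq => /(_ isT)/cvgrPdist_lt/(_ r r0).
  rewrite near_withinE => /nbhs_ballP[d /= d0 hd]; exists d => // y ypq xy.
  by apply: hd => //=; rewrite in_itv.
have : \forall d \near 0^'+, `[p, q] `<=` (fun x => forall y, p <= y <= q ->
    `|x - y| < d -> `|b x - b y| <= e).
  have /compact_near_coveringP/near_covering_withinP cc := @segment_compact R p q.
  apply: (cc _ (0 : R)^'+ (fun d x => forall y, p <= y <= q ->
    `|x - y| < d -> `|b x - b y| <= e)) => x xpq.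
  rewrite /= in_itv/= in xpq.
  have [d d0 hd] := cbP x xpq (e / 2) (divr_gt0 e0 (ltr0Sn _ 1)).
  have d2 : 0 < d / 2 by rewrite divr_gt0.
  exists ([set x' | `|x - x'| < d / 2], [set d' | d' < d / 2]) => /=.
    split; first by apply/nbhs_ballP; exists (d / 2).
    exact: nbhs_right_lt.
  move=> [x' d'] /= [xx' dd'] x'pq y ypq x'y.
  rewrite in_itv/= in x'pq.
  have h1 : `|b x - b x'| < e / 2 by apply: hd => //; lra.
  have h2 : `|b x - b y| < e / 2.
    apply: hd => //; rewrite -(subrKA x') (le_lt_trans (ler_normD _ _))//; lra.
  rewrite -(subrKA (b x)) (le_trans (ler_normD _ _))// distrC; lra.
move=> [d0 /= d00 hd0].
pose d := d0 / 2.
have d1 : 0 < d by rewrite divr_gt0.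
have hd x y : p <= x <= q -> p <= y <= q -> `|x - y| < d -> `|b x - b y| <= e.
  move=> xpq ypq; apply: (hd0 d) => //=.
  by rewrite sub0r normrN gtr0_norm// /d ltr_pdivrMr// ltr_pMr// ltr1n.
have [x1 _ hM] := EVT_max pq cb.
have [x2 _ hm] := EVT_min pq cb.
(* Points at distance at least [d] are handled by the oscillation of [b],
   which is at most its quotient by [d] times the distance. *)
have bnd x y : p <= x <= q -> p <= y <= q -> `|b x - b y| <= b x1 - b x2.
  move=> xpq ypq.
  have := hM x; have := hM y; have := hm x; have := hm y.
  rewrite !in_itv/= xpq ypq => /(_ isT) ? /(_ isT) ? /(_ isT) ? /(_ isT) ?.
  by rewrite ler_norml; apply/andP; split; lra.
have BB : 0 <= b x1 - b x2.
  by apply: le_trans (bnd p p _ _) => //; rewrite lexx.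
exists ((b x1 - b x2) / d); first by rewrite divr_ge0// ltW.
move=> x y xpq ypq; have [xy|xy] := ltP `|x - y| d.
  rewrite (le_trans (hd _ _ xpq ypq xy))// lerDl.
  by apply: mulr_ge0 => //; rewrite divr_ge0// (ltW d1).
rewrite (le_trans (bnd _ _ xpq ypq))//.
rewrite -[leLHS]add0r lerD ?(ltW e0)// -mulrA.
by apply: ler_peMr => //; rewrite ler_pdivlMl// mulr1.
Qed.

(** The nearest point of the interval: composing with it extends a continuous
    function on the interval to the line, and redefines a function on a null
    set so that bounds hold everywhere. *)
Definition clamp (x : R) : R := Num.max p (Num.min q x).

Lemma clampE x : clamp x = if x < p then p else if q < x then q else x.
Proof.
rewrite /clamp /Num.max /Num.min.
have pq' := pq.
by case: (ltP q x) => ?; case: (ltP x p) => ?; case: ltP => ?; lra.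
Qed.

Lemma clamp_itv x : p <= clamp x <= q.
Proof.
rewrite clampE; case: (ltP x p) => ?; first by rewrite lexx.
by case: (ltP q x) => ?; [rewrite lexx pq|apply/andP; split].
Qed.

Lemma clamp_id x : p <= x <= q -> clamp x = x.
Proof.
by rewrite clampE => /andP[? ?]; case: ltP => ?; [|case: ltP => ?]; lra.
Qed.

Lemma clamp_lip x y : `|clamp x - clamp y| <= `|x - y|.
Proof.
have pq' := pq; rewrite !clampE ler_norml; apply/andP; split.
all: have [?|?] := ger0P (x - y); case: (ltP x p) => ?; case: (ltP y p) => ?;
  case: (ltP q x) => ?; case: (ltP q y) => ?; lra.
Qed.

Lemma continuous_clamp : continuous (b \o clamp).
Proof.
move=> x; apply/cvgrPdist_le => e e0.
have e2 : 0 < e / 2 by rewrite divr_gt0.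
have [C C0 hC] := continuity_modulus e2.
have C1 : 0 < C + 1 by rewrite ltr_wpDl.
near=> y; rewrite /= (le_trans (hC _ _ (clamp_itv x) (clamp_itv y)))//.
have xy : `|x - y| <= e / 2 / (C + 1).
  near: y; apply: cvgr_dist_le; first exact: cvg_id.
  by rewrite divr_gt0.
have : C * `|clamp x - clamp y| <= e / 2.
  apply: (@le_trans _ _ ((C + 1) * `|x - y|)).
    by rewrite ler_pM// ?clamp_lip// lerDl.
  by rewrite mulrC -ler_pdivlMr.
lra.
Unshelve. all: end_near. Qed.

End ModulusOfContinuity.

Lemma measurable_clamp (R : realType) (p q : R) : p <= q ->
  measurable_fun setT (clamp p q : measurableTypeR R -> measurableTypeR R).
Proof.
move=> pq; have ci : {within `[p, q], continuous (id : R -> R)}.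
  by apply: continuous_subspaceT => ?.
exact: (continuous_measurable_fun (continuous_clamp pq ci)).
Qed.

Lemma measurable_dist d (T : measurableType d) (R : realType) (D : set T) (f g : T -> R) :
  measurable_fun D f -> measurable_fun D g ->
  measurable_fun D (fun x => (`|f x - g x|)%:E).
Proof.
move=> mf mg; apply/measurable_EFinP.
by apply: measurableT_comp => //; exact: measurable_funB.
Qed.

(** * Kernels approximating the identity *)
Section VanishingSequences.
Variable R : realType.
Implicit Types u v : nat -> \bar R.

(** Smallness of a sequence of extended reals up to errors, the form in which
    the approximation arguments below produce and consume limits. *)
Definition vanishes u :=
  forall e : R, 0 < e -> \forall m \near \oo, (u m <= e%:E)%E.

Lemma vanishes_le u v : (\forall m \near \oo, (u m <= v m)%E) ->
  vanishes v -> vanishes u.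
Proof. by move=> uv v0 e /v0; apply: filterS2 uv => m; exact: le_trans. Qed.

Lemma vanishesD u v : vanishes u -> vanishes v ->
  vanishes (fun m => (u m + v m)%E).
Proof.
move=> u0 v0 e e0; have e2 : 0 < e / 2 by rewrite divr_gt0.
apply: filterS2 (u0 _ e2) (v0 _ e2) => m um vm.
by rewrite [e]splitr EFinD leeD.
Qed.

Lemma vanishesZ (k : R) u : 0 <= k -> vanishes u ->
  vanishes (fun m => (k%:E * u m)%E).
Proof.
move=> k0 u0 e e0; have k1 : 0 < k + 1 by rewrite ltr_wpDl.
apply: filterS (u0 (e / (k + 1)) (divr_gt0 e0 k1)) => m um.
apply: (@le_trans _ _ (k%:E * (e / (k + 1))%:E)%E); first exact: lee_wpmul2l.
rewrite -EFinM lee_fin mulrCA ler_piMr//; first exact: ltW.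
by rewrite ler_pdivrMr// mul1r lerDl.
Qed.

Lemma vanishes0 : vanishes (fun=> 0%E).
Proof. by move=> e e0; near=> m; rewrite lee_fin ltW. Unshelve. all: end_near. Qed.

Lemma vanishes_approx u : (forall e : R, 0 < e ->
  exists2 v, vanishes v & \forall m \near \oo, (u m <= v m + e%:E)%E) ->
  vanishes u.
Proof.
move=> h e e0; have e2 : 0 < e / 2 by rewrite divr_gt0.
have [v v0 uv] := h _ e2.
apply: filterS2 uv (v0 _ e2) => m um vm.
by rewrite (le_trans um)// [in leRHS](splitr e) EFinD leeD.
Qed.

Lemma cvg_vanishes u : u @ \oo --> 0%E -> vanishes u.
Proof.
move=> /fine_cvgP[uf u0] e e0; move/cvgrPdist_le : u0 => /(_ e e0).
apply: filterS2 uf => m uf; rewrite sub0r normrN /= => h.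
by rewrite -(fineK uf) lee_fin (le_trans (ler_norm _)).
Qed.

End VanishingSequences.

Section ApproximateIdentity.
Context d (T : measurableType d) (R : realType).
Variable mu : {sigma_finite_measure set T -> \bar R}.
Variables (K : nat -> T * T -> R) (A : set T).
Hypotheses (mA : measurable A) (fA : (mu A < +oo)%E).
Hypotheses (mK : forall m, measurable_fun setT (K m))
  (K0 : forall m p, 0 <= K m p).
(* Kernels cut off to [A]: the masses in each variable are at most one. *)
Hypotheses
  (K1 : forall m w, (\int[mu]_z (K m (z, w))%:E <= (\1_A w)%:E)%E)
  (K2 : forall m z, (\int[mu]_w (K m (z, w))%:E <= (\1_A z)%:E)%E).

(** The weight of a function of two points, which the kernel forces to be
    close to each other; all errors of the approximation are such weights. *)
Definition weight m (F : T * T -> R) : \bar R :=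
  (\int[(mu \x mu)%E]_p (F p * K m p)%:E)%E.

Lemma weight_le m (F G : T * T -> R) : measurable_fun setT F ->
  measurable_fun setT G -> (forall p, 0 <= F p) -> (forall p, F p <= G p) ->
  (weight m F <= weight m G)%E.
Proof.
move=> mF mG F0 FG; apply: ge0_le_integral => //.
- by move=> p _; rewrite lee_fin mulr_ge0.
- exact/measurable_EFinP/measurable_funM.
- exact/measurable_EFinP/measurable_funM.
- by move=> p _; rewrite lee_fin ler_wpM2r.
Qed.

Lemma weightD m (F G : T * T -> R) : measurable_fun setT F ->
  measurable_fun setT G -> (forall p, 0 <= F p) -> (forall p, 0 <= G p) ->
  weight m (fun p => F p + G p) = (weight m F + weight m G)%E.
Proof.
move=> mF mG F0 G0; rewrite /weight -ge0_integralD//.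
- by apply: eq_integral => p _; rewrite mulrDl EFinD.
- by move=> p _; rewrite lee_fin mulr_ge0.
- exact/measurable_EFinP/measurable_funM.
- by move=> p _; rewrite lee_fin mulr_ge0.
- exact/measurable_EFinP/measurable_funM.
Qed.

Lemma weightZ m (k : R) (F : T * T -> R) : 0 <= k -> measurable_fun setT F ->
  (forall p, 0 <= F p) -> weight m (fun p => k * F p) = (k%:E * weight m F)%E.
Proof.
move=> k0 mF F0; rewrite /weight -ge0_integralZl//.
- by apply: eq_integral => p _; rewrite -mulrA EFinM.
- exact/measurable_EFinP/measurable_funM.
- by move=> p _; rewrite lee_fin mulr_ge0.
Qed.

Lemma weight_fst m (g : T -> R) : measurable_fun setT g -> (forall z, 0 <= g z) ->
  (weight m (fun p => g p.1) <= \int[mu]_(z in A) (g z)%:E)%E.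
Proof.
move=> mg g0; rewrite /weight fubini_tonelli1//=; last 2 first.
- by apply/measurable_EFinP/measurable_funM => //; exact: measurableT_comp.
- by move=> p; rewrite lee_fin mulr_ge0.
rewrite [leRHS]integral_mkcond; apply: ge0_le_integral => //.
- by move=> z _; apply: integral_ge0 => w _; rewrite lee_fin mulr_ge0.
- apply: measurable_fun_fubini_tonelli_F => //=.
    by apply/measurable_EFinP/measurable_funM => //; exact: measurableT_comp.
  by move=> p; rewrite lee_fin mulr_ge0.
- apply/(measurable_restrictT _ _).1 => //.
  exact/measurable_EFinP/measurable_funTS.
move=> z _; rewrite /fubini_F /=.
under eq_integral do rewrite EFinM.
rewrite ge0_integralZl//; last 3 first.
- by apply/measurable_EFinP; exact: (measurable_fun_pair2 z (mK m)).
- by move=> w _; rewrite lee_fin.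
- by rewrite lee_fin.
rewrite (le_trans (lee_wpmul2l _ (K2 m z)))//; first by rewrite lee_fin.
by rewrite patchE indicE; case: ifPn; rewrite ?mule1 ?mule0.
Qed.

Lemma weight_snd m (g : T -> R) : measurable_fun setT g -> (forall z, 0 <= g z) ->
  (weight m (fun p => g p.2) <= \int[mu]_(z in A) (g z)%:E)%E.
Proof.
move=> mg g0; rewrite /weight fubini_tonelli2//=; last 2 first.
- by apply/measurable_EFinP/measurable_funM => //; exact: measurableT_comp.
- by move=> p; rewrite lee_fin mulr_ge0.
rewrite [leRHS]integral_mkcond; apply: ge0_le_integral => //.
- by move=> z _; apply: integral_ge0 => w _; rewrite lee_fin mulr_ge0.
- apply: measurable_fun_fubini_tonelli_G => //=.
    by apply/measurable_EFinP/measurable_funM => //; exact: measurableT_comp.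
  by move=> p; rewrite lee_fin mulr_ge0.
- apply/(measurable_restrictT _ _).1 => //.
  exact/measurable_EFinP/measurable_funTS.
move=> z _; rewrite /fubini_G /=.
under eq_integral do rewrite EFinM.
rewrite ge0_integralZl//; last 3 first.
- by apply/measurable_EFinP; exact: (measurable_fun_pair1 z (mK m)).
- by move=> w _; rewrite lee_fin.
- by rewrite lee_fin.
rewrite (le_trans (lee_wpmul2l _ (K1 m z)))//; first by rewrite lee_fin.
by rewrite patchE indicE; case: ifPn; rewrite ?mule1 ?mule0.
Qed.

(** The total weight of a sum of one-variable functions is controlled by
    their integrals because both marginals of the kernel are at most one; this
    bounds the error of replacing a function by an approximation of it. *)
Lemma weight_diff m (g : T -> R) (F : T * T -> R) : measurable_fun setT g ->
  (forall z, 0 <= g z) -> measurable_fun setT F -> (forall p, 0 <= F p) ->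
  (forall p, F p <= g p.1 + g p.2) ->
  (weight m F <= 2%:E * \int[mu]_(z in A) (g z)%:E)%E.
Proof.
move=> mg g0 mF F0 Fg.
have mg1 : measurable_fun setT (fun p : T * T => g p.1).
  exact: measurableT_comp.
have mg2 : measurable_fun setT (fun p : T * T => g p.2).
  exact: measurableT_comp.
apply: (@le_trans _ _ (weight m (fun p => g p.1 + g p.2))).
  by apply: weight_le => //; exact: measurable_funD.
rewrite weightD// [in leRHS](_ : 2 = 1 + 1)//.
rewrite EFinD ge0_muleDl// ?lee_fin// !mul1e leeD//.
  exact: weight_fst.
exact: weight_snd.
Qed.

(** The sets whose indicator the kernel does not blur in the limit.  They form
    a sigma-algebra, so it is enough to find generators among them. *)
Definition sharp (E : set T) : Prop :=
  measurable E /\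
  vanishes (fun m => weight m (fun p => `|\1_E p.1 - \1_E p.2|)).

Let measurable_indic_diff (E : set T) : measurable E ->
  measurable_fun setT (fun p : T * T => `|\1_E p.1 - \1_E p.2| : R).
Proof.
move=> mE; have mE1 : measurable_fun setT (\1_E : T -> R) by exact: measurable_indic.
apply: measurableT_comp => //; apply: measurable_funB.
  exact: (measurableT_comp mE1).
exact: (measurableT_comp mE1).
Qed.

Lemma sharp_setC E : sharp E -> sharp (~` E).
Proof.
move=> [mE sE]; split; first exact: measurableC.
suff -> : (fun m => weight m (fun p => `|\1_(~` E) p.1 - \1_(~` E) p.2|)) =
          (fun m => weight m (fun p => `|\1_E p.1 - \1_E p.2|)) by [].
apply/funext => m; congr (weight m _); apply/funext => p.
rewrite !indicE !in_setC.
by case: (_ \in _); case: (_ \in _) => /=;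
  rewrite ?subrr// ?subr0 ?sub0r ?normrN.
Qed.

Lemma sharp0 : sharp set0.
Proof.
split; first exact: measurable0.
apply: vanishes_le (@vanishes0 R); near=> m.
rewrite /weight integral0_eq// => p _.
by rewrite !indicE !in_set0 subrr normr0 mul0r.
Unshelve. all: end_near. Qed.

Lemma sharp_setU E F : sharp E -> sharp F -> sharp (E `|` F).
Proof.
move=> [mE sE] [mF sF]; split; first exact: measurableU.
apply: vanishes_le (vanishesD sE sF); near=> m.
rewrite -weightD//; [|exact: measurable_indic_diff..].
apply: weight_le => //.
- by apply: measurable_indic_diff; exact: measurableU.
- by apply: measurable_funD; exact: measurable_indic_diff.
move=> p; rewrite !indicE !in_setU.
by do 4 case: (_ \in _) => /=;
  rewrite ?subrr ?subr0 ?sub0r ?normrN ?normr0 ?normr1 ?addr0 ?add0r ?ler01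
    ?lexx ?lerDl.
Unshelve. all: end_near. Qed.

(** The tail of the union has small measure in [A], so its indicator weighs
    little, and the finite unions are sharp. *)
Lemma sharp_bigcup (E : nat -> set T) : (forall i, sharp (E i)) ->
  sharp (\bigcup_i E i).
Proof.
move=> sE; have mE i : measurable (E i) by have [] := sE i.
have mU : measurable (\bigcup_i E i) by exact: bigcup_measurable.
split=> //; apply: vanishes_approx => e e0.
pose F n := \big[setU/set0]_(i < n) E i.
have sF n : sharp (F n).
  by rewrite /F; elim/big_rec : _ => [|i B _ sB]; [exact: sharp0|exact: sharp_setU].
have mF n : measurable (F n) by have [] := sF n.
pose D n := (\bigcup_i E i `\` F n) `&` A.
have mD n : measurable (D n) by apply: measurableI => //; exact: measurableD.
have : (mu \o D) @ \oo --> mu (\bigcap_n D n).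
  apply: nonincreasing_cvg_mu => //.
  - by rewrite (le_lt_trans _ fA)// le_measure ?inE//; exact: subIsetr.
  - exact: bigcap_measurable.
  - move=> m n mn; apply/subsetPset; apply: setSI; apply: setDS.
    exact: subset_bigsetU.
rewrite (_ : \bigcap_n D n = set0) ?measure0; last first.
  apply/seteqP; split => // x xD.
  have [[[i _ Eix] _] _] := xD 0%N I.
  have [[_ nF] _] := xD i.+1 I.
  by apply: nF; rewrite /F big_ord_recr; right.
move=> /cvg_vanishes/(_ (e / 2)); rewrite divr_gt0// => /(_ isT)[n _ /(_ n (leqnn _)) hn].
exists (fun m => weight m (fun p => `|\1_(F n) p.1 - \1_(F n) p.2|)).
  by have [] := sF n.
near=> m; pose G := \bigcup_i E i `\` F n.
have mG : measurable G by exact: measurableD.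
have mGG : measurable_fun setT (fun p : T * T => \1_G p.1 + \1_G p.2 : R).
  have mG1 : measurable_fun setT (\1_G : T -> R) by exact: measurable_indic.
  apply: measurable_funD; first exact: (measurableT_comp mG1).
  exact: (measurableT_comp mG1).
set dF : T * T -> R := fun p => `|\1_(F n) p.1 - \1_(F n) p.2|.
pose sG : T * T -> R := fun p => \1_G p.1 + \1_G p.2.
apply: (@le_trans _ _ (weight m dF + weight m sG)%E).
  have mdF : measurable_fun setT dF by exact: measurable_indic_diff.
  have sG0 p : 0 <= sG p by rewrite /sG addr_ge0.
  have dF0 p : 0 <= dF p by rewrite /dF.
  rewrite -weightD//.
  apply: weight_le => //; first exact: measurable_indic_diff.
    exact: measurable_funD.
  have FG x : \1_(\bigcup_i E i) x = \1_(F n) x + \1_G x :> R.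
    rewrite !indicE /G in_setD.
    have [xF|xF] := boolP (x \in F n); last by rewrite andbT add0r.
    rewrite andbF addr0 mem_set//.
    by move/set_mem : xF; rewrite /F -bigcup_mkord => -[i _ ?]; exists i.
  move=> p; rewrite /dF /sG !FG opprD addrACA (le_trans (ler_normD _ _))// lerD2l.
  by rewrite (le_trans (ler_normB _ _))// !ger0_norm.
rewrite leeD2l//.
apply: le_trans (weight_diff (g := \1_G) m _ _ mGG _ _) _ => //.
rewrite integral_indic// [e]splitr EFinD.
rewrite (_ : 2 = 1 + 1)// EFinD ge0_muleDl// ?lee_fin// !mul1e.
by rewrite leeD.
Unshelve. all: end_near. Qed.

(** Where the kernel only couples points on the same side of a set, that set
    is not blurred at all. *)
Lemma sharp_locally (E : set T) : measurable E ->
  {ae mu, forall w, \forall m \near \oo, forall z, K m (z, w) != 0 ->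
    (E z <-> E w)} -> sharp E.
Proof.
move=> mE loc; split => //.
pose F m (p : T * T) := (`|\1_E p.1 - \1_E p.2| * K m p)%:E.
have mF m : measurable_fun setT (F m).
  by apply/measurable_EFinP/measurable_funM => //; exact: measurable_indic_diff.
have F0 m p : (0 <= F m p)%E by rewrite lee_fin mulr_ge0.
have psiE m : weight m (fun p => `|\1_E p.1 - \1_E p.2|) =
    (\int[mu]_w fubini_G mu (F m) w)%E by rewrite /weight -fubini_tonelli2.
under eq_fun do rewrite psiE.
apply: cvg_vanishes.
have mpsi m : measurable_fun setT (fubini_G mu (F m)).
  exact: (measurable_fun_fubini_tonelli_G _ (mF m) (F0 m)).
have iA : mu.-integrable setT (fun w => (\1_A w)%:E).
  apply/integrableP; split; first by apply/measurable_EFinP; exact: measurable_indic.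
  rewrite (eq_integral (fun w => (\1_A w)%:E)); first by rewrite integral_indic// setIT.
  by move=> w _; rewrite /= ger0_norm.
have [] := @dominated_convergence _ _ _ mu setT measurableT
  (fun m w => fubini_G mu (F m) w) (cst 0%E) (fun w => (\1_A w)%:E) mpsi _ _ iA _.
- exact: measurable_cst.
- apply: filterS loc => w locw _; apply: cvg_near_cst.
  apply: filterS locw => m locm.
  rewrite /fubini_G integral0_eq// => z _; rewrite /F /=.
  have [->|/locm zw] := eqVneq (K m (z, w)) 0; first by rewrite mulr0.
  rewrite !indicE (_ : (z \in E) = (w \in E)) ?subrr ?normr0 ?mul0r//.
  by apply/idP/idP => /set_mem/zw/mem_set.
- apply: aeW => w m _; rewrite gee0_abs; last exact: integral_ge0.
  apply: le_trans (K1 m w); apply: ge0_le_integral => //.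
  + exact: (measurable_fun_pair1 w (mF m)).
  + by apply/measurable_EFinP; exact: (measurable_fun_pair1 w (mK m)).
  + move=> z _; rewrite lee_fin ler_piMl// !indicE.
    by case: (_ \in _); case: (_ \in _); rewrite ?subrr ?subr0 ?sub0r ?normrN ?normr0 ?normr1.
by move=> _ _; rewrite integral0.
Qed.

Lemma sharp_sigma_algebra : sigma_algebra setT sharp.
Proof.
split; [exact: sharp0| |exact: sharp_bigcup].
by move=> E sE; rewrite setTD; exact: sharp_setC.
Qed.

Hypothesis sharp_measurable : forall E, measurable E -> sharp E.

Lemma vanishes_weight_sum (I : Type) (s : seq I) (F : I -> T * T -> R) :
  (forall i, measurable_fun setT (F i)) -> (forall i p, 0 <= F i p) ->
  (forall i, vanishes (fun m => weight m (F i))) ->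
  vanishes (fun m => weight m (fun p => \sum_(i <- s) F i p)).
Proof.
move=> mF F0 vF; elim: s => [|i s IH].
  apply: vanishes_le (@vanishes0 R); near=> m.
  by rewrite /weight integral0_eq// => p _; rewrite big_nil mul0r.
have E m : weight m (fun p => \sum_(j <- i :: s) F j p) =
    (weight m (F i) + weight m (fun p => (\sum_(j <- s) F j p)%R))%E.
  rewrite -weightD//.
  - by congr (weight m _); apply/funext => p; rewrite big_cons.
  - exact: measurable_sum.
  - by move=> p; exact: sumr_ge0.
by under eq_fun do rewrite E; exact: vanishesD.
Unshelve. all: end_near. Qed.

Import HBSimple.

Let measurable_diff (f : T -> R) : measurable_fun setT f ->
  measurable_fun setT (fun p : T * T => f p.1 - f p.2).
Proof.
move=> mf; apply: measurable_funB.
  exact: (measurableT_comp mf).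
exact: (measurableT_comp mf).
Qed.

(** From sharp sets to simple functions, to integrable functions in mean, and
    to square integrable functions in mean square: each extension is an
    approximation whose error the marginal bounds control. *)
Lemma vanishes_weight_simple (s : {sfun T >-> R}) :
  vanishes (fun m => weight m (fun p => `|s p.1 - s p.2|)).
Proof.
pose r := finmap.enum_fset (fset_set (range s)).
pose G y (p : T * T) : R :=
  `|y| * `|\1_(s @^-1` [set y]) p.1 - \1_(s @^-1` [set y]) p.2|.
have mD y : measurable_fun setT
    (fun p : T * T => `|\1_(s @^-1` [set y]) p.1 - \1_(s @^-1` [set y]) p.2| : R).
  by apply: measurable_indic_diff; exact: measurable_funPTI.
have mG y : measurable_fun setT (G y) by apply: measurable_funM.
have G0 y p : 0 <= G y p by rewrite mulr_ge0.
apply: (@vanishes_le _ _ (fun m => weight m (fun p => \sum_(y <- r) G y p))).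
  near=> m; apply: weight_le => //.
  - by apply: measurableT_comp => //; apply: measurable_diff.
  - exact: measurable_sum.
  move=> p; rewrite !(fimfunE s) !fsbig_finite//= -sumrB.
  rewrite (le_trans (ler_norm_sum _ _ _))// ler_sum// => y _.
  by rewrite -mulrBr normrM.
apply: vanishes_weight_sum => // y.
rewrite (_ : (fun m => weight m (G y)) = (fun m => `|y|%:E *
    weight m (fun p => `|\1_(s @^-1` [set y]) p.1 - \1_(s @^-1` [set y]) p.2|%R))%E).
  apply: vanishesZ => //.
  by have [] := sharp_measurable (measurable_funPTI s (measurable_set1 y)).
by apply/funext => m; rewrite /G weightZ.
Unshelve. all: end_near. Qed.

Lemma vanishes_weight_integrable (f : T -> R) : measurable_fun setT f ->
  mu.-integrable A (EFin \o f) ->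
  vanishes (fun m => weight m (fun p => `|f p.1 - f p.2|)).
Proof.
move=> mf intf; apply: vanishes_approx => e e0.
have [g [_ _ fg]] := approximation_sfun_integrable mA intf.
have /(_ (e / 2)) := cvg_vanishes fg.
rewrite divr_gt0// => /(_ isT)[n _ /(_ n (leqnn _)) hn].
exists (fun m => weight m (fun p => `|g n p.1 - g n p.2|)).
  exact: vanishes_weight_simple.
near=> m; pose h x := `|f x - g n x|.
have mh : measurable_fun setT h.
  by apply: measurableT_comp => //; exact: measurable_funB.
have h0 x : 0 <= h x by rewrite /h.
have mgd : measurable_fun setT (fun p : T * T => `|g n p.1 - g n p.2|).
  by apply: measurableT_comp => //; exact: measurable_diff.
pose s2 (p : T * T) := h p.1 + h p.2.
have ms2 : measurable_fun setT s2.
  apply: measurable_funD; first exact: (measurableT_comp mh).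
  exact: (measurableT_comp mh).
have s20 p : 0 <= s2 p by rewrite addr_ge0.
apply: (@le_trans _ _
    (weight m (fun p => `|g n p.1 - g n p.2|%R) + weight m s2)%E).
  rewrite -weightD//; apply: weight_le => //.
  - by apply: measurableT_comp => //; exact: measurable_diff.
  - exact: measurable_funD.
  move=> p; rewrite /s2 /h.
  rewrite (_ : f p.1 - f p.2 = (g n p.1 - g n p.2) + ((f p.1 - g n p.1) - (f p.2 - g n p.2))).
    rewrite (le_trans (ler_normD _ _))// lerD2l.
    by rewrite (le_trans (ler_normB _ _)).
  ring.
rewrite leeD2l//; apply: le_trans (weight_diff (g := h) m _ _ ms2 _ _) _ => //.
rewrite [e]splitr EFinD (_ : 2 = 1 + 1)// EFinD ge0_muleDl// ?lee_fin// !mul1e.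
by rewrite leeD// ; under eq_integral do rewrite -EFin_normB.
Unshelve. all: end_near. Qed.

Lemma sqr_integrable_integrable (f : T -> R) : measurable_fun setT f ->
  mu.-integrable A (EFin \o (fun x => f x ^+ 2)) ->
  mu.-integrable A (EFin \o f).
Proof.
move=> mf f2.
have i1 : mu.-integrable A (EFin \o cst (1 : R)).
  by apply: (@bounded_integrable _ _ _ _ _ _ 1) => // x _; rewrite /= normr1.
apply: (le_integrable mA _ _ (integrableD mA i1 f2)).
  exact/measurable_EFinP/measurable_funTS.
move=> x _; rewrite lee_fin /= [leRHS]ger0_norm ?addr_ge0 ?sqr_ge0//.
rewrite -real_normK ?num_real//; set a := `|f x|.
(* a <= 1 + a^2 *)
have := sqr_ge0 (a - 2^-1); nra.
Qed.

Let trunc (n : nat) : R -> R := clamp (- n%:R) n%:R.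

Let trunc_le n : - n%:R <= n%:R :> R. Proof. by rewrite -subr_ge0 opprK addr_ge0. Qed.

Let trunc_bound n x : `|trunc n x| <= n%:R.
Proof. by rewrite ler_norml; exact: clamp_itv. Qed.

Let trunc_id n x : `|x| <= n%:R -> trunc n x = x.
Proof. by rewrite ler_norml; exact: clamp_id. Qed.

Let measurable_trunc n (f : T -> R) : measurable_fun setT f ->
  measurable_fun setT (fun x => trunc n (f x)).
Proof. by move=> mf; exact: (measurableT_comp (measurable_clamp (trunc_le n)) mf). Qed.

Let vanishes_trunc (f : T -> R) : measurable_fun setT f ->
  mu.-integrable A (EFin \o (fun x => f x ^+ 2)) ->
  vanishes (fun n => \int[mu]_(x in A) ((f x - trunc n (f x)) ^+ 2)%:E)%E.
Proof.
move=> mf f2; apply: cvg_vanishes.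
have mr n : measurable_fun setT (fun x => (f x - trunc n (f x)) ^+ 2).
  by apply: measurable_funX; apply: measurable_funB => //; exact: measurable_trunc.
have [] := @dominated_convergence _ _ _ mu A mA
  (fun n x => ((f x - trunc n (f x)) ^+ 2)%:E) (cst 0%E) _ _ _ _ f2 _.
- by move=> n; exact/measurable_EFinP/measurable_funTS.
- exact: measurable_cst.
- apply: aeW => x _; apply: cvg_near_cst; near=> n.
  rewrite trunc_id ?subrr ?expr0n//.
  by near: n; exact: nbhs_infty_ger.
- apply: aeW => x n _; rewrite /= lee_fin ger0_norm ?sqr_ge0//.
  rewrite -real_normK ?num_real// -[leRHS]real_normK ?num_real//.
  rewrite lerXn2r ?nnegrE//.
  have n0 : (0 : R) <= n%:R by [].
  rewrite /trunc clampE// ler_norml.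
  by have [?|?] := ger0P (f x); case: (ltP (f x) (- n%:R)) => ?;
    case: (ltP n%:R (f x)) => ?; lra.
by move=> _ _; rewrite integral0.
Unshelve. all: end_near. Qed.

(** Truncation at height n turns the square of a difference into at most 2n
    times the difference; the truncated part is small in L2. *)
Lemma vanishes_weight_sqr (f : T -> R) : measurable_fun setT f ->
  mu.-integrable A (EFin \o (fun x => f x ^+ 2)) ->
  vanishes (fun m => weight m (fun p => (f p.1 - f p.2) ^+ 2)).
Proof.
move=> mf f2; apply: vanishes_approx => e e0.
have /(_ (e / 8)) := vanishes_trunc mf f2.
rewrite divr_gt0// => /(_ isT)[n _ /(_ n (leqnn _)) hn].
pose t x := trunc n (f x); pose r x := f x - t x.
have mt : measurable_fun setT t by exact: measurable_trunc.
have mr : measurable_fun setT r by exact: measurable_funB.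
have mr2 : measurable_fun setT (fun x => 4 * r x ^+ 2).
  by apply: measurable_funM => //; exact: measurable_funX.
have mtd : measurable_fun setT (fun p : T * T => `|t p.1 - t p.2|).
  by apply: measurableT_comp => //; exact: measurable_diff.
have n0 : (0 : R) <= n%:R by [].
exists (fun m => (4 * n%:R)%:E * weight m (fun p => `|t p.1 - t p.2|%R))%E.
  apply: vanishesZ; first by rewrite mulr_ge0.
  apply: vanishes_weight_integrable => //.
  apply: (@bounded_integrable _ _ _ _ _ _ n%:R) => //; first exact: measurable_funTS.
  by move=> x _; exact: trunc_bound.
near=> m; pose s2 (p : T * T) := 4 * r p.1 ^+ 2 + 4 * r p.2 ^+ 2.
have ms2 : measurable_fun setT s2.
  apply: measurable_funD; first exact: (measurableT_comp mr2).
  exact: (measurableT_comp mr2).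
have s20 p : 0 <= s2 p by rewrite addr_ge0// mulr_ge0// sqr_ge0.
rewrite -weightZ ?mulr_ge0//.
have mG : measurable_fun setT (fun p : T * T => 4 * n%:R * `|t p.1 - t p.2|).
  exact: measurable_funM.
apply: (@le_trans _ _ (weight m (fun p => (4 * n%:R * `|t p.1 - t p.2|)%R)
    + weight m s2)%E).
  have G0 p : 0 <= 4 * n%:R * `|t p.1 - t p.2| by rewrite !mulr_ge0.
  rewrite -weightD//.
  apply: weight_le => //.
  - by apply: measurable_funX; exact: measurable_diff.
  - exact: measurable_funD.
  - by move=> p; exact: sqr_ge0.
  move=> p; rewrite /s2.
  have -> : f p.1 - f p.2 = (t p.1 - t p.2) + (r p.1 - r p.2) by rewrite /r; ring.
  have h1 : (t p.1 - t p.2) ^+ 2 <= 2 * n%:R * `|t p.1 - t p.2|.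
    rewrite -real_normK ?num_real// expr2 ler_wpM2r//.
    rewrite (le_trans (ler_normB _ _))// (_ : 2 * n%:R = n%:R + n%:R); last by ring.
    by rewrite lerD// trunc_bound.
  have := sqr_ge0 (t p.1 - t p.2 - (r p.1 - r p.2)).
  have := sqr_ge0 (r p.1 + r p.2); nra.
rewrite leeD2l//; apply: le_trans (weight_diff (g := fun x => 4 * r x ^+ 2) m _ _ ms2 _ _) _ => //.
  by move=> z; rewrite mulr_ge0// sqr_ge0.
under eq_integral do rewrite EFinM.
rewrite ge0_integralZl//=; last 2 first.
- exact/measurable_EFinP/measurable_funTS/measurable_funX.
- by move=> x _; rewrite lee_fin sqr_ge0.
rewrite muleA -EFinM.
have -> : e%:E = ((2 * 4)%:E * (e / 8)%:E)%E.
  by rewrite -EFinM; congr EFin; field.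
by rewrite lee_wpmul2l ?lee_fin.
Unshelve. all: end_near. Qed.

(* On the smaller set [B] the kernel has full mass: this excludes the points
   whose averaging window leaves [A]. *)
Variable B : set T.
Hypotheses (mB : measurable B) (BA : B `<=` A).
Hypotheses (Kb : forall m, exists C, forall p, K m p <= C)
  (Ksupp : forall m z w, ~ A z -> K m (z, w) = 0)
  (KB : forall m w, B w -> (\int[mu]_z (K m (z, w))%:E = 1)%E).

Definition average m (f : T -> R) (w : T) : R :=
  \int[mu]_(z in A) (f z * K m (z, w)).

Let integralA (g : T -> R) : (forall z, ~ A z -> g z = 0) ->
  (\int[mu]_z (g z)%:E = \int[mu]_(z in A) (g z)%:E)%E.
Proof.
move=> g0; rewrite [RHS]integral_mkcond; apply: eq_integral => z _.
by rewrite patchE; case: ifPn => // /negP nA; rewrite g0// => Az; apply/nA/mem_set.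
Qed.

Let integrableK m w (g : T -> R) : measurable_fun setT g ->
  mu.-integrable A (EFin \o g) ->
  mu.-integrable A (EFin \o (fun z => g z * K m (z, w))).
Proof.
move=> mg ig; have [C KC] := Kb m.
apply: (le_integrable mA _ _ (integrableZr mA C ig)).
  apply/measurable_EFinP/measurable_funTS/measurable_funM => //.
  exact: (measurable_fun_pair1 w (mK m)).
move=> z _; rewrite lee_fin /= !normrM ler_wpM2l//.
by rewrite !ger0_norm// (le_trans _ (KC (z, w))).
Qed.

Lemma measurable_average m (f : T -> R) : measurable_fun setT f ->
  mu.-integrable A (EFin \o f) -> measurable_fun setT (average m f).
Proof.
move=> mf intf.
pose F (p : T * T) := (f p.1 * K m p)%:E.
have mF : measurable_fun setT F.
  apply/measurable_EFinP/measurable_funM => //.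
  exact: (measurableT_comp mf).
have iF : (mu \x mu)%E.-integrable setT F.
  apply/integrableP; split => //.
  have mnf : measurable_fun setT (fun x => `|f x|) by exact: measurableT_comp.
  apply: (@le_lt_trans _ _ (\int[mu]_(z in A) `|(f z)%:E|)%E); last first.
    by have /integrableP[] := intf.
  apply: le_trans (weight_fst m mnf _) => //.
  rewrite le_eqVlt; apply/orP; left; apply/eqP; apply: eq_integral => p _.
  by rewrite /F /= normrM (ger0_norm (K0 m p)).
have -> : average m f = fine \o fubini_G mu F.
  apply/funext => w; rewrite /average /Rintegral /fubini_G /=; congr fine.
  by rewrite -integralA// => z nA; rewrite Ksupp// mulr0.
have mG := measurable_fubini_G iF.
by apply: (measurableT_comp _ mG).
Qed.

(** Jensen's inequality for the square.  With total mass one, the mean of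
    (f - s)^2 is a quadratic polynomial in s; its nonnegativity at the average
    is the inequality. *)
Lemma average_jensen m (f : T -> R) w : measurable_fun setT f ->
  mu.-integrable A (EFin \o (fun x => f x ^+ 2)) -> B w ->
  (((average m f w - f w) ^+ 2)%:E <=
    \int[mu]_z ((f z - f w) ^+ 2 * K m (z, w))%:E)%E.
Proof.
move=> mf f2 Bw.
have intf := sqr_integrable_integrable mf f2.
have mf2 : measurable_fun setT (fun x => f x ^+ 2) by exact: measurable_funX.
have ifk := integrableK m w mf intf.
have if2k := integrableK m w mf2 f2.
have i1 : mu.-integrable A (EFin \o cst (1 : R)).
  by apply: (@bounded_integrable _ _ _ _ _ _ 1) => // x _; rewrite /= normr1.
have i1k := integrableK m w (measurable_cst (1 : R)) i1.
have K1E : \int[mu]_(z in A) (cst 1 z * K m (z, w)) = 1.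
  transitivity (fine (\int[mu]_z (K m (z, w))%:E)%E); last by rewrite KB.
  rewrite integralA; last by move=> z; exact: Ksupp.
  by congr fine; apply: eq_integral => z _; rewrite mul1r.
have E s : mu.-integrable A (EFin \o (fun z => (f z - s) ^+ 2 * K m (z, w))) /\
  \int[mu]_(z in A) ((f z - s) ^+ 2 * K m (z, w)) =
  \int[mu]_(z in A) (f z ^+ 2 * K m (z, w)) - 2 * s * average m f w + s ^+ 2.
  pose a z := f z ^+ 2 * K m (z, w).
  pose b z := 2 * s * (f z * K m (z, w)).
  pose c z := s ^+ 2 * (cst 1 z * K m (z, w)).
  have ib : mu.-integrable A (EFin \o b).
    by move: (integrableZl mA (2 * s) ifk); apply: eq_integrable.
  have ic : mu.-integrable A (EFin \o c).
    by move: (integrableZl mA (s ^+ 2) i1k); apply: eq_integrable.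
  have iab : mu.-integrable A (EFin \o (fun z => a z - b z)).
    by move: (integrableB mA if2k ib); apply: eq_integrable.
  have -> : (fun z => (f z - s) ^+ 2 * K m (z, w)) = (fun z => a z - b z + c z).
    by apply/funext => z; rewrite /a /b /c /=; ring.
  split; first by move: (integrableD mA iab ic); apply: eq_integrable.
  rewrite RintegralD// RintegralB//; congr (_ - _ + _).
    by rewrite RintegralZl.
  by rewrite RintegralZl// K1E mulr1.
rewrite integralA; last by move=> z nA; rewrite Ksupp// mulr0.
have [iw Ew] := E (f w).
rewrite -EFin_Rintegral// lee_fin Ew.
have [_ Ea] := E (average m f w).
have : 0 <= \int[mu]_(z in A) ((f z - average m f w) ^+ 2 * K m (z, w)).
  by apply: Rintegral_ge0 => z _; rewrite mulr_ge0// sqr_ge0.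
rewrite Ea; nra.
Qed.

(** By Jensen the squared error of the average at a point is at most the mean
    of the squared differences, whose integral is a vanishing weight. *)
Theorem vanishes_average (f : T -> R) : measurable_fun setT f ->
  mu.-integrable A (EFin \o (fun x => f x ^+ 2)) ->
  vanishes (fun m => \int[mu]_(w in B) ((average m f w - f w) ^+ 2)%:E)%E.
Proof.
move=> mf f2; apply: vanishes_le (vanishes_weight_sqr mf f2).
have mD : measurable_fun setT (fun p : T * T => (f p.1 - f p.2) ^+ 2).
  by apply: measurable_funX; exact: measurable_diff.
near=> m.
have mF : measurable_fun setT
    (fun p : T * T => ((f p.1 - f p.2) ^+ 2 * K m p)%:E).
  exact/measurable_EFinP/measurable_funM.
have F0 (p : T * T) : (0 <= ((f p.1 - f p.2) ^+ 2 * K m p)%:E)%E.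
  by rewrite lee_fin mulr_ge0// sqr_ge0.
rewrite /weight fubini_tonelli2//.
apply: (@le_trans _ _ (\int[mu]_(w in B)
  \int[mu]_z ((f z - f w) ^+ 2 * K m (z, w))%:E)%E).
  apply: ge0_le_integral => //.
  - by move=> w _; rewrite lee_fin sqr_ge0.
  - apply/measurable_EFinP/measurable_funTS/measurable_funX/measurable_funB => //.
    by apply: measurable_average => //; exact: sqr_integrable_integrable.
  - by apply: measurable_funTS; exact: (measurable_fun_fubini_tonelli_G _ mF F0).
  - by move=> w Bw; exact: average_jensen.
apply: ge0_subset_integral => //.
  exact: (measurable_fun_fubini_tonelli_G _ mF F0).
by move=> w _; apply: integral_ge0 => z _; exact: (F0 (z, w)).
Unshelve. all: end_near. Qed.

End ApproximateIdentity.

(** * Integration by parts on the torus *)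
Section DerivativesAlongLines.
Variables (R : realType) (V : normedModType R).
Implicit Types (F : V -> R) (w v : V).

(** A derivative in a direction is the derivative of the restriction to a
    line, so the calculus of one variable applies. *)
Lemma is_derive_line F w v (t d : R) :
  is_derive (w + t *: v) v F d <->
  is_derive t (1 : R) (fun s => F (w + s *: v)) d.
Proof.
have E : (fun h : R => h^-1 *: ((F \o shift (w + t *: v)) (h *: v) - F (w + t *: v)))
  = (fun h : R => h^-1 *:
      (((fun s => F (w + s *: v)) \o shift t) (h *: (1 : R)) - F (w + t *: v))).
  apply/funext => h; congr (_ *: (F _ - _)) => /=.
  by rewrite /shift /= scalerDl addrCA /GRing.scale /= mulr1.
split => [[dF DF]|[dF DF]].
  by split; rewrite /derivable /derive -E.
by split; rewrite /derivable /derive E.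
Qed.

Lemma is_derive_line0 F w v (d : R) :
  is_derive w v F d <-> is_derive 0 (1 : R) (fun s => F (w + s *: v)) d.
Proof. by rewrite -is_derive_line scale0r addr0. Qed.

Lemma is_derive_along_comp F w v (d b' : R) (b : R -> R) :
  is_derive w v F d -> is_derive (F w) (1 : R) b b' ->
  is_derive w v (b \o F) (b' * d).
Proof.
move=> /is_derive_line0 dF db; apply/is_derive_line0.
apply: (is_derive1_comp (f := b) (g := fun s => F (w + s *: v))) => //.
by rewrite scale0r addr0.
Qed.

Lemma derivable_line_continuous F w v :
  (forall t : R, derivable F (w + t *: v) v) ->
  continuous (fun t : R => F (w + t *: v)).
Proof.
move=> dF t; apply: differentiable_continuous; apply/derivable1_diffP.
by have /is_derive_line[] := derivableP (dF t).
Qed.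

Let quotient_shift F w v z :
  (fun h : R => h^-1 *: (((fun x => F (x - w)) \o shift z) (h *: v) - F (z - w))) =
  (fun h : R => h^-1 *: ((F \o shift (z - w)) (h *: v) - F (z - w))).
Proof. by apply/funext => h /=; rewrite /shift /= addrA. Qed.

Lemma derivable_shift F w v z :
  derivable (fun x => F (x - w)) z v = derivable F (z - w) v.
Proof. by rewrite /derivable quotient_shift. Qed.

Lemma derive_shift F w v z : 'D_v (fun x => F (x - w)) z = 'D_v F (z - w).
Proof. by rewrite /derive quotient_shift. Qed.

End DerivativesAlongLines.

Section Spacetime.
Variable R : realType.
Implicit Types (F G : spacetime R -> R) (w z : spacetime R) (o : option 'I_3).

Definition axis_continuous F :=
  forall o w, continuous (fun t : R => F (w + t *: axis R o)).

Definition ord3 k (h : (k < 3)%N) : 'I_3 := Ordinal h.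

Lemma axisE0 w (t : R) : w + t *: axis R (Some (@ord3 0 isT)) =
  (w.1.1.1 + t, w.1.1.2, w.1.2, w.2).
Proof.
case: w => [[[a b] c] d]; rewrite /axis /unit_vector /=.
by congr (_, _, _, _); rewrite /= /GRing.scale /= ?mulr1 ?mulr0 ?addr0.
Qed.

Lemma axisE1 w (t : R) : w + t *: axis R (Some (@ord3 1 isT)) =
  (w.1.1.1, w.1.1.2 + t, w.1.2, w.2).
Proof.
case: w => [[[a b] c] d]; rewrite /axis /unit_vector /=.
by congr (_, _, _, _); rewrite /= /GRing.scale /= ?mulr1 ?mulr0 ?addr0.
Qed.

Lemma axisE2 w (t : R) : w + t *: axis R (Some (@ord3 2 isT)) =
  (w.1.1.1, w.1.1.2, w.1.2 + t, w.2).
Proof.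
case: w => [[[a b] c] d]; rewrite /axis /unit_vector /=.
by congr (_, _, _, _); rewrite /= /GRing.scale /= ?mulr1 ?mulr0 ?addr0.
Qed.

Lemma axisE3 w (t : R) : w + t *: axis R None =
  (w.1.1.1, w.1.1.2, w.1.2, w.2 + t).
Proof.
case: w => [[[a b] c] d]; rewrite /axis /=.
by congr (_, _, _, _); rewrite /= /GRing.scale /= ?mulr1 ?mulr0 ?addr0.
Qed.

Lemma ord3P (P : 'I_3 -> Prop) : P (@ord3 0 isT) -> P (@ord3 1 isT) ->
  P (@ord3 2 isT) -> forall k, P k.
Proof.
move=> P0 P1 P2 [[|[|[|//]]] h]; set k := Ordinal h.
- by rewrite (_ : k = @ord3 0 isT)//; exact: val_inj.
- by rewrite (_ : k = @ord3 1 isT)//; exact: val_inj.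
- by rewrite (_ : k = @ord3 2 isT)//; exact: val_inj.
Qed.

(** Continuity in each variable separately suffices, adding one variable at a
    time with the Caratheodory criterion. *)
Lemma axis_continuous_measurable F : axis_continuous F -> measurable_fun setT F.
Proof.
move=> cF.
have shift_cont (g : R -> R) a : continuous (fun t => g (a + t)) -> continuous g.
  move=> cg x; have Ex : a + (x - a) = x by rewrite addrC subrK.
  rewrite (_ : g = (fun t => g (a + t)) \o (fun y => y - a)); last first.
    by apply/funext => y /=; rewrite addrC subrK.
  apply: continuous_comp; last exact: cg.
  by apply: cvgB; [exact: cvg_id|exact: cvg_cst].
have c0 b c d : continuous (fun a => F (a, b, c, d)).
  apply: (shift_cont _ 0).
  by have := cF (Some (@ord3 0 isT)) (0, b, c, d); under eq_fun do rewrite axisE0.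
have c1 a c d : continuous (fun b => F (a, b, c, d)).
  apply: (shift_cont _ 0).
  by have := cF (Some (@ord3 1 isT)) (a, 0, c, d); under eq_fun do rewrite axisE1.
have c2 a b d : continuous (fun c => F (a, b, c, d)).
  apply: (shift_cont _ 0).
  by have := cF (Some (@ord3 2 isT)) (a, b, 0, d); under eq_fun do rewrite axisE2.
have c3 a b c : continuous (fun d => F (a, b, c, d)).
  apply: (shift_cont _ 0).
  by have := cF None (a, b, c, 0); under eq_fun do rewrite axisE3.
apply: caratheodory_measurable => [d|[[a b] c]]; last exact: c3.
apply: (caratheodory_measurable (f := fun p => F (p, d))) => [c|[a b]]; last exact: c2.
apply: (caratheodory_measurable (f := fun p => F (p, c, d))) => [b|a]; last exact: c1.
exact: continuous_measurable_fun.
Qed.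

(** Functions that are continuous along the coordinate axes and bounded on
    bounded sets: enough for measurability, Fubini and the fundamental theorem
    of calculus in each variable, and stable under algebraic operations. *)
Definition regular F := axis_continuous F /\
  forall r : R, exists C : R, forall w, `|w| <= r -> `|F w| <= C.

Lemma regular_measurable F : regular F -> measurable_fun setT F.
Proof. by move=> [cF _]; exact: axis_continuous_measurable. Qed.

Lemma regularD F G : regular F -> regular G -> regular (fun w => F w + G w).
Proof.
move=> [cF bF] [cG bG]; split.
  by move=> o w t; apply: cvgD; [exact: cF|exact: cG].
move=> r; have [C FC] := bF r; have [C' GC] := bG r.
exists (C + C') => w wr; rewrite (le_trans (ler_normD _ _))// lerD ?FC ?GC//.
Qed.

Lemma regularM F G : regular F -> regular G -> regular (fun w => F w * G w).
Proof.
move=> [cF bF] [cG bG]; split.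
  by move=> o w t; apply: cvgM; [exact: cF|exact: cG].
move=> r; have [C FC] := bF r; have [C' GC] := bG r.
exists (C * C') => w wr; rewrite normrM ler_pM ?FC ?GC//.
Qed.

Lemma regular_cst (a : R) : regular (fun=> a).
Proof.
by split; [move=> o w t; exact: cvg_cst|move=> r; exists `|a|].
Qed.

Lemma regularN F : regular F -> regular (fun w => - F w).
Proof.
move=> rF; rewrite (_ : (fun w => - F w) = (fun w => -1 * F w)).
  by apply: regularM => //; exact: regular_cst.
by apply/funext => w; rewrite mulN1r.
Qed.

Lemma regular_sum (I : Type) (s : seq I) (F : I -> spacetime R -> R) :
  (forall i, regular (F i)) -> regular (fun w => \sum_(i <- s) F i w).
Proof.
move=> rF; elim: s => [|i s IH].
  by under eq_fun do rewrite big_nil; exact: regular_cst.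
by under eq_fun do rewrite big_cons; exact: regularD.
Qed.

Lemma regular_comp F (b : R -> R) (p q : R) : p < q ->
  regular F -> (forall w, p < F w < q) ->
  {within `[p, q], continuous b} -> regular (fun w => b (F w)).
Proof.
move=> pq [cF _] Fpq cb; split.
  move=> o w t; apply: continuous_comp; first exact: cF.
  move: cb => /(continuous_within_itvP _ pq)[cb _ _]; apply: cb.
  by rewrite in_itv/= Fpq.
move=> r.
have [c1 _ hM] := EVT_max (ltW pq) cb.
have [c2 _ hm] := EVT_min (ltW pq) cb.
exists (`|b c1| + `|b c2|) => w _.
have Fi : F w \in `[p, q] by rewrite in_itv/=; case/andP: (Fpq w) => /ltW-> /ltW->.
rewrite ler_norml; apply/andP; split.
  rewrite (le_trans _ (hm _ Fi))// lerNl.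
  by rewrite (le_trans (ler_norm (- b c2)))// normrN lerDr.
by rewrite (le_trans (hM _ Fi))// (le_trans (ler_norm _))// lerDl.
Qed.

End Spacetime.

Section IntegrationByParts.
Variable R : realType.
Notation leb1 := (@lebesgue_measure R).
Notation line := (measurableTypeR R).

Lemma FTC_open (g g' : R -> R) (a b : R) : a < b -> continuous g' ->
  (forall t, a <= t <= b -> is_derive t (1 : R) g (g' t)) ->
  \int[leb1]_(t in `]a, b[) g' t = g b - g a.
Proof.
move=> ab cg' dg.
have cg t : a <= t <= b -> {for t, continuous g}.
  move=> tab; apply: differentiable_continuous; apply/derivable1_diffP.
  by have [] := dg t tab.
have H : (\int[leb1]_(x in `[a, b]) (g' x)%:E = (g b)%:E - (g a)%:E)%E.
  apply: (continuous_FTC2 ab).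
  - exact: continuous_subspaceT.
  - split.
    + move=> t; rewrite in_itv/= => /andP[at_ tb].
      by have [] := dg t; rewrite ?ltW.
    + by apply: cvg_at_right_filter; apply: cg; rewrite lexx ltW.
    + by apply: cvg_at_left_filter; apply: cg; rewrite lexx ltW.
  - move=> t; rewrite in_itv/= => /andP[at_ tb]; rewrite derive1E.
    by have [] := dg t; rewrite ?ltW.
have icc : leb1.-integrable `[a, b] (EFin \o g').
  apply: continuous_compact_integrable; first exact: segment_compact.
  exact: continuous_subspaceT.
have ico : leb1.-integrable `[a, b[ (EFin \o g').
  by apply: integrableS icc => //; exact: subset_itv_co_cc.
have ioo : leb1.-integrable `]a, b[ (EFin \o g').
  by apply: integrableS icc => //; exact: subset_itv_oo_cc.
rewrite Rintegral_itv_obnd_cbnd// Rintegral_itv_bndo_bndc//.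
by rewrite /Rintegral H.
Qed.

Lemma continuous_Rintegral_co_oo (g : R -> R) (a b : R) : continuous g ->
  \int[leb1]_(t in `[a, b[) g t = \int[leb1]_(t in `]a, b[) g t.
Proof.
move=> cg; rewrite Rintegral_itv_obnd_cbnd//.
have icc : leb1.-integrable `[a, b] (EFin \o g).
  apply: continuous_compact_integrable; first exact: segment_compact.
  exact: continuous_subspaceT.
by apply: integrableS icc => //; exact: subset_itv_oo_cc.
Qed.

Lemma FTC_co (g g' : R -> R) (a b : R) : a < b -> continuous g' ->
  (forall t, a <= t <= b -> is_derive t (1 : R) g (g' t)) ->
  \int[leb1]_(t in `[a, b[) g' t = g b - g a.
Proof.
by move=> ab cg' dg; rewrite continuous_Rintegral_co_oo//; exact: FTC_open.
Qed.

Lemma leb1_itv01 : (leb1 `[0%R, 1%R[%classic < +oo)%E.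
Proof. by rewrite lebesgue_measure_itv/= lte_fin ltr01 -EFinD ltry. Qed.

Lemma leb1_itv (T : R) : (leb1 `]0%R, T[%classic < +oo)%E.
Proof. by rewrite lebesgue_measure_itv/=; case: ifP => //; rewrite -EFinD ltry. Qed.

Lemma measurable_cell : measurable (@cell R : set (line * line * line)).
Proof. by apply: measurableX => //; apply: measurableX. Qed.

Lemma leb3_cell : leb3 (@cell R) = 1%E.
Proof.
have h : (leb1 `[0%R, 1%R[%classic = 1)%E.
  by rewrite lebesgue_measure_itv/= lte_fin ltr01 -EFinD subr0.
rewrite /leb3 /prod_measure /cell.
rewrite product_measure1E//=; last by apply: measurableX.
by rewrite /prod_measure product_measure1E//= !h !mule1.
Qed.

Lemma leb3_cell_fin : (leb3 (@cell R) < +oo)%E.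
Proof. by rewrite leb3_cell ltry. Qed.

Lemma measurable_cylinder (I : set line) : measurable I ->
  measurable (cylinder I : set (line * line * line * line)).
Proof. by move=> mI; apply: measurableX => //; exact: measurable_cell. Qed.

Lemma cylinder_le (S T : R) : S <= T ->
  cylinder `]0, S[ `<=` (cylinder `]0, T[ : set (spacetime R)).
Proof.
move=> ST [x t] [cx] /=; rewrite !in_itv/= => /andP[t0 tS].
by split; rewrite //= in_itv/= t0 (lt_le_trans tS).
Qed.

Lemma cylinder_unbounded (T : R) :
  cylinder `]0, T[ `<=` (cylinder `]0, +oo[ : set (spacetime R)).
Proof.
move=> [x t] [cx] /=; rewrite !in_itv/= => /andP[t0 _].
by split; rewrite //= in_itv/= t0.
Qed.

Lemma leb4_cylinder_fin (T : R) : (leb4 (cylinder `]0%R, T[%classic) < +oo)%E.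
Proof.
apply: finite_product_measure => //; first exact: measurable_cell.
- exact: leb3_cell_fin.
- exact: leb1_itv.
Qed.

Lemma cylinder_norm (T : R) (w : spacetime R) : cylinder `]0, T[ w ->
  `|w| <= Num.max 1 T.
Proof.
case: w => [[[a b] c] t] [[[]]] /=; rewrite !in_itv/=.
move=> /andP[a0 a1] /andP[b0 b1] /andP[c0 c1] /andP[t0 t1].
rewrite !prod_normE /= !ge_max !le_max !ger0_norm ?(ltW t0)//.
by rewrite (ltW a1) (ltW b1) (ltW c1) (ltW t1) orbT.
Qed.

Section BoundedFubiniZero.
Context d1 d2 (T1 : measurableType d1) (T2 : measurableType d2).
Variables (m1 : {sigma_finite_measure set T1 -> \bar R})
  (m2 : {sigma_finite_measure set T2 -> \bar R}).
Variables (A : set T1) (B : set T2).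
Hypotheses (mA : measurable A) (mB : measurable B).
Hypotheses (fA : (m1 A < +oo)%E) (fB : (m2 B < +oo)%E).
Variables (f : T1 * T2 -> R) (C : R).
Hypotheses (mf : measurable_fun setT f)
  (fC : forall x y, A x -> B y -> `|f (x, y)| <= C).

Lemma Fubini_eq0_fst : (forall y, B y -> \int[m1]_(x in A) f (x, y) = 0) ->
  \int[(m1 \x m2)%E]_(z in A `*` B) f z = 0.
Proof.
move=> f0; rewrite (bounded_Fubini2 mA mB fA fB mf fC).
rewrite (@eq_Rintegral _ _ _ _ _ (cst 0)); first by rewrite Rintegral_cst// mul0r.
by move=> y /set_mem; exact: f0.
Qed.

Lemma Fubini_eq0_snd : (forall x, A x -> \int[m2]_(y in B) f (x, y) = 0) ->
  \int[(m1 \x m2)%E]_(z in A `*` B) f z = 0.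
Proof.
move=> f0; rewrite (bounded_Fubini1 mA mB fA fB mf fC).
rewrite (@eq_Rintegral _ _ _ _ _ (cst 0)); first by rewrite Rintegral_cst// mul0r.
by move=> y /set_mem; exact: f0.
Qed.

End BoundedFubiniZero.

(** Integrate first along the direction of differentiation, over a full
    period: the boundary terms cancel. *)
Lemma periodic_derivative_integral (k : 'I_3) (F F' : spacetime R -> R) (T : R) :
  regular F' -> (forall w, is_derive w (axis R (Some k)) F (F' w)) ->
  periodic_in_space F ->
  \int[leb4]_(w in cylinder `]0, T[) F' w = 0.
Proof.
move=> rF' dF pF.
have mF' := regular_measurable rF'; have [cF' bF'] := rF'.
have [C FC] := bF' (Num.max 1 T).
have along w : \int[leb1]_(t in `[0, 1[) F' (w + t *: axis R (Some k)) = 0.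
  have dl t := (is_derive_line F w (axis R (Some k)) t _).1 (dF _).
  rewrite (FTC_co ltr01 (cF' (Some k) w) (fun t _ => dl t)).
  rewrite scale0r addr0 scale1r; apply/eqP; rewrite subr_eq0; apply/eqP.
  by case: w {dl} => x t; have := pF t k x; rewrite /axis /= => <-;
    congr (F (_, _)); rewrite /= addr0.
have FCb a b c t : `[0, 1[%classic a -> `[0, 1[%classic b -> `[0, 1[%classic c ->
    `]0, T[%classic t -> `|F' (a, b, c, t)| <= C.
  by move=> ha hb hc ht; apply: FC; apply: cylinder_norm.
have mI : measurable (`[0, 1[%classic : set R) by [].
have mII : measurable (`[0, 1[ `*` `[0, 1[ : set (R * R)) by exact: measurableX.
have fI := leb1_itv01.
have fII : ((leb1 \x leb1) (`[0%R, 1%R[ `*` `[0%R, 1%R[)%classic < +oo)%E.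
  exact: finite_product_measure.
apply: (@Fubini_eq0_fst _ _ _ _ leb3 leb1 _ _ measurable_cell _ leb3_cell_fin (leb1_itv T) _ C) => //.
  by move=> [[a b] c] t [[/= ha hb] hc] ht; exact: FCb.
move=> t ht; have mt := measurable_fun_pair1 t mF'.
move: k dF along; apply: ord3P => dF along.
- apply: (@Fubini_eq0_fst _ _ _ _ (prod_measure leb1 leb1) leb1 _ _ mII _ fII fI
     (fun x => F' (x, t)) C) => //.
    by move=> [a b] c [/= ha hb] hc; exact: FCb.
  move=> c hc; have mc := measurable_fun_pair1 c mt.
  apply: (@Fubini_eq0_fst _ _ _ _ leb1 leb1 _ _ mI _ fI fI
     (fun x => F' (x, c, t)) C) => //.
    by move=> a b ha hb; exact: FCb.
  move=> b hb; rewrite -[RHS](along (0, b, c, t)).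
  by apply: eq_Rintegral => a _; rewrite axisE0 /= add0r.
- apply: (@Fubini_eq0_fst _ _ _ _ (prod_measure leb1 leb1) leb1 _ _ mII _ fII fI
     (fun x => F' (x, t)) C) => //.
    by move=> [a b] c [/= ha hb] hc; exact: FCb.
  move=> c hc; have mc := measurable_fun_pair1 c mt.
  apply: (@Fubini_eq0_snd _ _ _ _ leb1 leb1 _ _ mI _ fI fI
     (fun x => F' (x, c, t)) C) => //.
    by move=> a b ha hb; exact: FCb.
  move=> a ha; rewrite -[RHS](along (a, 0, c, t)).
  by apply: eq_Rintegral => b _; rewrite axisE1 /= add0r.
- apply: (@Fubini_eq0_snd _ _ _ _ (prod_measure leb1 leb1) leb1 _ _ mII _ fII fI
     (fun x => F' (x, t)) C) => //.
    by move=> [a b] c [/= ha hb] hc; exact: FCb.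
  move=> [a b] [ha hb]; rewrite -[RHS](along (a, b, 0, t)).
  by apply: eq_Rintegral => c _; rewrite axisE2 /= add0r.
Qed.

Lemma time_derivative_integral (F F' : spacetime R -> R) (T : R) : 0 < T ->
  regular F -> regular F' -> (forall w, is_derive w (axis R None) F (F' w)) ->
  \int[leb4]_(w in cylinder `]0, T[) F' w =
  \int[leb3]_(x in cell) F (x, T) - \int[leb3]_(x in cell) F (x, 0).
Proof.
move=> T0 rF rF' dF.
have mF' := regular_measurable rF'; have [cF' bF'] := rF'.
have mF := regular_measurable rF; have [_ bF] := rF.
have [C FC] := bF' (Num.max 1 T).
have cn (x : position R) (t : R) : cell x -> 0 <= t <= T -> `|(x, t)| <= Num.max 1 T.
  case: x => [[a b] c] [[]] /=; rewrite !in_itv/=.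
  move=> /andP[a0 a1] /andP[b0 b1] /andP[c0 c1] /andP[t0 t1].
  rewrite !prod_normE /= !ge_max !le_max !ger0_norm//.
  by rewrite (ltW a1) (ltW b1) (ltW c1) t1 orbT.
have [C' FC'] := bF (Num.max 1 T).
have iF t : 0 <= t <= T -> leb3.-integrable cell (EFin \o (fun x => F (x, t))).
  move=> tT; apply: (@bounded_integrable _ _ _ _ _ _ C').
  - exact: measurable_cell.
  - exact: leb3_cell_fin.
  - by apply: measurable_funTS; exact: measurable_fun_pair1.
  - by move=> x cx; apply: FC'; exact: cn.
rewrite (bounded_Fubini1 (m1 := leb3) (m2 := leb1) measurable_cell _ leb3_cell_fin (leb1_itv T) mF' (C := C))//; last first.
  move=> x t cx; rewrite /= in_itv/= => /andP[t0 t1].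
  by apply/FC/cn => //; rewrite !ltW.
rewrite -RintegralB//; last 3 first.
- exact: measurable_cell.
- by apply: iF; rewrite ltW/=.
- by apply: iF; rewrite lexx ltW.
apply: eq_Rintegral => -[[a b] c] _.
pose w : spacetime R := (a, b, c, 0).
have dl t := (is_derive_line F w (axis R None) t _).1 (dF _).
have := FTC_open T0 (cF' None w) (fun t _ => dl t).
rewrite !axisE3 /= !add0r => <-.
by apply: eq_Rintegral => t _; rewrite axisE3 /= add0r.
Qed.

End IntegrationByParts.

(** * Convolution with a smooth kernel *)
Section SmoothFunctionsOnSpacetime.
Variable R : realType.
Implicit Types (h F : spacetime R -> R) (w z : spacetime R) (o : option 'I_3).

Lemma smooth_partial o h : smooth h -> smooth (partial o h).
Proof. by move=> sh s; have := sh (rcons s o); rewrite foldr_rcons. Qed.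

Lemma smooth_continuous h : smooth h -> continuous h.
Proof. by move=> /(_ [::])[]. Qed.

Lemma smooth_is_derive h o w : smooth h -> is_derive w (axis R o) h (partial o h w).
Proof. by move=> /(_ [::])[_ /(_ o w)]; exact: derivableP. Qed.

Lemma smooth_bounded h (r : R) : smooth h ->
  exists C : R, forall w, `|w| <= r -> `|h w| <= C.
Proof.
move=> /smooth_continuous ch.
pose I := `[- r, r]%classic : set R.
have cI : compact I by exact: segment_compact.
have cB : compact (I `*` I `*` I `*` I).
  by apply: compact_setX => //; apply: compact_setX => //; exact: compact_setX.
have : compact (h @` (I `*` I `*` I `*` I)).
  by apply: continuous_compact => //; exact: continuous_subspaceT.
move=> /compact_bounded[C [_ hC]]; exists (C + 1) => w wr.
apply: (hC (C + 1)); first by rewrite ltrDl.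
exists w => //; case: w wr => [[[a b] c] d].
rewrite !prod_normE /= !ge_max !ler_norml => /andP[/andP[/andP[? ?] ?] ?].
by split; [split; [split|]|]; rewrite /I /= in_itv/=.
Qed.

Lemma smooth_regular h : smooth h -> regular h.
Proof.
move=> sh; split; last by move=> r; exact: smooth_bounded.
move=> o w; apply: derivable_line_continuous => t.
by have [_ /(_ o)] := sh [::].
Qed.

Lemma partial_shift o h w : partial o (fun z => h (z - w)) = (fun z => partial o h (z - w)).
Proof. by apply/funext => z; rewrite /partial derive_shift. Qed.

Lemma smooth_shift h w : smooth h -> smooth (fun z => h (z - w)).
Proof.
move=> sh s.
have -> : foldr (@partial R) (fun z => h (z - w)) s =
          (fun z => foldr (@partial R) h s (z - w)).
  by elim: s => //= o s ->; exact: partial_shift.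
have [cg dg] := sh s; split => [z|o z]; last by rewrite derivable_shift.
apply: (@continuous_comp _ _ _ (fun z => z - w) (foldr (@partial R) h s) z).
  by apply: (@cvgB _ (spacetime R)); [exact: cvg_id|exact: cvg_cst].
exact: cg.
Qed.

End SmoothFunctionsOnSpacetime.

Section Convolution.
Variables (R : realType) (M : R).
Implicit Types (f h : spacetime R -> R) (w z : spacetime R).
Let D : set (spacetime R) := cylinder `]0, M[.

(** The kernel is evaluated at z - w rather than w - z: then z |-> h (z - w)
    is itself a test function, to which the weak equations apply. *)
Definition conv f h w : R := \int[leb4]_(z in D) (f z * h (z - w)).

Notation line := (measurableTypeR R).
Let mD : measurable (D : set (line * line * line * line)). Proof. exact: measurable_cylinder. Qed.

Let rD : R := Num.max 1 M.

Let measurable_shift h w : smooth h -> measurable_fun setT (fun z => h (z - w)).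
Proof.
move=> sh; apply: regular_measurable; apply: smooth_regular.
exact: smooth_shift.
Qed.

Let shift_norm z w : D z -> `|z - w| <= rD + `|w|.
Proof.
by move=> /cylinder_norm zD; rewrite (le_trans (ler_normB _ _))// lerD2r.
Qed.

Lemma integrable_conv f h w : measurable_fun setT f ->
  leb4.-integrable D (EFin \o f) -> smooth h ->
  leb4.-integrable D (EFin \o (fun z => f z * h (z - w))).
Proof.
move=> mf intf sh; have [C hC] := smooth_bounded (rD + `|w|) sh.
have iC := integrableZr mD C intf.
apply: (le_integrable mD _ _ iC).
  apply/measurable_EFinP/measurable_funTS/measurable_funM => //.
  exact: measurable_shift.
move=> z Dz; rewrite lee_fin /= !normrM ler_wpM2l//.
by rewrite (le_trans (hC _ (shift_norm w Dz)))// ler_norm.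
Qed.

Lemma conv_bounded f h (r : R) : measurable_fun setT f ->
  leb4.-integrable D (EFin \o f) -> smooth h ->
  exists C : R, forall w, `|w| <= r -> `|conv f h w| <= C.
Proof.
move=> mf intf sh; have [C hC] := smooth_bounded (rD + r) sh.
exists (\int[leb4]_(z in D) (`|f z| * C)) => w wr.
apply: le_trans (le_normr_Rintegral mD (integrable_conv w mf intf sh)) _.
apply: le_Rintegral => //.
- exact: integrable_norm (integrable_conv w mf intf sh).
- by move: (integrableZr mD C (integrable_norm intf)); apply: eq_integrable.
move=> z Dz; rewrite normrM ler_wpM2l// hC// (le_trans (shift_norm w Dz))//.
by rewrite lerD2l.
Qed.

(** Differentiation under the integral sign; the sign comes from the kernel
    being evaluated at z - w. *)
Lemma is_derive_conv f h o w : measurable_fun setT f ->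
  leb4.-integrable D (EFin \o f) -> smooth h ->
  is_derive w (axis R o) (conv f h) (- conv f (partial o h) w).
Proof.
move=> mf intf sh; apply/is_derive_line0.
have sh' := smooth_partial o sh.
pose e := axis R o.
pose g (t : R) z := f z * h (z - (w + t *: e)).
have dg t z : is_derive t (1 : R) (g ^~ z) (- (f z * partial o h (z - (w + t *: e)))).
  have dL : is_derive (- t) (1 : R) (fun s => h (z - w + s *: e))
      (partial o h (z - w + (- t) *: e)).
    by apply: (is_derive_line _ _ _ _ _).1; exact: smooth_is_derive.
  have dN : is_derive t (1 : R) (fun s : R => - s) (- 1).
    by apply: is_deriveN.
  have := is_derive1_comp (f := fun s => h (z - w + s *: e))
    (g := fun s : R => - s) dL dN.
  move=> /(is_deriveZ (f z)).
  rewrite (_ : f z \*: _ = g ^~ z); last first.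
    apply/funext => s; rewrite -[LHS]/(f z * h (z - w + (- s) *: e)).
    rewrite /g; congr (_ * h _).
    by rewrite scaleNr opprD addrA.
  move=> /is_derive_eq; apply.
  by rewrite mulrN1 scalerN scaleNr opprD addrA.
have -> : (fun s => conv f h (w + s *: axis R o)) =
          (fun s => \int[leb4]_(z in D) g s z) by [].
have [C hC] := smooth_bounded (rD + `|w| + `|e|) sh'.
have iG : leb4.-integrable D (EFin \o (fun z => `|f z| * `|C|)).
  by move: (integrableZr mD `|C| (integrable_norm intf)); apply: eq_integrable.
have ig t : `]-1, 1[%classic t -> leb4.-integrable D (EFin \o g t).
  by move=> _; exact: integrable_conv.
have I0 : `]-1, 1[%classic (0 : R) by rewrite /= in_itv/= ltrN10 ltr01.
have dbl t z : `]-1, 1[%classic t -> D z -> derivable (g ^~ z) t 1.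
  by move=> _ _; have [] := dg t z.
have G0 z : 0 <= `|f z| * `|C| by [].
have bd t z : `]-1, 1[%classic t -> D z -> `|partial1of2 g t z| <= `|f z| * `|C|.
  rewrite /= in_itv/= => /andP[t1 t2] Dz.
  rewrite /partial1of2 derive1E (@derive_val _ _ _ _ _ _ _ (dg t z)).
  rewrite normrN normrM ler_wpM2l//.
  apply: le_trans (ler_norm C); apply: hC.
  rewrite opprD addrA (le_trans (ler_normB _ _))// lerD ?shift_norm//.
  by rewrite normrZ ler_piMl// ler_norml !ltW.
have d1 := derivable_under_integral mD I0 ig dbl G0 iG bd.
have d2 := differentiation_under_integral mD I0 ig dbl G0 iG bd.
apply: DeriveDef; first exact: d1.
rewrite -derive1E d2.
have ik := integrable_conv w mf intf sh'.
transitivity (\int[leb4]_(z in D) (-1 * (f z * partial o h (z - w)))); last first.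
  by rewrite (RintegralZl (-1) mD ik) mulN1r.
apply: eq_Rintegral => z _.
rewrite /partial1of2 derive1E (@derive_val _ _ _ _ _ _ _ (dg 0 z)).
by rewrite scale0r addr0 mulN1r.
Qed.

Lemma regular_conv f h : measurable_fun setT f ->
  leb4.-integrable D (EFin \o f) -> smooth h -> regular (conv f h).
Proof.
move=> mf intf sh; split; last by move=> r; exact: conv_bounded.
move=> o w; apply: derivable_line_continuous => t.
by have [] := is_derive_conv o (w + t *: axis R o) mf intf sh.
Qed.

Lemma periodic_conv f h : periodic_in_space h -> periodic_in_space (conv f h).
Proof.
move=> ph t k x; apply: eq_Rintegral => z _; congr (_ * _).
rewrite -(ph (z - (x + unit_vector R k, t)).2 k).
by congr h; case: z => z s; congr (_, _); rewrite /= opprD addrA subrK.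
Qed.

End Convolution.

(** * Bump functions in space and time *)
Section MassOfTranslates.
Variable R : realType.
Notation leb1 := (@lebesgue_measure R).
Implicit Types a A : R -> R.

(** Integrals of translates and reflections are computed from one
    antiderivative, which a large interval around the origin provides. *)
Lemma antiderivative a (r : R) : 0 < r -> continuous a ->
  exists A, forall x, `|x| < r -> is_derive x (1 : R) A (a x).
Proof.
move=> r0 ca.
have ia : leb1.-integrable `[- r, r] (EFin \o a).
  apply: continuous_compact_integrable; first exact: segment_compact.
  exact: continuous_subspaceT.
exists (fun x => \int[leb1]_(t in `[- r, x]) a t) => x.
rewrite ltr_norml => /andP[rx xr].
have [d1 d2] := continuous_FTC1_closed xr ia rx (ca x).
rewrite derive1E in d2.
exact: (DeriveDef d1 d2).
Qed.

Lemma antiderivative_MVT a A (r x y : R) :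
  (forall x, `|x| < r -> is_derive x (1 : R) A (a x)) ->
  `|x| < r -> `|y| < r -> x < y ->
  exists2 c, x < c < y & A y - A x = a c * (y - x).
Proof.
move=> dA; rewrite !ltr_norml => /andP[x1 x2] /andP[y1 y2] xy.
have dA' t : x <= t <= y -> is_derive t (1 : R) A (a t).
  by move=> /andP[? ?]; apply: dA; rewrite ltr_norml; apply/andP; split;
    [exact: lt_le_trans x1 _|exact: le_lt_trans y2].
have cA : {within `[x, y], continuous A}.
  apply: derivable_within_continuous => t; rewrite in_itv/= => /dA' dt.
  by have [] := dt.
have dA2 t : t \in `]x, y[ -> is_derive t (1 : R) A (a t).
  by rewrite in_itv/= => /andP[? ?]; apply: dA'; rewrite !ltW.
have [c cxy E] := MVT xy dA2 cA.
by exists c => //; move: cxy; rewrite in_itv.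
Qed.

Lemma integral_translate a A (r p q y : R) : p < q -> continuous a ->
  (forall x, `|x| < r -> is_derive x (1 : R) A (a x)) ->
  `|p - y| < r -> `|q - y| < r ->
  \int[leb1]_(x in `]p, q[) a (x - y) = A (q - y) - A (p - y).
Proof.
move=> pq ca dA; rewrite !ltr_norml => /andP[p1 p2] /andP[q1 q2].
apply: (FTC_open (g := fun x => A (x - y)) (g' := fun x => a (x - y))) => //.
  move=> t; apply: continuous_comp; last exact: ca.
  by apply: cvgB; [exact: cvg_id|exact: cvg_cst].
move=> t /andP[pt tq].
have dI : is_derive t (1 : R) (fun x : R => x - y) 1.
  exact: (is_derive_shift t (1 : R) (- y)).
have : is_derive (t - y) (1 : R) A (a (t - y)).
  by apply: dA; rewrite ltr_norml; apply/andP; split; lra.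
move=> dAt; have := is_derive1_comp (f := A) (g := fun x : R => x - y) dAt dI.
by rewrite mulr1.
Qed.

Lemma integral_reflect a A (r p q y : R) : p < q -> continuous a ->
  (forall x, `|x| < r -> is_derive x (1 : R) A (a x)) ->
  `|y - p| < r -> `|y - q| < r ->
  \int[leb1]_(x in `]p, q[) a (y - x) = A (y - p) - A (y - q).
Proof.
move=> pq ca dA; rewrite !ltr_norml => /andP[p1 p2] /andP[q1 q2].
have cay : continuous (fun x => a (y - x)).
  move=> t; apply: continuous_comp; last exact: ca.
  by apply: cvgB; [exact: cvg_cst|exact: cvg_id].
have dA' t : p <= t <= q -> is_derive t (1 : R) (fun x => - A (y - x)) (a (y - t)).
  move=> /andP[pt tq].
  have dI : is_derive t (1 : R) (fun x : R => y - x) (- 1).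
    rewrite -[X in is_derive _ _ _ X]add0r.
    exact: (is_deriveB (is_derive_cst y t (1 : R)) (is_derive_id t (1 : R))).
  have dAt : is_derive (y - t) (1 : R) A (a (y - t)).
    by apply: dA; rewrite ltr_norml; apply/andP; split; lra.
  have := is_derive1_comp (f := A) (g := fun x : R => y - x) dAt dI.
  by move=> /is_deriveN; rewrite mulrN1 opprK.
by rewrite (FTC_open pq cay dA') opprK addrC.
Qed.

(** With A an antiderivative, A (s + 1) - A s has derivative zero by
    periodicity. *)
Lemma mass_periodic a (y : R) : continuous a -> (forall x, a (x + 1) = a x) ->
  \int[leb1]_(x in `[0, 1[) a (x - y) = \int[leb1]_(x in `[0, 1[) a x.
Proof.
move=> ca pa.
have r0 : 0 < `|y| + 3 by rewrite ltr_wpDl.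
have [A dA] := antiderivative r0 ca.
have nn (x : R) : `|x| <= `|y| + 2 -> `|x| < `|y| + 3.
  by move=> /le_lt_trans; apply; rewrite ltrD2l ltr_nat.
have cay : continuous (fun x => a (x - y)).
  move=> t; apply: continuous_comp; last exact: ca.
  by apply: cvgB; [exact: cvg_id|exact: cvg_cst].
rewrite !continuous_Rintegral_co_oo//.
have -> : \int[leb1]_(x in `]0, 1[) a x = \int[leb1]_(x in `]0, 1[) a (x - 0).
  by apply: eq_Rintegral => x _; rewrite subr0.
have b1 : `|1 - y| < `|y| + 3.
  by apply: nn; rewrite (le_trans (ler_normB _ _))// normr1 addrC lerD2l ler1n.
have b0 : `|0 - y| < `|y| + 3.
  by apply: nn; rewrite sub0r normrN lerDl.
rewrite (integral_translate ltr01 ca dA)// (integral_translate ltr01 ca dA)//; last 2 first.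
- by apply: nn; rewrite subr0 normr0 addr_ge0.
- by apply: nn; rewrite subr0 normr1 ler_wpDl// ler1n.
rewrite !subr0 !sub0r.
pose N s := A (s + 1) - A s.
have dN s : `|s| <= `|y| + 1 -> is_derive s (1 : R) N 0.
  move=> sy; rewrite -(subrr (a s)); apply: is_deriveB; last first.
    by apply: dA; apply: nn; rewrite (le_trans sy)// lerD2l ler1n.
  have dI : is_derive s (1 : R) (fun x : R => x + 1) 1.
    exact: (is_derive_shift s (1 : R) 1).
  rewrite -pa -[X in is_derive _ _ _ X]mulr1.
  apply: (is_derive1_comp (f := A) (g := fun x : R => x + 1)) => //.
  by apply: dA; apply: nn; rewrite (le_trans (ler_normD _ _))// normr1 -[2]/(1 + 1) addrA lerD2r.
suff : N (- y) = N 0 by rewrite /N add0r (addrC (- y)).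
have y1 : `|- y| < `|y| + 1 by rewrite normrN ltrDl.
have z1 : `|0 : R| < `|y| + 1 by rewrite normr0 ltr_wpDl.
have dN' x : `|x| < `|y| + 1 -> is_derive x (1 : R) N (cst 0 x).
  by move=> /ltW /dN.
have [h|h|->//] := ltgtP (- y) 0.
  have [c _] := antiderivative_MVT dN' y1 z1 h.
  by rewrite /= mul0r => /eqP; rewrite subr_eq0 => /eqP.
have [c _] := antiderivative_MVT dN' z1 y1 h.
by rewrite /= mul0r => /eqP; rewrite subr_eq0 => /eqP.
Qed.

Lemma mass_gt0 a (x0 p q : R) : continuous a -> (forall x, 0 <= a x) ->
  p < x0 < q -> 0 < a x0 -> 0 < \int[leb1]_(x in `]p, q[) a x.
Proof.
move=> ca a0 /andP[px qx] ax.
pose r := `|p| + `|q| + 1.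
have r0 : 0 < r by rewrite /r ltr_wpDl.
have [A dA] := antiderivative r0 ca.
have inr x : p <= x <= q -> `|x| < r.
  move=> /andP[px' xq']; rewrite /r ltr_norml; apply/andP; split.
    have := ler_norm (- p); rewrite normrN; have := normr_ge0 q; lra.
  have := ler_norm q; have := normr_ge0 p; lra.
have [x1 [x01 x1q] ax1] : exists2 x1, x0 < x1 /\ x1 < q &
    forall x, x0 < x < x1 -> 0 < a x.
  have /nbhs_ballP[e /= e0 he] : \forall x \near x0, 0 < a x by exact: cvgr_gt (ca x0) _ _.
  pose d := Num.min (e / 2) ((q - x0) / 2).
  have d0 : 0 < d by rewrite /d lt_min !divr_gt0 ?subr_gt0.
  have de : d < e by rewrite /d gt_min; apply/orP; left; lra.
  have dq : d < q - x0 by rewrite /d gt_min; apply/orP; right; lra.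
  exists (x0 + d); first by split; [rewrite ltrDl|rewrite addrC -ltrBrDr].
  move=> x /andP[x0x xd]; apply: he; rewrite /ball /= distrC gtr0_norm ?subr_gt0//.
  by rewrite ltrBlDl (lt_trans xd)// ltrD2l.
rewrite (_ : \int[leb1]_(x in `]p, q[) a x = \int[leb1]_(x in `]p, q[) a (x - 0)); last first.
  by apply: eq_Rintegral => x _; rewrite subr0.
have pq : p < q by exact: lt_trans qx.
rewrite (integral_translate pq ca dA) ?subr0; last 2 first.
- by apply: inr; rewrite lexx ltW.
- by apply: inr; rewrite lexx ltW.
have rp : `|p| < r by apply: inr; rewrite lexx ltW.
have rq : `|q| < r by apply: inr; rewrite lexx ltW.
have rx0 : `|x0| < r by apply: inr; rewrite !ltW.
have rx1 : `|x1| < r by apply: inr; rewrite !ltW// (lt_trans px).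
have [c1 _ E1] := antiderivative_MVT dA rp rx0 px.
have [c2 c2x E2] := antiderivative_MVT dA rx0 rx1 x01.
have [c3 _ E3] := antiderivative_MVT dA rx1 rq x1q.
have h1 : 0 <= A x0 - A p by rewrite E1 mulr_ge0// subr_ge0 ltW.
have h2 : 0 < A x1 - A x0 by rewrite E2 mulr_gt0 ?subr_gt0// ax1.
have h3 : 0 <= A q - A x1 by rewrite E3 mulr_ge0// subr_ge0 ltW.
lra.
Qed.

(** For a density supported in the unit interval the antiderivative is constant
    on either side of it; the mass of an interval is then at most the total
    mass, with equality as soon as the interval covers the support. *)
Section CompactSupport.
Variables (a : R -> R) (p q y : R).
Hypotheses (pq : p < q) (ca : continuous a) (a0 : forall x, 0 <= a x).
Hypothesis a_supp : forall x, a x != 0 -> 0 < x < 1.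

Let r : R := `|p| + `|q| + `|y| + 2.

Let setup : exists A, [/\ forall x, `|x| < r -> is_derive x (1 : R) A (a x),
  \int[leb1]_(x in `]0, 1[) a x = A 1 - A 0,
  forall x, `|x| < r -> x <= 0 -> A x = A 0,
  forall x, `|x| < r -> 1 <= x -> A x = A 1 &
  forall x, `|x| < r -> A 0 <= A x <= A 1].
Proof.
have r0 : 0 < r by rewrite /r ltr_wpDl.
have [A dA] := antiderivative r0 ca; exists A.
have h0 : `|0 : R| < r by rewrite normr0.
have h1 : `|1 : R| < r.
  rewrite normr1 /r; have := normr_ge0 p; have := normr_ge0 q.
  by have := normr_ge0 y; lra.
have Al x : `|x| < r -> x <= 0 -> A x = A 0.
  move=> hx; rewrite le_eqVlt => /predU1P[->//|x0].
  have [c /andP[_ c0] E] := antiderivative_MVT dA hx h0 x0.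
  apply/eqP; rewrite eq_sym -subr_eq0 E.
  have [->|/a_supp/andP[c1 _]] := eqVneq (a c) 0; first by rewrite mul0r.
  by have := lt_trans c0 c1; rewrite ltxx.
have Ar x : `|x| < r -> 1 <= x -> A x = A 1.
  move=> hx; rewrite le_eqVlt => /predU1P[->//|x0].
  have [c /andP[c0 _] E] := antiderivative_MVT dA h1 hx x0.
  apply/eqP; rewrite -subr_eq0 E.
  have [->|/a_supp/andP[_ c1]] := eqVneq (a c) 0; first by rewrite mul0r.
  by have := lt_trans c0 c1; rewrite ltxx.
have mono x z : `|x| < r -> `|z| < r -> x <= z -> A x <= A z.
  move=> hx hz; rewrite le_eqVlt => /predU1P[->//|xz].
  have [c _ E] := antiderivative_MVT dA hx hz xz.
  by rewrite -subr_ge0 E mulr_ge0// subr_ge0 ltW.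
split => //.
  rewrite -[in RHS](subr0 (1 : R)) -[X in _ - A X](subr0 (0 : R)).
  rewrite -(integral_translate ltr01 ca dA) ?subr0//.
  by apply: eq_Rintegral => x _; rewrite subr0.
move=> x hx; apply/andP; split.
  by have [/(Al _ hx)->//|/ltW] := leP x 0; exact: mono.
by have [/(mono _ _ hx h1)//|/ltW/(Ar _ hx)->] := leP x 1.
Qed.

Let rp : `|p - y| < r.
Proof.
rewrite (le_lt_trans (ler_normB _ _))// /r; have := normr_ge0 q; lra.
Qed.

Let rq : `|q - y| < r.
Proof.
rewrite (le_lt_trans (ler_normB _ _))// /r; have := normr_ge0 p; lra.
Qed.

Lemma mass_translate_le :
  \int[leb1]_(x in `]p, q[) a (x - y) <= \int[leb1]_(x in `]0, 1[) a x.
Proof.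
have [A [dA -> _ _ Ab]] := setup.
rewrite (integral_translate pq ca dA)//.
by have /andP[_ ?] := Ab _ rq; have /andP[? _] := Ab _ rp; rewrite lerB.
Qed.

Lemma mass_reflect_le :
  \int[leb1]_(x in `]p, q[) a (y - x) <= \int[leb1]_(x in `]0, 1[) a x.
Proof.
have [A [dA -> _ _ Ab]] := setup.
have rp' : `|y - p| < r by rewrite distrC.
have rq' : `|y - q| < r by rewrite distrC.
rewrite (integral_reflect pq ca dA)//.
by have /andP[_ ?] := Ab _ rp'; have /andP[? _] := Ab _ rq'; rewrite lerB.
Qed.

Lemma mass_translate_eq : p <= y -> y + 1 <= q ->
  \int[leb1]_(x in `]p, q[) a (x - y) = \int[leb1]_(x in `]0, 1[) a x.
Proof.
move=> py yq; have [A [dA -> Al Ar _]] := setup.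
rewrite (integral_translate pq ca dA)//.
by rewrite (Ar _ rq) ?(Al _ rp)//; lra.
Qed.

End CompactSupport.

End MassOfTranslates.

Section Bumps.
Variable R : realType.
Notation leb1 := (@lebesgue_measure R).

Lemma smooth1_continuous (f : R -> R) : smooth1 f -> continuous f.
Proof.
move=> /(_ 1%N)[f' df _] x; apply: differentiable_continuous.
by apply/derivable1_diffP; have [] := df x.
Qed.

Lemma one_minus_cos (x : R) : 1 - cos (2 * pi * x) = 2 * sin (pi * x) ^+ 2.
Proof.
have -> : 2 * pi * x = pi * x + pi * x by ring.
rewrite cosD; have := cos2Dsin2 (pi * x); lra.
Qed.

Lemma one_minus_cos_gt0 (x : R) : 0 < x < 1 -> 0 < 1 - cos (2 * pi * x).
Proof.
move=> /andP[x0 x1]; rewrite one_minus_cos mulr_gt0// exprn_gt0//.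
apply: sin_gt0_pi; rewrite mulr_gt0 ?pi_gt0//= -[ltRHS]mulr1.
by rewrite ltr_pM2l ?pi_gt0.
Qed.

(* bump0 (1/(m+1) - (1 - cos (2 pi x))): periodic and even, and positive only
   where 1 - cos (2 pi x) is small, that is near the integers. *)
Let sb m (x : R) := bump0 (1 * cos (2 * pi * x + 0) + (m.+1%:R^-1 - 1)).

Let sb_neq0 m x : sb m x != 0 -> 1 - cos (2 * pi * x) < m.+1%:R^-1.
Proof.
by move=> /bump0_neq0; rewrite mul1r addr0; set q := _^-1; move: q => q; lra.
Qed.

Let smooth1_sb m : smooth1 (sb m).
Proof.
apply: (smooth1_comp (g := fun x => 1 * cos (2 * pi * x + 0) + (m.+1%:R^-1 - 1))).
  exact: smooth1_bump0.
apply: (smooth1_comp (f := fun x => 1 * x + (m.+1%:R^-1 - 1))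
   (g := fun x => cos (2 * pi * x + 0))); first exact: smooth1_affine.
apply: (smooth1_comp (f := cos) (g := fun x => 2 * pi * x + 0)).
  exact: smooth1_cos.
exact: smooth1_affine.
Qed.

Let sb_gt0 m : exists2 x : R, 0 < x < 1 & 0 < sb m x.
Proof.
have cs := smooth1_continuous (smooth1_sb m).
have s0 : 0 < sb m 0.
  rewrite /sb bump0_gt0 mulr0 addr0 cos0 mul1r addrCA subrr addr0 invr_gt0.
  by rewrite ltr0n.
have /nbhs_ballP[e /= e0 he] : \forall x \near (0 : R), 0 < sb m x.
  exact: cvgr_gt (cs 0) _ s0.
exists (Num.min (e / 2) (1 / 2)).
  rewrite lt_min !divr_gt0//= gt_min; apply/orP; right; lra.
apply: he; rewrite /ball /= sub0r normrN gtr0_norm.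
  by rewrite gt_min; apply/orP; left; lra.
by rewrite lt_min !divr_gt0.
Qed.

(** Bumps on the circle, as functions of period one, so that products of them
    are test functions on the torus.  Concentration at the integers is stated
    away from 1 and -1, which represent the same point as 0. *)
Lemma space_bumps : exists k : nat -> R -> R,
  [/\ forall m, smooth1 (k m) /\ (forall x, k m (x + 1) = k m x),
      forall m x, 0 <= k m x,
      forall m x, k m (- x) = k m x,
      forall m, \int[leb1]_(x in `[0, 1[) k m x = 1 &
      forall d : R, 0 < d -> \forall m \near \oo,
        forall x, `|x| <= 1 - d -> k m x != 0 -> `|x| < d].
Proof.
pose Z m := \int[leb1]_(x in `[0, 1[) sb m x.
have cs m : continuous (sb m) by exact: smooth1_continuous.
have Z0 m : 0 < Z m.
  have [x x01 sx] := sb_gt0 m.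
  rewrite /Z continuous_Rintegral_co_oo//.
  by apply: mass_gt0 sx => // y; exact: bump0_ge0.
exists (fun m x => (Z m)^-1 * sb m x); split.
- move=> m; split.
    by apply: smooth1M; [exact: smooth1_cst|exact: smooth1_sb].
  move=> x; congr (_ * bump0 (1 * _ + _)); rewrite !addr0.
  rewrite mulrDr mulr1 cosD mulr_natl cos2pi sin2pi; ring.
- move=> m x; apply: mulr_ge0; last exact: bump0_ge0.
  by rewrite invr_ge0 ltW.
- by move=> m x; rewrite /sb !addr0 mulrN cosN.
- move=> m; rewrite RintegralZl//; first by rewrite mulVf// gt_eqF.
  have icc : leb1.-integrable `[0, 1] (EFin \o sb m).
    apply: continuous_compact_integrable; first exact: segment_compact.
    exact: continuous_subspaceT.
  by apply: integrableS icc => //; exact: subset_itv_co_cc.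
move=> d d0.
have [d1|d1] := ltP (1 - d) d.
  by exists 0%N => // m _ x xd _; exact: le_lt_trans d1.
have cg : {within `[d, 1 - d], continuous (fun x : R => 1 - cos (2 * pi * x))}.
  apply: continuous_subspaceT => x; apply: cvgB; first exact: cvg_cst.
  apply: continuous_comp; last exact: continuous_cos.
  by apply: cvgM; [exact: cvg_cst|exact: cvg_id].
have [c cd hc] := EVT_min d1 cg.
have c0 : 0 < 1 - cos (2 * pi * c).
  move: cd; rewrite in_itv/= => /andP[? ?]; apply: one_minus_cos_gt0.
  by apply/andP; split; lra.
have [n0 _ hn] := near_infty_natSinv_lt (PosNum c0).
exists n0 => // m /= /hn /= hm x xd; rewrite mulf_eq0 negb_or.
move=> /andP[_ /sb_neq0 sx]; rewrite ltNge; apply/negP => dx.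
have : `|x| \in `[d, 1 - d] by rewrite in_itv/= dx.
move=> /hc; rewrite leNgt => /negP; apply.
apply: le_lt_trans hm; apply: ltW; apply: le_lt_trans sx.
by have [_|_] := ger0P x; rewrite // mulrN cosN.
Qed.

Let eps (m : nat) : R := (2 * m.+1%:R)^-1.

Let eps_gt0 m : 0 < eps m.
Proof. by rewrite invr_gt0 mulr_gt0. Qed.

Let eps2 m : 2 * eps m = m.+1%:R^-1.
Proof. by rewrite /eps invfM mulrA divff ?mul1r. Qed.

Let tb m (t : R) := bump0 (1 * t + - eps m) * bump0 (- 1 * t + 2 * eps m).

Let tb_neq0 m t : tb m t != 0 -> eps m < t < 2 * eps m.
Proof.
rewrite mulf_eq0 negb_or => /andP[/bump0_neq0 h1 /bump0_neq0 h2].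
by apply/andP; split; lra.
Qed.

(** Time bumps charge strictly positive times only: averages then look forward
    in time, and the translated kernels vanish near the initial time. *)
Lemma time_bumps : exists k : nat -> R -> R,
  [/\ forall m, smooth1 (k m),
      forall m x, 0 <= k m x,
      forall m x, k m x != 0 -> (2 * m.+1%:R)^-1 < x < m.+1%:R^-1 &
      forall m, \int[leb1]_(x in `]0, 1[) k m x = 1].
Proof.
have sT m : smooth1 (tb m).
  apply: smooth1M.
    by apply: smooth1_comp; [exact: smooth1_bump0|exact: smooth1_affine].
  by apply: smooth1_comp; [exact: smooth1_bump0|exact: smooth1_affine].
have cT m : continuous (tb m) by exact: smooth1_continuous.
have T0 m x : 0 <= tb m x by rewrite mulr_ge0 ?bump0_ge0.
pose Z m := \int[leb1]_(x in `]0, 1[) tb m x.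
have Z0 m : 0 < Z m.
  have e0 := eps_gt0 m.
  apply: (mass_gt0 (x0 := 3 / 2 * eps m)) => //.
    apply/andP; split; first lra.
    have : 2 * eps m <= 1 by rewrite eps2 invf_le1// ler1n.
    lra.
  by rewrite /tb mulr_gt0// bump0_gt0; lra.
exists (fun m x => (Z m)^-1 * tb m x); split.
- by move=> m; apply: smooth1M; [exact: smooth1_cst|exact: sT].
- by move=> m x; apply: mulr_ge0 => //; rewrite invr_ge0 ltW.
- move=> m x; rewrite mulf_eq0 negb_or => /andP[_ /tb_neq0].
  by rewrite eps2.
- move=> m; rewrite RintegralZl//; first by rewrite mulVf// gt_eqF.
  have icc : leb1.-integrable `[0, 1] (EFin \o tb m).
    apply: continuous_compact_integrable; first exact: segment_compact.
    exact: continuous_subspaceT.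
  by apply: integrableS icc => //; exact: subset_itv_oo_cc.
Qed.

End Bumps.

(** * The mollifying kernel *)
Section TensorProducts.
Variable R : realType.
Notation leb1 := (@lebesgue_measure R).
Implicit Types (a b c d : R -> R) (z w : spacetime R).

Definition tensor a b c d z : R := a z.1.1.1 * b z.1.1.2 * c z.1.2 * d z.2.

Lemma is_derive_shifted (f : R -> R) (x l k : R) : is_derive x (1 : R) f l ->
  is_derive (0 : R) (1 : R) (fun s => k * f (x + s)) (k * l).
Proof.
move=> df.
have df' : is_derive (0 : R) (1 : R) (fun s => f (x + s)) l.
  have := (is_derive_line0 f x (1 : R) l).1 df.
  by under eq_fun do rewrite [_ *: _]mulr1.
exact: (is_deriveZ k df').
Qed.

Lemma is_derive_tensor a b c d a' b' c' d' w :
  (forall x, is_derive x (1 : R) a (a' x)) ->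
  (forall x, is_derive x (1 : R) b (b' x)) ->
  (forall x, is_derive x (1 : R) c (c' x)) ->
  (forall x, is_derive x (1 : R) d (d' x)) -> forall o : option 'I_3,
  is_derive w (axis R o) (tensor a b c d)
   (match o with
    | None => tensor a b c d' w
    | Some k => if k == 0%N :> nat then tensor a' b c d w else
                if k == 1%N :> nat then tensor a b' c d w else
                tensor a b c' d w
    end).
Proof.
move=> da db dc dd o; apply/is_derive_line0.
case: o => [k|]; last first.
  under eq_fun do rewrite axisE3 /tensor /=.
  exact: is_derive_shifted.
move: k; apply: ord3P => /=.
- under eq_fun do rewrite axisE0 /tensor /=.
  rewrite (_ : (fun s => _) = (fun s => (b w.1.1.2 * c w.1.2 * d w.2) * a (w.1.1.1 + s))).
    rewrite (_ : tensor _ _ _ _ _ = (b w.1.1.2 * c w.1.2 * d w.2) * a' w.1.1.1).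
      exact: is_derive_shifted.
    by rewrite /tensor; ring.
  by apply/funext => s; ring.
- under eq_fun do rewrite axisE1 /tensor /=.
  rewrite (_ : (fun s => _) = (fun s => (a w.1.1.1 * c w.1.2 * d w.2) * b (w.1.1.2 + s))).
    rewrite (_ : tensor _ _ _ _ _ = (a w.1.1.1 * c w.1.2 * d w.2) * b' w.1.1.2).
      exact: is_derive_shifted.
    by rewrite /tensor; ring.
  by apply/funext => s; ring.
- under eq_fun do rewrite axisE2 /tensor /=.
  rewrite (_ : (fun s => _) = (fun s => (a w.1.1.1 * b w.1.1.2 * d w.2) * c (w.1.2 + s))).
    rewrite (_ : tensor _ _ _ _ _ = (a w.1.1.1 * b w.1.1.2 * d w.2) * c' w.1.2).
      exact: is_derive_shifted.
    by rewrite /tensor; ring.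
  by apply/funext => s; ring.
Qed.

Let continuous_factors (U : topologicalType) (f : U -> R) (g : R -> R) :
  continuous f -> continuous g -> continuous (fun z : U * R => f z.1 * g z.2).
Proof.
move=> cf cg z; apply: cvgM.
  by apply: continuous_comp; [exact: cvg_fst|exact: cf].
by apply: continuous_comp; [exact: cvg_snd|exact: cg].
Qed.

(** A partial derivative of a product of functions of one variable each is a
    product of the same kind. *)
Lemma smooth_tensor a b c d : smooth1 a -> smooth1 b -> smooth1 c -> smooth1 d ->
  smooth (tensor a b c d).
Proof.
move=> sa sb sc sd s; move: a b c d sa sb sc sd.
elim/last_ind: s => [|s o IH] a b c d sa sb sc sd.
  have [a' da _] := smooth1_derive sa; have [b' db _] := smooth1_derive sb.
  have [c' dc _] := smooth1_derive sc; have [d' dd _] := smooth1_derive sd.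
  split => [z|o z]; last by have [] := is_derive_tensor z da db dc dd o.
  have [ca cb] := (smooth1_continuous sa, smooth1_continuous sb).
  have [cc cd] := (smooth1_continuous sc, smooth1_continuous sd).
  exact: (continuous_factors (continuous_factors (continuous_factors ca cb) cc) cd).
rewrite foldr_rcons.
have [a' da sa'] := smooth1_derive sa; have [b' db sb'] := smooth1_derive sb.
have [c' dc sc'] := smooth1_derive sc; have [d' dd sd'] := smooth1_derive sd.
have E : partial o (tensor a b c d) = match o with
    | None => tensor a b c d'
    | Some k => if k == 0%N :> nat then tensor a' b c d else
                if k == 1%N :> nat then tensor a b' c d else
                tensor a b c' d
    end.
  apply/funext => z; rewrite /partial.
  rewrite (@derive_val _ _ _ _ _ _ _ (is_derive_tensor z da db dc dd o)).
  by case: o => // k; case: ifP => // _; case: ifP.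
rewrite E; case: o {E} => [k|]; last exact: IH.
by case: ifP => _; [|case: ifP => _]; exact: IH.
Qed.

Lemma continuous_bounded (f : R -> R) (r : R) : continuous f ->
  exists C : R, forall x, `|x| <= r -> `|f x| <= C.
Proof.
move=> cf.
have : compact (f @` `[- r, r]).
  apply: continuous_compact; last exact: segment_compact.
  exact: continuous_subspaceT.
move=> /compact_bounded[C [_ hC]]; exists (C + 1) => x xr.
apply: (hC (C + 1)); first by rewrite ltrDl.
by exists x => //; rewrite /= in_itv/= -ler_norml.
Qed.

Let integral_product (d1 d2 : measure_display) (T1 : measurableType d1) (T2 : measurableType d2)
  (m1 : {sigma_finite_measure set T1 -> \bar R})
  (m2 : {sigma_finite_measure set T2 -> \bar R})
  (A : set T1) (B : set T2) (f : T1 -> R) (g : T2 -> R) (Cf Cg : R) :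
  measurable A -> measurable B -> (m1 A < +oo)%E -> (m2 B < +oo)%E ->
  measurable_fun setT f -> measurable_fun setT g ->
  (forall x, A x -> `|f x| <= Cf) -> (forall y, B y -> `|g y| <= Cg) ->
  \int[(m1 \x m2)%E]_(z in A `*` B) (f z.1 * g z.2) =
  (\int[m1]_(x in A) f x) * \int[m2]_(y in B) g y.
Proof.
move=> mA mB fA fB mf mg bf bg.
have mfg : measurable_fun setT (fun z : T1 * T2 => f z.1 * g z.2).
  apply: measurable_funM; first exact: (measurableT_comp mf).
  exact: (measurableT_comp mg).
rewrite (bounded_Fubini1 mA mB fA fB mfg (C := Cf * Cg)); last first.
  by move=> x y Ax By; rewrite normrM ler_pM ?bf ?bg.
have ig : m2.-integrable B (EFin \o g).
  by apply: (bounded_integrable _ _ _ bg) => //; exact: measurable_funTS.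
have if_ : m1.-integrable A (EFin \o f).
  by apply: (bounded_integrable _ _ _ bf) => //; exact: measurable_funTS.
transitivity (\int[m1]_(x in A) (f x * \int[m2]_(y in B) g y)).
  by apply: eq_Rintegral => x _; rewrite -RintegralZl.
by rewrite RintegralZr.
Qed.

Section Integrals.
Variables (a b c d : R -> R).
Hypotheses (ca : continuous a) (cb : continuous b) (cc : continuous c)
  (cd : continuous d).

Let I01_norm (x : R) : `[0, 1[%classic x -> `|x| <= 1.
Proof. by rewrite /= in_itv/= => /andP[x0 /ltW x1]; rewrite ger0_norm. Qed.

Let mII : measurable (`[0, 1[ `*` `[0, 1[ : set (measurableTypeR R * measurableTypeR R)).
Proof. exact: measurableX. Qed.

Let fII : ((leb1 \x leb1) (`[0%R, 1%R[ `*` `[0%R, 1%R[)%classic < +oo)%E.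
Proof. by apply: finite_product_measure => //; exact: leb1_itv01. Qed.

Lemma integral_tensor_cell :
  \int[leb3]_(x in cell) (a x.1.1 * b x.1.2 * c x.2) =
  (\int[leb1]_(x in `[0, 1[) a x) * (\int[leb1]_(x in `[0, 1[) b x) *
  \int[leb1]_(x in `[0, 1[) c x.
Proof.
have [Ca ba] := continuous_bounded 1 ca; have [Cb bb] := continuous_bounded 1 cb.
have [Cc bc] := continuous_bounded 1 cc.
have mab : measurable_fun setT (fun x : measurableTypeR R * measurableTypeR R => a x.1 * b x.2).
  apply: measurable_funM.
    exact: (measurableT_comp (continuous_measurable_fun ca)).
  exact: (measurableT_comp (continuous_measurable_fun cb)).
have mI : measurable (`[0, 1[%classic : set (measurableTypeR R)) by [].
rewrite (@integral_product _ _ _ _ (prod_measure leb1 leb1) leb1 _ _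
  (fun x => a x.1 * b x.2) c (Ca * Cb) Cc mII mI fII (@leb1_itv01 R) mab)//; first 1 last.
- exact: continuous_measurable_fun.
- by move=> [x y] [/= /I01_norm hx /I01_norm hy]; rewrite normrM ler_pM ?ba ?bb.
- by move=> x /I01_norm; exact: bc.
congr (_ * _).
rewrite (@integral_product _ _ _ _ leb1 leb1 _ _ a b Ca Cb mI mI (@leb1_itv01 R) (@leb1_itv01 R))//.
- exact: continuous_measurable_fun.
- exact: continuous_measurable_fun.
- by move=> x /I01_norm; exact: ba.
- by move=> x /I01_norm; exact: bb.
Qed.

Lemma integral_tensor (M : R) :
  \int[leb4]_(z in cylinder `]0, M[) tensor a b c d z =
  (\int[leb1]_(x in `[0, 1[) a x) * (\int[leb1]_(x in `[0, 1[) b x) *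
  (\int[leb1]_(x in `[0, 1[) c x) * \int[leb1]_(x in `]0, M[) d x.
Proof.
have [Ca ba] := continuous_bounded 1 ca; have [Cb bb] := continuous_bounded 1 cb.
have [Cc bc] := continuous_bounded 1 cc; have [Cd bd] := continuous_bounded M cd.
have mI : measurable (`]0, M[%classic : set (measurableTypeR R)) by [].
rewrite -integral_tensor_cell.
rewrite (@integral_product _ _ _ _ leb3 leb1 _ _
  (fun x => a x.1.1 * b x.1.2 * c x.2) d (Ca * Cb * Cc) Cd
  (@measurable_cell R) mI (@leb3_cell_fin R) (leb1_itv M))//.
- apply: measurable_funM; last first.
    exact: (measurableT_comp (continuous_measurable_fun cc)).
  apply: measurable_funM.
    apply: (measurableT_comp (continuous_measurable_fun ca)).
    exact: (measurableT_comp measurable_fst measurable_fst).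
  apply: (measurableT_comp (continuous_measurable_fun cb)).
  exact: (measurableT_comp measurable_snd measurable_fst).
- exact: continuous_measurable_fun.
- move=> [[x y] z] [[/= /I01_norm hx /I01_norm hy] /I01_norm hz].
  rewrite !normrM; apply: ler_pM; [by rewrite mulr_ge0|by []| |exact: bc].
  by rewrite ler_pM ?ba ?bb.
- move=> x; rewrite /= in_itv/= => /andP[x0 /ltW x1]; apply: bd.
  by rewrite ger0_norm// ltW.
Qed.

End Integrals.

End TensorProducts.

Section Kernel.
Variable R : realType.
Notation leb1 := (@lebesgue_measure R).
Notation line := (measurableTypeR R).
Implicit Types (z w : spacetime R).

(** Periodic even bumps [k] for the three space variables and one-sided bumps
    [th] for time, both of unit mass and concentrating at 0. *)
Record bumps (k th : nat -> R -> R) : Prop := Bumps {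
  k_smooth : forall m, smooth1 (k m);
  k_periodic : forall m x, k m (x + 1) = k m x;
  k_ge0 : forall m x, 0 <= k m x;
  k_even : forall m x, k m (- x) = k m x;
  k_mass : forall m, \int[leb1]_(x in `[0, 1[) k m x = 1;
  k_concentrates : forall d : R, 0 < d -> \forall m \near \oo,
    forall x, `|x| <= 1 - d -> k m x != 0 -> `|x| < d;
  th_smooth : forall m, smooth1 (th m);
  th_ge0 : forall m x, 0 <= th m x;
  th_support : forall m x, th m x != 0 -> (2 * m.+1%:R)^-1 < x < m.+1%:R^-1;
  th_mass : forall m, \int[leb1]_(x in `]0, 1[) th m x = 1 }.

Lemma bumps_exist : exists k th, bumps k th.
Proof.
have [k [k1 k2 k3 k4 k5]] := space_bumps R.
have [th [t1 t2 t3 t4]] := time_bumps R.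
by exists k, th; split => // m; have [] := k1 m.
Qed.

Variables (k th : nat -> R -> R).
Hypothesis kth : bumps k th.

Definition kernel m : spacetime R -> R := tensor (k m) (k m) (k m) (th m).

Let ck m : continuous (k m). Proof. apply: smooth1_continuous; exact: (k_smooth kth). Qed.
Let ct m : continuous (th m). Proof. apply: smooth1_continuous; exact: (th_smooth kth). Qed.

Let translate_continuous (f : R -> R) (y : R) : continuous f ->
  continuous (fun x => f (x - y)).
Proof.
move=> cf t; apply: continuous_comp; last exact: cf.
by apply: cvgB; [exact: cvg_id|exact: cvg_cst].
Qed.

Let reflect_continuous (f : R -> R) (y : R) : continuous f ->
  continuous (fun x => f (y - x)).
Proof.
move=> cf t; apply: continuous_comp; last exact: cf.
by apply: cvgB; [exact: cvg_cst|exact: cvg_id].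
Qed.

Lemma smooth_kernel m : smooth (kernel m).
Proof. by apply: smooth_tensor; [exact: (k_smooth kth)..|exact: (th_smooth kth)]. Qed.

Lemma kernel_ge0 m z : 0 <= kernel m z.
Proof. by rewrite /kernel /tensor !mulr_ge0 ?(k_ge0 kth) ?(th_ge0 kth). Qed.

Lemma kernel_periodic m : periodic_in_space (kernel m).
Proof.
move=> t i [[x y] z]; move: i; apply: ord3P;
  by rewrite /kernel /tensor /= ?addr0 ?(k_periodic kth).
Qed.

Lemma kernel_time m z : kernel m z != 0 ->
  (2 * m.+1%:R)^-1 < z.2 < m.+1%:R^-1.
Proof. by rewrite mulf_eq0 negb_or => /andP[_ /(th_support kth)]. Qed.

Let th_01 m x : th m x != 0 -> 0 < x < 1.
Proof.
move=> /(th_support kth)/andP[h1 h2]; apply/andP; split.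
  by apply: lt_trans h1; rewrite invr_gt0 mulr_gt0.
by apply: lt_le_trans h2 _; rewrite invf_le1// ler1n.
Qed.

Let k_translate_mass m y : \int[leb1]_(x in `[0, 1[) k m (x - y) = 1.
Proof. by rewrite mass_periodic ?(k_mass kth)//; exact: (k_periodic kth). Qed.

Let k_reflect_mass m y : \int[leb1]_(x in `[0, 1[) k m (y - x) = 1.
Proof.
rewrite -[RHS](k_translate_mass m y); apply: eq_Rintegral => x _.
by rewrite -(k_even kth) opprB.
Qed.

(** The space factors have unit mass over any period; only time can lose mass,
    when the window reaches beyond the final time. *)
Lemma kernel_mass m (M : R) w : \int[leb4]_(z in cylinder `]0, M[) kernel m (z - w) =
  \int[leb1]_(t in `]0, M[) th m (t - w.2).
Proof.
have := integral_tensor (@translate_continuous _ w.1.1.1 (@ck m))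
  (@translate_continuous _ w.1.1.2 (@ck m)) (@translate_continuous _ w.1.2 (@ck m))
  (@translate_continuous _ w.2 (@ct m)) M.
by rewrite !k_translate_mass !mul1r.
Qed.

Lemma kernel_mass_le m (M : R) w : 0 < M ->
  \int[leb4]_(z in cylinder `]0, M[) kernel m (z - w) <= 1.
Proof.
move=> M0; rewrite kernel_mass -(th_mass kth m).
apply: mass_translate_le => //; [exact: (th_ge0 kth)|exact: th_01].
Qed.

Lemma kernel_mass_eq m (M : R) w : 0 <= w.2 -> w.2 + 1 <= M ->
  \int[leb4]_(z in cylinder `]0, M[) kernel m (z - w) = 1.
Proof.
move=> w0 wM; rewrite kernel_mass -(th_mass kth m).
have M0 : 0 < M by apply: lt_le_trans wM; rewrite ltr_wpDl.
apply: mass_translate_eq => //; [exact: (th_ge0 kth)|exact: th_01].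
Qed.

Lemma kernel_reflect_mass_le m (T : R) z : 0 < T ->
  \int[leb4]_(w in cylinder `]0, T[) kernel m (z - w) <= 1.
Proof.
move=> T0.
have := integral_tensor (@reflect_continuous _ z.1.1.1 (@ck m))
  (@reflect_continuous _ z.1.1.2 (@ck m)) (@reflect_continuous _ z.1.2 (@ck m))
  (@reflect_continuous _ z.2 (@ct m)) T.
rewrite !k_reflect_mass !mul1r => ->; rewrite -(th_mass kth m).
apply: mass_reflect_le => //; [exact: (th_ge0 kth)|exact: th_01].
Qed.

Lemma kernel_trace m z (s : R) :
  \int[leb3]_(y in cell) kernel m (z - (y, s)) = th m (z.2 - s).
Proof.
pose t := th m (z.2 - s).
have cc : continuous (fun x => k m (z.1.2 - x) * t).
  by move=> x; apply: cvgM; [exact: reflect_continuous|exact: cvg_cst].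
have := integral_tensor_cell (@reflect_continuous _ z.1.1.1 (@ck m))
  (@reflect_continuous _ z.1.1.2 (@ck m)) cc.
rewrite !k_reflect_mass !mul1r RintegralZr//; last first.
  have icc : leb1.-integrable `[0, 1] (EFin \o (fun x => k m (z.1.2 - x))).
    apply: continuous_compact_integrable; first exact: segment_compact.
    by apply: continuous_subspaceT; exact: reflect_continuous.
  by apply: integrableS icc => //; exact: subset_itv_co_cc.
rewrite k_reflect_mass mul1r -/t => <-; apply: eq_Rintegral => y _.
by rewrite /kernel /tensor mulrA.
Qed.

End Kernel.

(** * Mollification converges in L2 *)
Section KernelApproximatesIdentity.
Variable R : realType.
Notation leb1 := (@lebesgue_measure R).
Notation line := (measurableTypeR R).
Notation ST := (line * line * line * line)%type.

Let null1 (a : R) : leb1 [set a] = 0%E. Proof. exact: lebesgue_measure_set1. Qed.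

Let product_null_fst d1 d2 (T1 : measurableType d1) (T2 : measurableType d2)
  (m1 : {sigma_finite_measure set T1 -> \bar R})
  (m2 : {sigma_finite_measure set T2 -> \bar R}) (A : set T1) :
  measurable A -> m1 A = 0%E ->
  measurable (A `*` @setT T2) /\ prod_measure m1 m2 (A `*` setT) = 0%E.
Proof.
move=> mA A0; split; first exact: measurableX.
by rewrite /prod_measure product_measure1E// [X in (X * _)%E]A0 mul0e.
Qed.

Let product_null_snd d1 d2 (T1 : measurableType d1) (T2 : measurableType d2)
  (m1 : {sigma_finite_measure set T1 -> \bar R})
  (m2 : {sigma_finite_measure set T2 -> \bar R}) (A : set T2) :
  measurable A -> m2 A = 0%E ->
  measurable (@setT T1 `*` A) /\ prod_measure m1 m2 (setT `*` A) = 0%E.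
Proof.
move=> mA A0; split; first exact: measurableX.
by rewrite /prod_measure product_measure1E// [X in (_ * X)%E]A0 mule0.
Qed.

(** Level sets of the coordinates are null, so that half-spaces have null
    boundary. *)
Lemma coordinates_neq_ae (a : R) : {ae leb4, forall w : ST,
  [/\ w.1.1.1 != a, w.1.1.2 != a, w.1.2 != a & w.2 != a]}.
Proof.
have ma : measurable ([set a] : set line) by [].
have [mx nx] := @product_null_fst _ _ _ _ leb1 leb1 _ ma (null1 a).
have [my ny] := @product_null_snd _ _ _ _ leb1 leb1 _ ma (null1 a).
have [mx3 nx3] := @product_null_fst _ _ _ _ (prod_measure leb1 leb1) leb1 _ mx nx.
have [my3 ny3] := @product_null_fst _ _ _ _ (prod_measure leb1 leb1) leb1 _ my ny.
have [mz3 nz3] := @product_null_snd _ _ _ _ (prod_measure leb1 leb1) leb1 _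
  ma (null1 a).
have [mx4 nx4] := @product_null_fst _ _ _ _ leb3 leb1 _ mx3 nx3.
have [my4 ny4] := @product_null_fst _ _ _ _ leb3 leb1 _ my3 ny3.
have [mz4 nz4] := @product_null_fst _ _ _ _ leb3 leb1 _ mz3 nz3.
have [mt4 nt4] := @product_null_snd _ _ _ _ leb3 leb1 _ ma (null1 a).
have ae (p : ST -> R) (N : set ST) : measurable N -> leb4 N = 0%E ->
    (forall w, p w = a -> N w) -> {ae leb4, forall w, p w != a}.
  move=> mN N0 pN; exists N; split => // w /= /negP; rewrite negbK => /eqP.
  exact: pN.
have h1 : {ae leb4, forall w : ST, w.1.1.1 != a}.
  by apply: (ae _ _ mx4 nx4) => w.
have h2 : {ae leb4, forall w : ST, w.1.1.2 != a}.
  by apply: (ae _ _ my4 ny4) => w.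
have h3 : {ae leb4, forall w : ST, w.1.2 != a}.
  by apply: (ae _ _ mz4 nz4) => w.
have h4 : {ae leb4, forall w : ST, w.2 != a}.
  by apply: (ae _ _ mt4 nt4) => w.
apply: filterS2 (filterI h1 h2) (filterI h3 h4) => w [? ?] [? ?].
by split.
Qed.

Variables (k th : nat -> R -> R) (M : R).
Hypothesis kth : bumps k th.

Lemma measurable_kernel_difference m : measurable_fun setT
  (fun p : ST * ST => kernel k th m ((p.1 : spacetime R) - p.2)).
Proof.
have md (f : R -> R) (p : ST -> line) : continuous f -> measurable_fun setT p ->
    measurable_fun setT (fun q : ST * ST => f ((p q.1 : R) - p q.2)).
  move=> cf mp; apply: (measurableT_comp (continuous_measurable_fun cf)).
  apply: (@measurable_funB _ _ _ _ (fun q : ST * ST => p q.1) (fun q => p q.2)).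
    exact: (measurableT_comp mp measurable_fst).
  exact: (measurableT_comp mp measurable_snd).
have ck := smooth1_continuous (k_smooth kth m).
have ct := smooth1_continuous (th_smooth kth m).
have m11 : measurable_fun setT (fun z : ST => z.1.1).
  exact: (measurableT_comp measurable_fst measurable_fst).
apply: measurable_funM; last exact: (md _ snd ct).
apply: measurable_funM; last first.
  apply: (md _ (fun z => z.1.2) ck).
  exact: (measurableT_comp measurable_snd measurable_fst).
apply: measurable_funM.
  apply: (md _ (fun z => z.1.1.1) ck).
  exact: (measurableT_comp measurable_fst m11).
apply: (md _ (fun z => z.1.1.2) ck).
exact: (measurableT_comp measurable_snd m11).
Qed.

Hypothesis M1 : 1 < M.
Let A : set ST := cylinder `]0, M[.
Let B : set ST := cylinder `]0, M - 1[.

Let mA : measurable A. Proof. exact: measurable_cylinder. Qed.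
Let mB : measurable B. Proof. exact: measurable_cylinder. Qed.
Let fA : (leb4 A < +oo)%E. Proof. exact: leb4_cylinder_fin. Qed.

Let BA : B `<=` A. Proof. by apply: cylinder_le; rewrite gerBl. Qed.

Let h m (z w : ST) : R := kernel k th m ((z : spacetime R) - w).

(* The kernel between the two cylinders.  [B] stops one unit of time before
   [A], so that the windows of its points stay in [A]. *)
Let K m (p : ST * ST) : R := \1_A p.1 * \1_B p.2 * h m p.1 p.2.

Let h0 m z w : 0 <= h m z w. Proof. exact: kernel_ge0. Qed.

Let K0 m p : 0 <= K m p.
Proof. by apply: mulr_ge0; [rewrite mulr_ge0|exact: h0]. Qed.

Let mh m : measurable_fun setT (fun p : ST * ST => h m p.1 p.2).
Proof. exact: measurable_kernel_difference. Qed.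

Let mK m : measurable_fun setT (K m).
Proof.
have mA1 : measurable_fun setT (\1_A : ST -> R) by exact: measurable_indic.
have mB1 : measurable_fun setT (\1_B : ST -> R) by exact: measurable_indic.
apply: measurable_funM => //; apply: measurable_funM.
  exact: (measurableT_comp mA1 measurable_fst).
exact: (measurableT_comp mB1 measurable_snd).
Qed.

Let h_bounded m z w : A z -> A w -> exists2 C : R, `|h m z w| <= C &
  forall z' w', A z' -> A w' -> `|h m z' w'| <= C.
Proof.
have [C hC] := smooth_bounded (Num.max 1 M + Num.max 1 M) (smooth_kernel kth m).
have H z' w' : A z' -> A w' -> `|h m z' w'| <= C.
  move=> /cylinder_norm Az /cylinder_norm Aw.
  by apply: hC; rewrite (le_trans (ler_normB _ _))// lerD.
by move=> Az Aw; exists C; [exact: H|].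
Qed.

Let integral_indic_mul (E : set ST) (g : ST -> R) :
  (\int[leb4]_z (\1_E z * g z)%:E = \int[leb4]_(z in E) (g z)%:E)%E.
Proof.
rewrite [RHS]integral_mkcond; apply: eq_integral => z _.
by rewrite patchE indicE; case: (_ \in _); rewrite ?mul1r ?mul0r.
Qed.

Let ind1 (E : set ST) z : E z -> \1_E z = 1 :> R.
Proof. by move=> Ez; rewrite indicE mem_set. Qed.

Let ind0 (E : set ST) z : ~ E z -> \1_E z = 0 :> R.
Proof. by move=> Ez; rewrite indicE memNset. Qed.

Let K1 m w : (\int[leb4]_z (K m (z, w))%:E <= (\1_A w)%:E)%E.
Proof.
rewrite /K /=; have [Bw|Bw] := pselect (B w); last first.
  rewrite integral0_eq ?lee_fin// => z _.
  by rewrite (ind0 Bw) mulr0 mul0r.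
rewrite [leRHS](_ : _ = 1%E); last by rewrite (ind1 (BA Bw)).
under eq_integral do rewrite (ind1 Bw) mulr1.
rewrite integral_indic_mul -EFin_Rintegral//; last first.
  have [C _ hC] := h_bounded m (BA Bw) (BA Bw).
  apply: (bounded_integrable mA fA _ (C := C)).
    by apply: measurable_funTS; exact: (measurable_fun_pair1 w (mh m)).
  by move=> z Az; apply: hC => //; exact: BA.
by rewrite lee_fin; apply: (kernel_mass_le kth); exact: lt_trans M1.
Qed.

Let K2 m z : (\int[leb4]_w (K m (z, w))%:E <= (\1_A z)%:E)%E.
Proof.
rewrite /K /=; have [Az|Az] := pselect (A z); last first.
  rewrite integral0_eq ?lee_fin// => w _.
  by rewrite (ind0 Az) !mul0r.
rewrite [leRHS](_ : _ = 1%E); last by rewrite (ind1 Az).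
under eq_integral do rewrite (ind1 Az) mul1r.
rewrite integral_indic_mul -EFin_Rintegral//; last first.
  have [C _ hC] := h_bounded m Az Az.
  apply: (bounded_integrable mB _ _ (C := C)).
  - exact: leb4_cylinder_fin.
  - by apply: measurable_funTS; exact: (measurable_fun_pair2 z (mh m)).
  - by move=> w Bw; apply: hC => //; exact: BA.
by rewrite lee_fin; apply: (kernel_reflect_mass_le kth); rewrite subr_gt0.
Qed.

Let KB m w : B w -> (\int[leb4]_z (K m (z, w))%:E = 1)%E.
Proof.
move=> Bw; rewrite /K /=.
under eq_integral do rewrite (ind1 Bw) mulr1.
rewrite integral_indic_mul -EFin_Rintegral//; last first.
  have [C _ hC] := h_bounded m (BA Bw) (BA Bw).
  apply: (bounded_integrable mA fA _ (C := C)).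
    by apply: measurable_funTS; exact: (measurable_fun_pair1 w (mh m)).
  by move=> z Az; apply: hC => //; exact: BA.
rewrite (kernel_mass_eq kth m (M := M) (w := w))//.
  by case: w Bw => x t [_] /=; rewrite in_itv/= => /andP[/ltW].
case: w Bw => x t [_] /=; rewrite in_itv/= => /andP[_]; lra.
Qed.

Let Kb m : exists C, forall p, K m p <= C.
Proof.
have [[z [Az _]]|nz] := pselect (exists z, A z /\ A z); last first.
  exists 0 => p; rewrite /K indicE memNset ?mul0r// => Ap.
  by apply: nz; exists p.1.
have [C _ hC] := h_bounded m Az Az; exists `|C| => p.
rewrite /K !indicE.
have [/set_mem Ap|_] := boolP (p.1 \in A); last by rewrite !mul0r.
have [/set_mem Bp|_] := boolP (p.2 \in B); last by rewrite mulr0 mul0r.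
rewrite !mul1r (le_trans (ler_norm _))// (le_trans (hC _ _ Ap (BA Bp)))//.
exact: ler_norm.
Qed.

Let Ksupp m z w : ~ A z -> K m (z, w) = 0.
Proof. by move=> nA; rewrite /K /= indicE memNset// !mul0r. Qed.

Let K_neq0 m z w : K m (z, w) != 0 -> [/\ A z, B w,
  k m (z.1.1.1 - w.1.1.1 : R) != 0, k m (z.1.1.2 - w.1.1.2 : R) != 0 &
  k m (z.1.2 - w.1.2 : R) != 0 /\ th m (z.2 - w.2 : R) != 0].
Proof.
rewrite /K /h /kernel /tensor /= !indicE.
have [/set_mem Az|_] := boolP (z \in A); last by rewrite !mul0r eqxx.
have [/set_mem Bw|_] := boolP (w \in B); last by rewrite mulr0 mul0r eqxx.
by rewrite !mul1r !mulf_eq0 !negb_or => /andP[/andP[/andP[h1 h2] h3] h4]; split.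
Qed.

(** On the circle [0, 1), two points coupled by the kernel are close unless
    one of them is close to the base point 0. *)
Let space_side (x a : R) : 0 <= x < 1 -> x != 0 -> x != a ->
  \forall m \near \oo, forall y, 0 <= y < 1 -> k m (y - x) != 0 ->
    (y <= a <-> x <= a).
Proof.
move=> /andP[x0 x1] xn0 xa.
pose d := Num.min x (Num.min (1 - x) `|x - a|).
have d0 : 0 < d.
  by rewrite !lt_min lt_neqAle eq_sym xn0 x0 subr_gt0 x1 normr_gt0 subr_eq0.
have [dx d1 da] : [/\ d <= x, d <= 1 - x & d <= `|x - a|].
  by rewrite /d !ge_min !lexx !orbT.
apply: filterS (k_concentrates kth d0) => m hm y /andP[y0 y1] /hm yx.
have {}yx : `|y - x| < d by apply: yx; rewrite ler_norml; lra.
move: yx da; rewrite ltr_norml => /andP[h1 h2].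
by have [_|_] := ger0P (x - a) => h3; split => h4; lra.
Qed.

Let time_side (x a : R) : x != a ->
  \forall m \near \oo, forall y, th m (y - x) != 0 -> (y <= a <-> x <= a).
Proof.
move=> xa; have d0 : 0 < `|x - a| by rewrite normr_gt0 subr_eq0.
have [n0 _ hn] := near_infty_natSinv_lt (PosNum d0).
exists n0 => // m /= /hn /= hm y /(th_support kth)/andP[h1 h2].
have h3 : 0 < y - x by apply: lt_trans h1; rewrite invr_gt0 mulr_gt0.
have {}h2 := lt_trans h2 hm.
move: h2; have [_|_] := ger0P (x - a) => h2; split => h4; lra.
Qed.

Let cellP (x : position R) : cell x ->
  [/\ 0 <= x.1.1 < 1, 0 <= x.1.2 < 1 & 0 <= x.2 < 1].
Proof. by move=> [[]] /=; rewrite !in_itv. Qed.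

Notation sharpK := (sharp leb4 K).

(** A point off the boundary of a half-space is eventually coupled only with
    points on its side; the boundary is null. *)
Let sharp_half_space (a : R) : [/\ sharpK [set z : ST | (z.1.1.1 : R) <= a],
  sharpK [set z : ST | (z.1.1.2 : R) <= a],
  sharpK [set z : ST | (z.1.2 : R) <= a] & sharpK [set z : ST | (z.2 : R) <= a]].
Proof.
have m11 : measurable_fun setT (fun z : ST => z.1.1).
  exact: (measurableT_comp measurable_fst measurable_fst).
have mle (p : ST -> line) : measurable_fun setT p ->
    measurable [set z | (p z : R) <= a].
  move=> mp; rewrite (_ : [set z | _] = p @^-1` `]-oo, a]).
    by rewrite -[X in measurable X]setTI; exact: mp.
  by apply/seteqP; split => z /=; rewrite in_itv.
split; apply: (sharp_locally mA fA mK K0 K1).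
- by apply: mle; exact: (measurableT_comp measurable_fst m11).
- apply: filterS2 (coordinates_neq_ae 0) (coordinates_neq_ae a) => w [w0 _ _ _] [wa _ _ _].
  have [Bw|nB] := pselect (B w); last first.
    by exists 0%N => // m _ z /K_neq0[].
  have [wc _ _] := cellP Bw.1.
  apply: filterS (space_side wc w0 wa) => m hm z /K_neq0[Az _ kz _ _].
  by have [zc _ _] := cellP Az.1; exact: hm.
- by apply: mle; exact: (measurableT_comp measurable_snd m11).
- apply: filterS2 (coordinates_neq_ae 0) (coordinates_neq_ae a) => w [_ w0 _ _] [_ wa _ _].
  have [Bw|nB] := pselect (B w); last first.
    by exists 0%N => // m _ z /K_neq0[].
  have [_ wc _] := cellP Bw.1.
  apply: filterS (space_side wc w0 wa) => m hm z /K_neq0[Az _ _ kz _].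
  by have [_ zc _] := cellP Az.1; exact: hm.
- by apply: mle; exact: (measurableT_comp measurable_snd measurable_fst).
- apply: filterS2 (coordinates_neq_ae 0) (coordinates_neq_ae a) => w [_ _ w0 _] [_ _ wa _].
  have [Bw|nB] := pselect (B w); last first.
    by exists 0%N => // m _ z /K_neq0[].
  have [_ _ wc] := cellP Bw.1.
  apply: filterS (space_side wc w0 wa) => m hm z /K_neq0[Az _ _ _ [kz _]].
  by have [_ _ zc] := cellP Az.1; exact: hm.
- exact: mle.
- apply: filterS (coordinates_neq_ae a) => w [_ _ _ wa].
  by apply: filterS (time_side wa) => m hm z /K_neq0[_ _ _ _ [_ /hm]].
Qed.

(** Coordinates are measurable for the sigma-algebra of sharp sets, since
    half-spaces are sharp; hence all Borel sets are sharp. *)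
Let sharp_measurable (E : set ST) : measurable E -> sharpK E.
Proof.
have sA := sharp_sigma_algebra mA fA mK K0 K1 K2.
pose S := g_sigma_algebraType sharpK.
have mS (F : set S) : measurable F = sharpK F.
  by rewrite /measurable /= sigma_algebra_id.
have mline (p : S -> line) : (forall a : R, sharpK [set z | (p z : R) <= a]) ->
    measurable_fun setT p.
  move=> hp; apply: (measurability _ (RGenOInfty.measurableE R)) => //.
  move=> _ [_ [a ->] <-]; rewrite setTI mS.
  rewrite (_ : _ @^-1` _ = ~` [set z | (p z : R) <= a]).
    exact: (sharp_setC (hp a)).
  apply/seteqP; split => z /=; rewrite in_itv/= andbT.
    by rewrite ltNge => /negP.
  by rewrite ltNge => /negP.
have m1 : measurable_fun setT (fun z : S => z.1.1.1 : line).
  by apply: mline => a; have [] := sharp_half_space a.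
have m2 : measurable_fun setT (fun z : S => z.1.1.2 : line).
  by apply: mline => a; have [] := sharp_half_space a.
have m3 : measurable_fun setT (fun z : S => z.1.2 : line).
  by apply: mline => a; have [] := sharp_half_space a.
have m4 : measurable_fun setT (fun z : S => z.2 : line).
  by apply: mline => a; have [] := sharp_half_space a.
have mid : measurable_fun setT (fun z : S => z : ST).
  rewrite (_ : (fun z : S => z : ST) =
    (fun z : S => (z.1.1.1 : line, z.1.1.2 : line, z.1.2 : line, z.2 : line))).
    exact: measurable_fun_pair (measurable_fun_pair (measurable_fun_pair m1 m2) m3) m4.
  by apply/funext => -[[[]]].
by move=> mE; rewrite -mS -[E]setTI; exact: mid.
Qed.

Theorem conv_cvg_L2 (f : spacetime R -> R) : measurable_fun setT (f : ST -> R) ->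
  leb4.-integrable A (EFin \o (fun z => f z ^+ 2)) ->
  vanishes (fun m =>
    \int[leb4]_(w in B) ((conv M f (kernel k th m) w - f w) ^+ 2)%:E)%E.
Proof.
move=> mf f2.
have := vanishes_average mA fA mK K0 K1 K2 sharp_measurable mB Kb Ksupp KB mf f2.
apply: vanishes_le; near=> m.
rewrite le_eqVlt; apply/orP; left; apply/eqP; apply: eq_integral => w /set_mem Bw.
suff -> : conv M f (kernel k th m) w = average leb4 K A m f w by [].
apply: eq_Rintegral => z /set_mem Az.
suff -> : K m (z, w) = kernel k th m (z - w) by [].
by rewrite /K /= (ind1 Az) (ind1 Bw) !mul1r.
Unshelve. all: end_near. Qed.

End KernelApproximatesIdentity.

(** * Limits of nonlinear expressions in L1 *)
Section NonlinearLimits.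
Context d (T : measurableType d) (R : realType).
Variables (mu : {measure set T -> \bar R}) (D : set T).
Hypotheses (mD : measurable D) (fD : (mu D < +oo)%E).
Implicit Types f g : T -> R.

Definition L1_dist f g : \bar R := (\int[mu]_(x in D) `|f x - g x|%:E)%E.
Definition L2_dist f g : \bar R := (\int[mu]_(x in D) ((f x - g x) ^+ 2)%:E)%E.

Let le_int f g : measurable_fun D f -> measurable_fun D g ->
  (forall x, D x -> 0 <= f x <= g x) ->
  (\int[mu]_(x in D) (f x)%:E <= \int[mu]_(x in D) (g x)%:E)%E.
Proof.
move=> mf mg fg; apply: ge0_le_integral => //.
- by move=> x /fg/andP[? _]; rewrite lee_fin.
- exact/measurable_EFinP.
- exact/measurable_EFinP.
- by move=> x /fg/andP[_ ?]; rewrite lee_fin.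
Qed.

Let intD f g : measurable_fun D f -> measurable_fun D g ->
  (forall x, D x -> 0 <= f x) -> (forall x, D x -> 0 <= g x) ->
  (\int[mu]_(x in D) (f x + g x)%:E =
   \int[mu]_(x in D) (f x)%:E + \int[mu]_(x in D) (g x)%:E)%E.
Proof.
move=> mf mg f0 g0; rewrite -ge0_integralD//.
- exact/measurable_EFinP.
- exact/measurable_EFinP.
Qed.

Let intZ (k : R) f : 0 <= k -> measurable_fun D f ->
  (forall x, D x -> 0 <= f x) ->
  (\int[mu]_(x in D) (k * f x)%:E = k%:E * \int[mu]_(x in D) (f x)%:E)%E.
Proof.
move=> k0 mf f0; rewrite -ge0_integralZl//.
exact/measurable_EFinP.
Qed.

Let msub f g : measurable_fun D f -> measurable_fun D g ->
  measurable_fun D (fun x => `|f x - g x|).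
Proof.
by move=> mf mg; apply: measurableT_comp => //; exact: measurable_funB.
Qed.

Lemma L1_triangle f g h : measurable_fun D f -> measurable_fun D g ->
  measurable_fun D h -> (L1_dist f h <= L1_dist f g + L1_dist g h)%E.
Proof.
move=> mf mg mh; rewrite /L1_dist -intD//; [|exact: msub|exact: msub].
apply: le_int => [||x Dx].
- exact: msub.
- by apply: measurable_funD; exact: msub.
- by rewrite normr_ge0 ler_distD.
Qed.

(** Pointwise t <= t^2/r + r, with r small compared with the inverse of the
    total measure. *)
Lemma L1_of_L2 (f : nat -> T -> R) g : (forall m, measurable_fun D (f m)) ->
  measurable_fun D g -> vanishes (fun m => L2_dist (f m) g) ->
  vanishes (fun m => L1_dist (f m) g).
Proof.
move=> mf mg fg; apply: vanishes_approx => e e0.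
pose M := fine (mu D); have M0 : 0 <= M by exact: fine_ge0.
have ME : mu D = M%:E by rewrite fineK// ge0_fin_numE.
have M1 : 0 < M + 1 by rewrite ltr_wpDl.
pose r := e / (M + 1); have r0 : 0 < r by rewrite divr_gt0.
exists (fun m => (r^-1)%:E * L2_dist (f m) g)%E.
  by apply: vanishesZ => //; rewrite invr_ge0 ltW.
near=> m.
have m2 : measurable_fun D (fun x => (f m x - g x) ^+ 2).
  by apply: measurable_funX; exact: measurable_funB.
apply: (@le_trans _ _ (\int[mu]_(x in D) (r^-1 * (f m x - g x) ^+ 2 + r)%:E)%E).
  apply: le_int; first exact: msub.
    by apply: measurable_funD => //; exact: measurable_funM.
  move=> x _; rewrite normr_ge0 /= -(real_normK (num_real (f m x - g x))).
  set t := `|_|; have t0 : 0 <= t by rewrite /t.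
  have [tr|rt] := leP t r.
    by rewrite ler_wpDl// mulr_ge0// ?invr_ge0 ?sqr_ge0// ltW.
  rewrite ler_wpDr ?(ltW r0)// mulrC ler_pdivlMr// expr2.
  by rewrite ler_wpM2l// ltW.
rewrite intD//; last 3 first.
- by apply: measurable_funM.
- by move=> x _; rewrite mulr_ge0 ?invr_ge0 ?sqr_ge0 ?ltW.
- by move=> x _; exact: ltW.
rewrite intZ//; [|by rewrite invr_ge0 ltW|by move=> x _; exact: sqr_ge0].
rewrite leeD2l// integral_cst// ME -EFinM lee_fin /r.
by rewrite -mulrA ler_piMr ?(ltW e0)// mulrC ler_pdivrMr// mul1r lerDl.
Unshelve. all: end_near. Qed.

(** The increment of a product is ab + aH + Fb; Young's inequality with a small
    parameter r bounds it by squares of increments, plus r (F^2 + H^2). *)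
Lemma L1_product (f h : nat -> T -> R) (F H : T -> R) : (forall m, measurable_fun D (f m)) ->
  (forall m, measurable_fun D (h m)) -> measurable_fun D F -> measurable_fun D H ->
  mu.-integrable D (EFin \o (fun x => F x ^+ 2)) ->
  mu.-integrable D (EFin \o (fun x => H x ^+ 2)) ->
  vanishes (fun m => L2_dist (f m) F) -> vanishes (fun m => L2_dist (h m) H) ->
  vanishes (fun m =>
    L1_dist (fun x => (f m x * h m x)%R) (fun x => (F x * H x)%R)).
Proof.
move=> mf mh mF mH F2 H2 fF hH; apply: vanishes_approx => e e0.
have mF2 : measurable_fun D (fun x => F x ^+ 2) by exact: measurable_funX.
have mH2 : measurable_fun D (fun x => H x ^+ 2) by exact: measurable_funX.
pose S := fine (\int[mu]_(x in D) (F x ^+ 2 + H x ^+ 2)%:E)%E.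
have iS : mu.-integrable D (EFin \o (fun x => F x ^+ 2 + H x ^+ 2)).
  by move: (integrableD mD F2 H2); apply: eq_integrable.
have SE : (\int[mu]_(x in D) (F x ^+ 2 + H x ^+ 2)%:E = S%:E)%E.
  by rewrite fineK//; exact: integrable_fin_num.
have S0 : 0 <= S.
  by apply: fine_ge0; apply: integral_ge0 => x _; rewrite lee_fin addr_ge0 ?sqr_ge0.
have S1 : 0 < S + 1 by rewrite ltr_wpDl.
pose r := e / (S + 1); have r0 : 0 < r by rewrite divr_gt0.
pose k := 1 + r^-1; have k0 : 0 <= k by rewrite addr_ge0// invr_ge0 ltW.
exists (fun m => k%:E * (L2_dist (f m) F + L2_dist (h m) H))%E.
  by apply: vanishesZ => //; exact: vanishesD.
near=> m.
have m1 : measurable_fun D (fun x => (f m x - F x) ^+ 2).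
  by apply: measurable_funX; exact: measurable_funB.
have m2 : measurable_fun D (fun x => (h m x - H x) ^+ 2).
  by apply: measurable_funX; exact: measurable_funB.
have m12 : measurable_fun D (fun x => (f m x - F x) ^+ 2 + (h m x - H x) ^+ 2).
  exact: measurable_funD.
have mS : measurable_fun D (fun x => F x ^+ 2 + H x ^+ 2) by exact: measurable_funD.
apply: (@le_trans _ _ (\int[mu]_(x in D)
   (k * ((f m x - F x) ^+ 2 + (h m x - H x) ^+ 2) + r * (F x ^+ 2 + H x ^+ 2))%:E)%E).
  apply: le_int.
  - by apply: msub; exact: measurable_funM.
  - by apply: measurable_funD; apply: measurable_funM.
  move=> x _; rewrite normr_ge0 /=.
  have -> : f m x * h m x - F x * H x =
    (f m x - F x) * (h m x - H x) + (f m x - F x) * H x + F x * (h m x - H x) by ring.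
  set a := f m x - F x; set b := h m x - H x.
  have young (y z : R) : `|y * z| <= r^-1 * y ^+ 2 + r * z ^+ 2.
    rewrite normrM -(real_normK (num_real y)) -(real_normK (num_real z)).
    set u := `|y|; set v := `|z|.
    have rn0 : r != 0 by rewrite gt_eqF.
    have E : r^-1 * (u - r * v) ^+ 2 = r^-1 * u ^+ 2 - 2 * (u * v) + r * v ^+ 2.
      by field.
    have h1 : 0 <= r^-1 * (u - r * v) ^+ 2.
      by rewrite mulr_ge0 ?sqr_ge0// invr_ge0 ltW.
    have h2 : 0 <= u * v by apply: mulr_ge0; exact: normr_ge0.
    by move: E h1 h2; set X := r^-1 * (u - _) ^+ 2; set Y := r^-1 * u ^+ 2; lra.
  have h1 : `|a * b| <= a ^+ 2 + b ^+ 2.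
    by rewrite ler_norml; have := sqr_ge0 (a - b); have := sqr_ge0 (a + b); nra.
  have h2 := young a (H x).
  have h3 : `|F x * b| <= r^-1 * b ^+ 2 + r * F x ^+ 2 by rewrite mulrC; exact: young.
  rewrite (le_trans (ler_normD _ _))//.
  apply: (@le_trans _ _ (`|a * b| + `|a * H x| + `|F x * b|)).
    by rewrite lerD2r; exact: ler_normD.
  rewrite /k; move: h1 h2 h3.
  set A := `|a * b|; set B := `|a * H x|; set C := `|F x * b|.
  move: (r^-1) => ri; nra.
rewrite intD//; last 4 first.
- exact: measurable_funM.
- exact: measurable_funM.
- by move=> x _; rewrite mulr_ge0// addr_ge0 ?sqr_ge0.
- by move=> x _; rewrite mulr_ge0 ?addr_ge0 ?sqr_ge0 ?ltW.
rewrite intZ//; last by move=> x _; rewrite addr_ge0 ?sqr_ge0.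
rewrite intD//; [|by move=> x _; exact: sqr_ge0..].
rewrite leeD2l// intZ ?(ltW r0)//; last by move=> x _; rewrite addr_ge0 ?sqr_ge0.
rewrite SE -EFinM lee_fin /r -mulrA ler_piMr ?(ltW e0)// mulrC ler_pdivrMr//.
by rewrite mul1r lerDl.
Unshelve. all: end_near. Qed.

Lemma Rintegral_cvg_L1 (f : nat -> T -> R) g :
  (forall m, mu.-integrable D (EFin \o f m)) -> mu.-integrable D (EFin \o g) ->
  vanishes (fun m => L1_dist (f m) g) ->
  \int[mu]_(x in D) f m x @[m --> \oo] --> \int[mu]_(x in D) g x.
Proof.
move=> intf intg fg; apply/cvgrPdist_le => e e0.
apply: filterS (fg e e0) => m fgm.
have ifg : mu.-integrable D (EFin \o (fun x => f m x - g x)).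
  by move: (integrableB mD (intf m) intg); apply: eq_integrable.
rewrite distrC -RintegralB// (le_trans (le_normr_Rintegral mD ifg))//.
by rewrite -lee_fin EFin_Rintegral//; exact: (integrable_norm ifg).
Qed.

Lemma L1_refl f : vanishes (fun _ : nat => L1_dist f f).
Proof.
apply: vanishes_le (@vanishes0 R); near=> m.
by rewrite /L1_dist integral0_eq// => x _; rewrite subrr normr0.
Unshelve. all: end_near. Qed.

Lemma L1_mulr_bounded (f : nat -> T -> R) g (c : T -> R) (C : R) :
  (forall m, measurable_fun D (f m)) -> measurable_fun D g -> measurable_fun D c ->
  (forall x, D x -> `|c x| <= C) -> vanishes (fun m => L1_dist (f m) g) ->
  vanishes (fun m => L1_dist (fun x => (f m x * c x)%R) (fun x => (g x * c x)%R)).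
Proof.
move=> mf mg mc cC fg.
have C0 : 0 <= `|C| by [].
apply: vanishes_le (vanishesZ C0 fg); near=> m.
rewrite -intZ//; last exact: msub.
apply: le_int.
- by apply: msub; exact: measurable_funM.
- by apply: measurable_funM => //; exact: msub.
move=> x Dx; rewrite normr_ge0/= -mulrBl normrM mulrC ler_wpM2r//.
by rewrite (le_trans (cC _ Dx))// ler_norm.
Unshelve. all: end_near. Qed.

Lemma L1_sum (I : Type) (s : seq I) (f : I -> nat -> T -> R) (g : I -> T -> R) :
  (forall i m, measurable_fun D (f i m)) -> (forall i, measurable_fun D (g i)) ->
  (forall i, vanishes (fun m => L1_dist (f i m) (g i))) ->
  vanishes (fun m => L1_dist (fun x => (\sum_(i <- s) f i m x)%R)
    (fun x => (\sum_(i <- s) g i x)%R)).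
Proof.
move=> mf mg fg; elim: s => [|i s IH].
  apply: vanishes_le (@vanishes0 R); near=> m.
  by rewrite /L1_dist integral0_eq// => x _; rewrite !big_nil subrr normr0.
apply: vanishes_le (vanishesD (fg i) IH); near=> m.
have mS m' : measurable_fun D (fun x => \sum_(i <- s) f i m' x).
  exact: measurable_sum.
have mS' : measurable_fun D (fun x => \sum_(i <- s) g i x) by exact: measurable_sum.
rewrite -intD//; [|exact: msub..].
apply: le_int.
- by apply: msub; exact: measurable_sum.
- by apply: measurable_funD; exact: msub.
move=> x Dx; rewrite normr_ge0/= !big_cons opprD addrACA; exact: ler_normD.
Unshelve. all: end_near. Qed.

Lemma integrable_mulr_bounded f (c : T -> R) (C : R) : mu.-integrable D (EFin \o f) ->
  measurable_fun D c -> (forall x, D x -> `|c x| <= C) ->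
  mu.-integrable D (EFin \o (fun x => f x * c x)).
Proof.
move=> intf mc cC.
have mf : measurable_fun D f by have /integrableP[/measurable_EFinP] := intf.
apply: (le_integrable mD _ _ (integrableZr mD C intf)).
  by apply/measurable_EFinP/measurable_funM.
move=> x Dx; rewrite lee_fin /= !normrM ler_wpM2l//.
by rewrite (le_trans (cC _ Dx))// ler_norm.
Qed.

Section Composition.
Variables (b : R -> R) (p q : R).
Hypotheses (pq : p <= q) (cb : {within `[p, q], continuous b}).

Lemma measurable_composition f : measurable_fun D f ->
  (forall x, D x -> p <= f x <= q) -> measurable_fun D (fun x => b (f x)).
Proof.
move=> mf fpq; apply: (eq_measurable_fun (fun x => (b \o clamp p q) (f x))).
  by move=> x /set_mem Dx; rewrite /= clamp_id// fpq.
apply: (measurableT_comp _ mf).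
exact: (continuous_measurable_fun (continuous_clamp pq cb)).
Qed.

Lemma bounded_on_interval : exists2 C : R, 0 <= C &
  forall x, p <= x <= q -> `|b x| <= C.
Proof.
have [C C0 hC] := continuity_modulus pq cb ltr01.
exists (`|b p| + 1 + C * (q - p)); first by rewrite !addr_ge0// mulr_ge0// subr_ge0.
move=> x xpq; have h := hC x p xpq; rewrite lexx pq in h.
rewrite -(subrK (b p) (b x)) (le_trans (ler_normD _ _))//.
rewrite addrC -addrA lerD2l (le_trans (h isT))// lerD2l ler_wpM2l//.
by case/andP: xpq => ? ?; rewrite ger0_norm; lra.
Qed.

Lemma integrable_composition f (H : T -> R) : measurable_fun D f ->
  (forall x, D x -> p <= f x <= q) -> mu.-integrable D (EFin \o H) ->
  mu.-integrable D (EFin \o (fun x => b (f x) * H x)).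
Proof.
move=> mf fpq iH; have [C C0 hC] := bounded_on_interval.
have mH : measurable_fun D H by have /integrableP[/measurable_EFinP] := iH.
apply: (le_integrable mD _ _ (integrableZl mD C iH)).
  by apply/measurable_EFinP/measurable_funM => //; exact: measurable_composition.
move=> x Dx; rewrite lee_fin /= !normrM ler_wpM2r// (ger0_norm C0).
exact/hC/fpq.
Qed.

Let vanishes_tail (H : T -> R) : mu.-integrable D (EFin \o H) ->
  vanishes (fun n => \int[mu]_(x in D) (`|H x| - Num.min `|H x| n%:R)%:E)%E.
Proof.
move=> iH; apply: cvg_vanishes.
have mH : measurable_fun D H by have /integrableP[/measurable_EFinP] := iH.
have mnH : measurable_fun D (fun x => `|H x|) by exact: measurableT_comp.
have [] := @dominated_convergence _ _ _ mu D mD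
  (fun n x => (`|H x| - Num.min `|H x| n%:R)%:E) (cst 0%E) _ _ _ _
  (integrable_norm iH) _.
- move=> n; apply/measurable_EFinP/measurable_funB => //.
  by apply: measurable_minr.
- exact: measurable_cst.
- apply: aeW => x _; apply: cvg_near_cst; near=> n.
  rewrite min_l ?subrr//.
  by near: n; exact: nbhs_infty_ger.
- apply: aeW => x n _; rewrite /= lee_fin ger0_norm; last first.
    by rewrite subr_ge0 ge_min lexx.
  by rewrite gerBl le_min normr_ge0 ler0n.
by move=> _ _; rewrite integral0.
Unshelve. all: end_near. Qed.

(** Convergence in L1 of the argument of a continuous function, and in L1 of a
    factor which need not be bounded: the factor is cut off at a high level,
    and the continuous function replaced by its modulus of continuity. *)
Lemma nonlinear_limit (u h : nat -> T -> R) (w H : T -> R) :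
  (forall m, measurable_fun D (u m)) -> measurable_fun D w ->
  (forall m x, D x -> p <= u m x <= q) -> (forall x, D x -> p <= w x <= q) ->
  (forall m, measurable_fun D (h m)) -> mu.-integrable D (EFin \o H) ->
  vanishes (fun m => L1_dist (u m) w) -> vanishes (fun m => L1_dist (h m) H) ->
  vanishes (fun m =>
    L1_dist (fun x => (b (u m x) * h m x)%R) (fun x => (b (w x) * H x)%R)).
Proof.
move=> mum mw upq wpq mh iH uw hH; apply: vanishes_approx => e e0.
have mH : measurable_fun D H by have /integrableP[/measurable_EFinP] := iH.
have [B B0 hB] := bounded_on_interval.
pose S := \int[mu]_(x in D) `|H x|.
have S0 : 0 <= S by apply: Rintegral_ge0.
have SE : (\int[mu]_(x in D) `|H x|%:E = S%:E)%E.
  by rewrite EFin_Rintegral//; exact: (integrable_norm iH).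
have S1 : 0 < S + 1 by rewrite ltr_wpDl.
pose r := e / 2 / (S + 1); have r0 : 0 < r by rewrite !divr_gt0.
have [C C0 hC] := continuity_modulus pq cb r0.
pose k := C * (q - p); have k0 : 0 <= k by rewrite mulr_ge0// subr_ge0.
have k1 : 0 < k + 1 by rewrite ltr_wpDl.
have /(_ (e / 2 / (k + 1))) := vanishes_tail iH.
rewrite !divr_gt0// => /(_ isT)[n _ /(_ n (leqnn _)) hn].
exists (fun m => B%:E * L1_dist (h m) H + (C * n%:R)%:E * L1_dist (u m) w)%E.
  by apply: vanishesD; apply: vanishesZ => //; rewrite mulr_ge0.
near=> m; pose t x := `|H x| - Num.min `|H x| n%:R.
have t0 x : 0 <= t x by rewrite /t subr_ge0 ge_min lexx.
have mnH : measurable_fun D (fun x => `|H x|) by exact: measurableT_comp.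
have mt : measurable_fun D t.
  by apply: measurable_funB => //; exact: measurable_minr.
have mbu : measurable_fun D (fun x => b (u m x)).
  by apply: measurable_composition => // x; exact: upq.
have mbw : measurable_fun D (fun x => b (w x)) by exact: measurable_composition.
have mhH : measurable_fun D (fun x => `|h m x - H x|) by exact: msub.
have muw : measurable_fun D (fun x => `|u m x - w x|) by exact: msub.
have m1 : measurable_fun D (fun x => B * `|h m x - H x|) by exact: measurable_funM.
have m2 : measurable_fun D (fun x => C * n%:R * `|u m x - w x|).
  exact: measurable_funM.
have m3 : measurable_fun D (fun x => r * `|H x|) by exact: measurable_funM.
have m4 : measurable_fun D (fun x => k * t x) by exact: measurable_funM.
have p1 x : D x -> 0 <= B * `|h m x - H x| by rewrite mulr_ge0.
have p2 x : D x -> 0 <= C * n%:R * `|u m x - w x| by rewrite !mulr_ge0.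
have p3 x : D x -> 0 <= r * `|H x| by rewrite mulr_ge0// ltW.
have p4 x : D x -> 0 <= k * t x by rewrite mulr_ge0.
apply: (@le_trans _ _ (\int[mu]_(x in D) (B * `|h m x - H x| +
   C * n%:R * `|u m x - w x| + (r * `|H x| + k * t x))%:E)%E).
  apply: le_int.
  - by apply: msub; apply: measurable_funM => //; have /integrableP[/measurable_EFinP] := iH.
  - by apply: measurable_funD; exact: measurable_funD.
  move=> x Dx; rewrite normr_ge0 /=.
  have -> : b (u m x) * h m x - b (w x) * H x =
    b (u m x) * (h m x - H x) + (b (u m x) - b (w x)) * H x by ring.
  rewrite (le_trans (ler_normD _ _))// -addrA lerD//.
    by rewrite normrM ler_wpM2r// hB// upq.
  rewrite normrM.
  apply: (@le_trans _ _ ((r + C * `|u m x - w x|) * `|H x|)).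
    by rewrite ler_wpM2r// hC ?upq ?wpq.
  have uwq : `|u m x - w x| <= q - p.
    have /andP[? ?] := upq m x Dx; have /andP[? ?] := wpq x Dx.
    by rewrite ler_norml; apply/andP; split; lra.
  have Hn : `|H x| <= n%:R + t x.
    by rewrite /t addrC -addrA lerDl addrC subr_ge0 ge_min lexx orbT.
  have h1 : `|u m x - w x| * `|H x| <= n%:R * `|u m x - w x| + (q - p) * t x.
    apply: (@le_trans _ _ (`|u m x - w x| * (n%:R + t x))).
      by rewrite ler_wpM2l.
    by rewrite mulrDr mulrC lerD2l ler_wpM2r.
  rewrite mulrDl -mulrA addrCA lerD2l /k -!mulrA -mulrDr.
  by rewrite ler_wpM2l.
rewrite intD//; last 4 first.
- exact: measurable_funD.
- exact: measurable_funD.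
- by move=> x Dx; rewrite addr_ge0 ?p1 ?p2.
- by move=> x Dx; rewrite addr_ge0 ?p3 ?p4.
rewrite intD// intD// leeD//.
  by rewrite leeD// intZ// mulr_ge0.
rewrite [e]splitr EFinD leeD//.
  rewrite intZ ?(ltW r0)// SE -EFinM lee_fin /r.
  by rewrite mulrAC ler_pdivrMr// ler_wpM2l ?lerDl// divr_ge0// ltW.
rewrite intZ//; apply: (@le_trans _ _ (k%:E * (e / 2 / (k + 1))%:E)%E).
  exact: lee_wpmul2l.
rewrite -EFinM lee_fin mulrCA mulrC mulrAC ler_pdivrMr// mulrC.
by rewrite ler_wpM2l ?lerDl// divr_ge0// ltW.
Unshelve. all: end_near. Qed.

End Composition.

End NonlinearLimits.

(** * Mollified equations *)
Section TestFunctions.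
Variable R : realType.
Notation line := (measurableTypeR R).
Notation ST := (line * line * line * line)%type.
Implicit Types (f phi : spacetime R -> R) (w : spacetime R) (o : option 'I_3).

Lemma test_function_vanishes (I : set R) phi : `]0, +oo[ `<=` I -> test_function I phi ->
  exists2 T : R, 0 < T & forall x t, T <= t -> phi (x, t) = 0.
Proof.
move=> Ipos [_ _ [K [cK _ phi0]]].
have [B [_ hB]] := compact_bounded cK.
exists (`|B| + 2); first by rewrite ltr_wpDl.
move=> x t Tt; have B0 := normr_ge0 B; apply: phi0 => [|Kt].
  by apply: Ipos; rewrite /= in_itv/= andbT; lra.
have := hB (`|B| + 1); rewrite (le_lt_trans (ler_norm B)) ?ltrDl// => /(_ isT t Kt) /=.
by have := ler_norm t; lra.
Qed.

Lemma is_derive_eq0 f (z v : spacetime R) : (\forall t \near (0 : R), f (z + t *: v) = 0) ->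
  is_derive z v f 0.
Proof.
move=> f0; apply/is_derive_line0.
apply: (near_eq_is_derive (f := (cst 0 : R -> R))).
by apply: filterS f0 => t ->.
Qed.

Lemma partial_eq0_late phi (T : R) : (forall x t, T <= t -> phi (x, t) = 0) ->
  forall o x t, T < t -> partial o phi (x, t) = 0.
Proof.
move=> phi0 o x t Tt; apply: derive_val.
apply: is_derive_eq0; case: o => [k|] /=; near=> s.
  by apply: phi0; rewrite /= scaler0 addr0 ltW.
have st : `|s| < t - T by near: s; apply: (@nbhs0_lt R R); rewrite subr_gt0.
apply: phi0; rewrite /= [_ *: _]mulr1.
by move: st; rewrite ltr_norml => /andP[h _]; lra.
Unshelve. all: end_near. Qed.

Lemma Rintegral_late (f : spacetime R -> R) (T : R) :
  (forall x t, T <= t -> f (x, t) = 0) ->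
  \int[leb4]_(z in cylinder `]0, +oo[) f z = \int[leb4]_(z in cylinder `]0, T[) f z.
Proof.
move=> f0; rewrite Rintegral_mkcond [RHS]Rintegral_mkcond.
apply: eq_Rintegral => -[x t] _; rewrite !patchE.
have [Tt|tT] := leP T t; first by rewrite f0//; do 2 case: ifP.
congr (if _ then _ else _); apply/idP/idP => /set_mem [cx] /=;
  rewrite in_itv/= => /andP[t0 _]; apply/mem_set; split => //=.
  by rewrite in_itv/= t0.
by rewrite in_itv/= t0.
Qed.

Variables (k th : nat -> R -> R).
Hypothesis kth : bumps k th.
Notation h := (kernel k th).

Let eps_gt0 m : 0 < (2 * m.+1%:R : R)^-1.
Proof. by rewrite invr_gt0 mulr_gt0. Qed.

Let eps_le1 m : m.+1%:R^-1 <= 1 :> R.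
Proof. by rewrite invf_le1// ler1n. Qed.

Lemma kernel_eq0 m w x t : t <= w.2 + (2 * m.+1%:R)^-1 \/ w.2 + m.+1%:R^-1 <= t ->
  h m ((x, t) - w) = 0.
Proof.
move=> tw; apply: contrapT => /eqP /(kernel_time kth) /= /andP[h1 h2].
case: tw => h3; first by move: h1; rewrite ltrBrDl ltNge h3.
by move: h2; rewrite ltrBlDl ltNge h3.
Qed.

(** The time bump vanishes up to a positive time, which keeps the support of
    the translated kernel inside the open half-line even when [w] sits at the
    initial time. *)
Lemma test_function_kernel m w (I : set R) : `]0, +oo[ `<=` I ->
  0 <= w.2 -> test_function I (fun z => h m (z - w)).
Proof.
move=> Ipos w0; split.
- exact/smooth_shift/(smooth_kernel kth).
- move=> t i x; rewrite -(kernel_periodic kth m ((x, t) - w).2 i (x - w.1)).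
  by congr (h m (_, _)); rewrite /= addrAC.
exists `[w.2 + (2 * m.+1%:R)^-1, w.2 + m.+1%:R^-1]%classic; split.
- exact: segment_compact.
- move=> t /=; rewrite in_itv/= => /andP[h1 _]; apply: Ipos; rewrite /= in_itv/= andbT.
  by apply: lt_le_trans h1; rewrite ltr_wpDl.
- move=> x t _ /=; rewrite in_itv/= => /negP; rewrite negb_and -!ltNge => tw.
  apply: kernel_eq0; case/orP: tw => ?; [left|right]; exact: ltW.
Qed.

(** This is why the initial data do not enter the mollified equation. *)
Lemma kernel_initial m w x : 0 <= w.2 -> h m ((x, 0) - w) = 0.
Proof. by move=> w0; apply: kernel_eq0; left; rewrite addr_ge0// ltW. Qed.

Lemma kernel_late m w (M : R) : w.2 + 1 <= M ->
  forall x t, M <= t -> h m ((x, t) - w) = 0.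
Proof.
move=> wM x t Mt; apply: kernel_eq0; right.
by rewrite (le_trans _ Mt)// (le_trans _ wM)// lerD2l.
Qed.

Lemma partial_kernel_late o m w (M : R) : w.2 + 1 < M ->
  forall x t, M <= t -> partial o (h m) ((x, t) - w) = 0.
Proof.
move=> wM x t Mt; have := partial_shift o (h m) w.
move=> /(congr1 (fun F => F (x, t))) /= <-.
apply: (partial_eq0_late (T := w.2 + 1)); last exact: lt_le_trans Mt.
exact: kernel_late.
Qed.

End TestFunctions.

Section Mollification.
Variable R : realType.
Notation line := (measurableTypeR R).
Notation ST := (line * line * line * line)%type.
Implicit Types (f phi : spacetime R -> R) (w z : spacetime R) (o : option 'I_3).

Definition locally_L2 f := forall T : R,
  measurable_fun (cylinder `]0, T[ : set ST) (f : ST -> R) /\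
  leb4.-integrable (cylinder `]0, T[) (EFin \o (fun z => f z ^+ 2)).

Definition has_gradient f (g : 'I_3 -> spacetime R -> R) :=
  forall phi, test_function `]0, +oo[ phi -> forall i : 'I_3,
    \int[leb4]_(z in cylinder `]0, +oo[) (f z * partial (Some i) phi z) =
    - \int[leb4]_(z in cylinder `]0, +oo[) (g i z * phi z).

Lemma regular_bounded_on (F : spacetime R -> R) (T : R) : regular F ->
  exists C : R, forall w, cylinder `]0, T[ w -> `|F w| <= C.
Proof.
by move=> [_ /(_ (Num.max 1 T))[C hC]]; exists C => w /cylinder_norm; exact: hC.
Qed.

Lemma regular_integrable (F : spacetime R -> R) (T : R) : regular F ->
  leb4.-integrable (cylinder `]0, T[) (EFin \o F).
Proof.
move=> rF; have [C hC] := regular_bounded_on T rF.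
apply: (@bounded_integrable _ _ _ _ _ _ C).
- exact: measurable_cylinder.
- exact: leb4_cylinder_fin.
- by apply: measurable_funTS; exact: regular_measurable.
- exact: hC.
Qed.

Lemma regular_measurable_on (F : spacetime R -> R) (T : R) : regular F ->
  measurable_fun (cylinder `]0, T[ : set ST) (F : ST -> R).
Proof. by move=> rF; apply: measurable_funTS; exact: regular_measurable. Qed.

Variables (k th : nat -> R -> R) (M : R).
Hypotheses (kth : bumps k th) (M1 : 1 < M).
Notation h := (kernel k th).
Notation D := (cylinder `]0, M[ : set (spacetime R)).
Notation Q := (cylinder `]0, M - 1[ : set (spacetime R)).

Let mD : measurable (D : set ST). Proof. exact: measurable_cylinder. Qed.
Let mQ : measurable (Q : set ST). Proof. exact: measurable_cylinder. Qed.
Let fD : (leb4 D < +oo)%E. Proof. exact: leb4_cylinder_fin. Qed.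
Let fQ : (leb4 Q < +oo)%E. Proof. exact: leb4_cylinder_fin. Qed.

Let QD : Q `<=` D. Proof. by apply: cylinder_le; rewrite gerBl. Qed.

(** Functions on (0, oo) are integrable up to finite times only; times before
    [M] are all that the mollification at times before M - 1 sees. *)
Definition cutoff f : spacetime R -> R := f \_ D.

Definition moll m f : spacetime R -> R := conv M (cutoff f) (h m).

Let cutoffE f z : D z -> cutoff f z = f z.
Proof. by move=> Dz; rewrite /cutoff patchE mem_set. Qed.

Section LocallyL2.
Variable f : spacetime R -> R.
Hypothesis f2 : locally_L2 f.

Let mf : measurable_fun setT (cutoff f : ST -> R).
Proof. by apply/(measurable_restrictT _ mD); have [] := f2 M. Qed.

Let i2 : leb4.-integrable D (EFin \o (fun z => cutoff f z ^+ 2)).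
Proof.
have [_ i2] := f2 M; apply: eq_integrable i2 => // z /set_mem Dz.
by rewrite /= cutoffE.
Qed.

Let i1 : leb4.-integrable D (EFin \o cutoff f).
Proof. exact: (sqr_integrable_integrable mD fD mf i2). Qed.

Lemma integrable_locally_L2 : leb4.-integrable D (EFin \o f).
Proof.
apply: eq_integrable i1 => // z /set_mem Dz.
by rewrite /= cutoffE.
Qed.

Lemma regular_conv_cutoff (g : spacetime R -> R) : smooth g ->
  regular (conv M (cutoff f) g).
Proof. exact: regular_conv. Qed.

Lemma regular_moll m : regular (moll m f).
Proof. exact/regular_conv_cutoff/(smooth_kernel kth). Qed.

Lemma is_derive_moll m o w :
  is_derive w (axis R o) (moll m f) (- conv M (cutoff f) (partial o (h m)) w).
Proof. by apply: is_derive_conv => //; exact: smooth_kernel. Qed.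

Lemma periodic_moll m : periodic_in_space (moll m f).
Proof. exact/periodic_conv/(kernel_periodic kth). Qed.

Lemma moll_cvg_L2 : vanishes (fun m => L2_dist leb4 Q (moll m f) f).
Proof.
have := conv_cvg_L2 kth M1 mf i2; apply: vanishes_le; near=> m.
rewrite le_eqVlt; apply/orP; left; apply/eqP; apply: eq_integral => w /set_mem Qw.
by rewrite cutoffE//; exact: QD.
Unshelve. all: end_near. Qed.

Lemma moll_cvg_L1 : vanishes (fun m => L1_dist leb4 Q (moll m f) f).
Proof.
apply: L1_of_L2 => //.
- by move=> m; apply: regular_measurable_on; exact: regular_moll.
- by have [] := f2 (M - 1).
- exact: moll_cvg_L2.
Qed.

Lemma moll_bounds m w : (forall z, D z -> 0 <= f z <= 1) -> 0 <= moll m f w <= 1.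
Proof.
move=> f01; apply/andP; split.
  apply: Rintegral_ge0 => z Dz; rewrite cutoffE// mulr_ge0 ?(kernel_ge0 kth)//.
  by have /andP[] := f01 z Dz.
have M0 : 0 < M by exact: lt_trans M1.
apply: le_trans (kernel_mass_le kth m w M0).
have sh := smooth_kernel kth m.
apply: le_Rintegral => //.
- exact: integrable_conv.
- have i0 : leb4.-integrable D (EFin \o cst (1 : R)).
    by apply: (bounded_integrable mD fD (C := 1)) => // z _; rewrite /= normr1.
  move: (integrable_conv w (measurable_cst (1 : R)) i0 sh).
  by apply: eq_integrable => // z _; rewrite /= mul1r.
move=> z Dz; rewrite cutoffE// ler_piMl ?(kernel_ge0 kth)//.
by have /andP[] := f01 z Dz.
Qed.

End LocallyL2.

Let conv_cutoff_late f o m w : Q w ->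
  \int[leb4]_(z in cylinder `]0, +oo[) (f z * partial o (fun z => h m (z - w)) z) =
  conv M (cutoff f) (partial o (h m)) w.
Proof.
move=> [_ /=]; rewrite in_itv/= => /andP[_ wM].
rewrite (Rintegral_late (T := M)).
  by apply: eq_Rintegral => z /set_mem Dz; rewrite cutoffE// partial_shift.
move=> x t Mt; rewrite partial_shift (@partial_kernel_late _ _ _ kth _ m w M) ?mulr0//.
by rewrite -ltrBrDr.
Qed.

Let moll_late f m w : Q w ->
  \int[leb4]_(z in cylinder `]0, +oo[) (f z * h m (z - w)) = moll m f w.
Proof.
move=> [_ /=]; rewrite in_itv/= => /andP[_ wM].
rewrite (Rintegral_late (T := M)).
  by apply: eq_Rintegral => z /set_mem Dz; rewrite cutoffE.
move=> x t Mt; rewrite (@kernel_late _ _ _ kth m w M) ?mulr0//.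
by rewrite -lerBrDr ltW.
Qed.

Let Qpos w : Q w -> 0 <= w.2.
Proof. by move=> [_ /=]; rewrite in_itv/= => /andP[/ltW]. Qed.

(** The weak gradient, tested with a translate of the kernel. *)
Lemma moll_gradient f (g : 'I_3 -> spacetime R -> R) m i w : has_gradient f g ->
  Q w -> - conv M (cutoff f) (partial (Some i) (h m)) w = moll m (g i) w.
Proof.
move=> fg Qw; rewrite -conv_cutoff_late// -moll_late//.
rewrite fg ?opprK//; apply: (test_function_kernel kth) => //.
exact: Qpos.
Qed.

(** The weak conservation law, tested with a translate of the kernel: the
    mollified density and flux satisfy the equation pointwise. *)
Lemma moll_divergence (c0 : position R -> R) c (J : 'I_3 -> spacetime R -> R) m w :
  (forall phi, test_function `[0, +oo[ phi ->
    \int[leb3]_(x in cell) (c0 x * phi (x, 0)) +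
    \int[leb4]_(z in cylinder `]0, +oo[) (c z * dt phi z) +
    \int[leb4]_(z in cylinder `]0, +oo[) (\sum_i J i z * partial (Some i) phi z) = 0) ->
  (forall i, locally_L2 (J i)) -> Q w ->
  - conv M (cutoff c) (partial None (h m)) w =
  \sum_i conv M (cutoff (J i)) (partial (Some i) (h m)) w.
Proof.
move=> weak J2 Qw.
have tw : test_function `[0, +oo[ (fun z => h m (z - w)).
  apply: (test_function_kernel kth); last exact: Qpos.
  by move=> t /=; rewrite !in_itv/= !andbT => /ltW.
have := weak _ tw.
have -> : \int[leb3]_(x in cell) (c0 x * h m ((x, 0) - w)) = 0.
  under eq_Rintegral do rewrite (kernel_initial kth m _ (Qpos Qw)) mulr0.
  by rewrite Rintegral_cst ?mul0r//; exact: measurable_cell.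
rewrite add0r conv_cutoff_late// => /eqP; rewrite addr_eq0 => /eqP ->.
rewrite opprK.
rewrite (Rintegral_late (T := M)); last first.
  move=> x t Mt; rewrite big1// => i _.
  rewrite partial_shift (@partial_kernel_late _ _ _ kth _ m w M) ?mulr0//.
  by rewrite -ltrBrDr; case: Qw => _ /=; rewrite in_itv/= => /andP[].
have ii (i : 'I_3) : leb4.-integrable D (EFin \o (fun z =>
    J i z * partial (Some i) (fun z => h m (z - w)) z)).
  have [mJ iJ] := J2 i M.
  have mcut : measurable_fun setT (cutoff (J i) : ST -> R).
    by apply/(measurable_restrictT _ mD).
  have icut : leb4.-integrable D (EFin \o cutoff (J i)).
    apply: eq_integrable (integrable_locally_L2 (J2 i)) => // z /set_mem Dz.
    by rewrite /= cutoffE.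
  move: (integrable_conv w mcut icut (smooth_partial (Some i) (smooth_kernel kth m))).
  by apply: eq_integrable => // z /set_mem Dz; rewrite /= cutoffE// partial_shift.
have [-> _] := Rintegral_sum (index_enum 'I_3) mD ii.
apply: eq_bigr => i _; apply: eq_Rintegral => z /set_mem Dz.
by rewrite cutoffE// partial_shift.
Qed.

End Mollification.

Section GradientOfSquare.
Variable R : realType.
Notation line := (measurableTypeR R).
Notation ST := (line * line * line * line)%type.
Variables (r : spacetime R -> R) (g : 'I_3 -> spacetime R -> R).
Hypotheses (r2 : locally_L2 r) (g2 : forall i, locally_L2 (g i)).
Hypothesis r01 : forall z, cylinder `]0, +oo[ z -> 0 <= r z <= 1.
Hypothesis rg : has_gradient r g.

(** The chain rule for the square holds for the mollified function, whose
    gradient is the mollified gradient, and passes to the limit.  It turns the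
    square integrable gradient of the root of the concentration into that of
    the concentration. *)
Lemma gradient_sqr : has_gradient (fun z => r z ^+ 2) (fun i z => 2 * r z * g i z).
Proof.
move=> phi tphi i.
have [sphi pphi _] := tphi.
have [T T0 phi0] := test_function_vanishes (@subset_refl _ _) tphi.
have dphi0 := partial_eq0_late phi0.
(* One unit of time for the window of the kernel, one to contain the support
   of the test function strictly. *)
pose M := T + 2.
have M1 : 1 < M by rewrite /M; lra.
have TM : T < M - 1 by rewrite /M; lra.
pose dphi := partial (Some i) phi; rewrite -/dphi.
have {}dphi0 x t : T < t -> dphi (x, t) = 0 by exact: dphi0.
pose Q : set (spacetime R) := cylinder `]0, M - 1[.
have mQ : measurable (Q : set ST) by exact: measurable_cylinder.
have fQ : (leb4 Q < +oo)%E.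
  exact: leb4_cylinder_fin.
rewrite (Rintegral_late (T := M - 1)); last first.
  by move=> x t Mt; rewrite dphi0 ?mulr0//; exact: lt_le_trans Mt.
rewrite (Rintegral_late (T := M - 1)); last first.
  by move=> x t Mt; rewrite phi0 ?mulr0//; apply: le_trans Mt; exact: ltW.
rewrite -/Q; have [k [th kth]] := bumps_exist R.
have rD z : cylinder `]0, M[ z -> 0 <= r z <= 1 by move=> /cylinder_unbounded; exact: r01.
have rQ z : Q z -> 0 <= r z <= 1 by move=> /cylinder_unbounded; exact: r01.
pose rm m := moll k th M m r; pose gm m := moll k th M m (g i).
have regr m : regular (rm m) by exact: regular_moll.
have regg m : regular (gm m) by exact: regular_moll.
have regp : regular phi by exact: smooth_regular.
have regdp : regular dphi by apply/smooth_regular/smooth_partial.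
have rm01 m w : Q w -> 0 <= rm m w <= 1 by move=> _; exact: moll_bounds.
have E m : \int[leb4]_(z in Q) (rm m z ^+ 2 * dphi z) =
    - \int[leb4]_(z in Q) (2 * rm m z * (gm m z * phi z)).
  pose dr w := - conv M (cutoff M r) (partial (Some i) (kernel k th m)) w.
  have regdr : regular dr.
    by apply/regularN/regular_conv_cutoff/smooth_partial/smooth_kernel.
  pose F w := rm m w * rm m w * phi w.
  pose F' w := rm m w * rm m w * dphi w + phi w * (2 * rm m w * dr w).
  have dF w : is_derive w (axis R (Some i)) F (F' w).
    have d1 := is_derive_moll M kth r2 m (Some i) w.
    have d2 := smooth_is_derive (Some i) w sphi.
    apply: is_derive_eq (is_deriveM (is_deriveM d1 d1) d2) _.
    rewrite /F' /dr /rm /dphi /GRing.scale /= mulrfctE; ring.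
  have regF' : regular F'.
    by apply: regularD; repeat apply: regularM => //; exact: regular_cst.
  have pF : periodic_in_space F.
    move=> t j x; rewrite /F (pphi t j x).
    by rewrite /rm (periodic_moll M kth r m t j x).
  have I0 := periodic_derivative_integral (M - 1) regF' dF pF.
  apply/eqP; rewrite -addr_eq0; apply/eqP; rewrite -RintegralD//.
  - rewrite -I0; apply: eq_Rintegral => z /set_mem Qz.
    by rewrite /F' /dr (moll_gradient kth m i rg Qz) /gm; ring.
  - have re : regular (fun z => rm m z ^+ 2 * dphi z).
      by repeat apply: regularM => //.
    exact: regular_integrable.
  - have re : regular (fun z => 2 * rm m z * (gm m z * phi z)).
      by repeat apply: regularM => //; exact: regular_cst.
    exact: regular_integrable.
have [mr ir] := r2 (M - 1); have [mg ig] := g2 i (M - 1).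
have mrm m : measurable_fun (Q : set ST) (rm m : ST -> R).
  exact: regular_measurable_on.
have mgm m : measurable_fun (Q : set ST) (gm m : ST -> R).
  exact: regular_measurable_on.
have mdp : measurable_fun (Q : set ST) (dphi : ST -> R).
  exact: regular_measurable_on.
have mp : measurable_fun (Q : set ST) (phi : ST -> R).
  exact: regular_measurable_on.
have [C hC] := regular_bounded_on (M - 1) regp.
have idp : leb4.-integrable Q (EFin \o dphi) by exact: regular_integrable.
have igp : leb4.-integrable Q (EFin \o (fun z => g i z * phi z)).
  exact: (integrable_mulr_bounded mQ (integrable_locally_L2 (M - 1) (g2 i)) mp hC).
pose b1 (s : R) := s ^+ 2; pose b2 (s : R) := 2 * s.
have cb1 : {within `[0, 1], continuous b1}.
  by apply: continuous_subspaceT => s; exact: exprn_continuous.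
have cb2 : {within `[0, 1], continuous b2}.
  by apply: continuous_subspaceT => s; apply: cvgM; [exact: cvg_cst|exact: cvg_id].
have rr := moll_cvg_L1 kth M1 r2.
have gg : vanishes (fun m => L1_dist leb4 Q (fun z => gm m z * phi z) (fun z => g i z * phi z)).
  exact: (L1_mulr_bounded mQ mgm mg mp hC (moll_cvg_L1 kth M1 (g2 i))).
have mgp m : measurable_fun (Q : set ST) (fun z : ST => gm m z * phi z).
  exact: measurable_funM.
have V1 := nonlinear_limit mQ ler01 cb1 mrm mr rm01 rQ (fun=> mdp) idp rr (L1_refl _ _ _).
have V2 := nonlinear_limit mQ ler01 cb2 mrm mr rm01 rQ mgp igp rr gg.
have J1 := integrable_composition mQ ler01 cb1 mr rQ idp.
have J2 := integrable_composition mQ ler01 cb2 mr rQ igp.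
have J1m m := integrable_composition mQ ler01 cb1 (mrm m) (rm01 m) idp.
have igmp m : leb4.-integrable Q (EFin \o (fun z => gm m z * phi z)).
  have re : regular (fun z => gm m z * phi z) by exact: regularM.
  exact: regular_integrable.
have J2m m := integrable_composition mQ ler01 cb2 (mrm m) (rm01 m) (igmp m).
have C1 := Rintegral_cvg_L1 mQ J1m J1 V1.
have C2 := Rintegral_cvg_L1 mQ J2m J2 V2.
have C2' := cvgN C2.
have -> : \int[leb4]_(z in Q) (2 * r z * g i z * phi z) =
    \int[leb4]_(z in Q) (b2 (r z) * (g i z * phi z)).
  by apply: eq_Rintegral => z _; rewrite mulrA.
apply: cvg_unique C1 _ => //.
rewrite (_ : (fun m => \int[leb4]_(z in Q) (b1 (rm m z) * dphi z)) =
  (fun m => - \int[leb4]_(z in Q) (b2 (rm m z) * (gm m z * phi z)))).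
  exact: C2'.
by apply/funext => m; exact: E.
Qed.

End GradientOfSquare.

(** * The initial trace of the mollified function *)
Section Trace.
Variable R : realType.
Notation line := (measurableTypeR R).
Notation SP := (line * line * line)%type.
Implicit Types F : spacetime R -> R.

Lemma cell_norm (y : position R) : cell y -> `|((y, 0) : spacetime R)| <= 1.
Proof.
move: y => [[p q] r] [[/=]]; rewrite !in_itv/= => /andP[p0 p1] /andP[q0 q1] /andP[r0 r1].
rewrite !prod_normE /= normr0 !ge_max !ger0_norm//.
by rewrite (ltW p1) (ltW q1) (ltW r1) ler01.
Qed.

Lemma trace_measurable F : regular F ->
  measurable_fun (cell : set SP) (fun y : SP => F (y, 0)).
Proof.
by move=> rF; apply: measurable_funTS; exact: measurable_fun_pair1 (regular_measurable rF).
Qed.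

Lemma trace_integrable F : regular F ->
  leb3.-integrable cell (EFin \o (fun y : position R => F (y, 0))).
Proof.
move=> rF; have [_ /(_ 1)[C hC]] := rF.
apply: (bounded_integrable (@measurable_cell R) (@leb3_cell_fin R) (C := C)).
  exact: trace_measurable.
by move=> y cy; apply: hC; exact: cell_norm.
Qed.

End Trace.

Section InitialTrace.
Variable R : realType.
Notation leb1 := (@lebesgue_measure R).
Notation line := (measurableTypeR R).
Notation SP := (line * line * line)%type.
Notation ST := (line * line * line * line)%type.
Variables (k th : nat -> R -> R) (M : R).
Hypotheses (kth : bumps k th) (M1 : 1 < M).
Notation h := (kernel k th).
Notation D := (cylinder `]0, M[ : set (spacetime R)).
Notation Q := (cylinder `]0, M - 1[ : set (spacetime R)).

Let mD : measurable (D : set ST). Proof. exact: measurable_cylinder. Qed.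
Let mC : measurable (cell : set SP). Proof. exact: measurable_cell. Qed.
Let fD : (leb4 D < +oo)%E. Proof. exact: leb4_cylinder_fin. Qed.
Let fC : (leb3 (@cell R) < +oo)%E. Proof. exact: leb3_cell_fin. Qed.
Let M0 : 0 < M. Proof. exact: lt_trans M1. Qed.
Let mI (T : R) : measurable (`]0, T[ : set line). Proof. by []. Qed.
Let fI := @leb1_itv R.

Let th_mass1 m (s : R) : 0 <= s -> s + 1 <= M ->
  \int[leb1]_(t in `]0, M[) th m (t - s) = 1.
Proof.
move=> s0 sM; have <- := kernel_mass kth m M ((0, 0, 0, s) : spacetime R).
exact: (kernel_mass_eq kth).
Qed.

(** A unit mass sits in the time variable of the kernel, so mollifying a
    function of the position only gives a function of the position only. *)
Section Stationary.
Variable e : position R -> R.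
Hypothesis me : measurable_fun (cell : set SP) (e : SP -> R).
Hypothesis e01 : forall x, cell x -> 0 <= e x <= 1.

Let ez (z : spacetime R) : R := (e \_ cell) z.1.

Let mez : measurable_fun setT (ez : ST -> R).
Proof.
have mec : measurable_fun setT (e \_ cell : SP -> R).
  by apply/(measurable_restrictT _ mC).
exact: (measurableT_comp mec measurable_fst).
Qed.

Let ez01 z : 0 <= ez z <= 1.
Proof.
rewrite /ez patchE; case: ifP => [/set_mem|_]; first exact: e01.
by rewrite lexx ler01.
Qed.

Lemma stationary_locally_L2 : locally_L2 ez.
Proof.
move=> T; split; first exact: measurable_funTS.
apply: (@bounded_integrable _ _ _ _ _ _ 1).
- exact: measurable_cylinder.
- exact: leb4_cylinder_fin.
- by apply: measurable_funTS; apply: (@measurable_funX _ _ _ _ (ez : ST -> R)).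
- move=> z _; have /andP[h0 h1] := ez01 z.
  by rewrite ger0_norm ?exprn_ge0// expr_le1.
Qed.

Lemma moll_stationary m y s : 0 <= s -> s + 1 <= M ->
  moll k th M m ez (y, s) = moll k th M m ez (y, 0).
Proof.
suff H r : 0 <= r -> r + 1 <= M -> moll k th M m ez (y, r) =
    \int[leb3]_(x in cell) (e x *
      (k m (x.1.1 - y.1.1) * k m (x.1.2 - y.1.2) * k m (x.2 - y.2))).
  by move=> s0 sM; rewrite !H// add0r ltW.
move=> r0 rM.
pose f (z : ST) : R := cutoff M ez z * h m ((z : spacetime R) - (y, r)).
have mcut : measurable_fun setT (cutoff M ez : ST -> R).
  by apply/(measurable_restrictT _ mD); apply: measurable_funTS.
have mf : measurable_fun setT f.
  apply: measurable_funM => //.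
  exact: (measurable_fun_pair1 ((y, r) : ST) (measurable_kernel_difference kth m)).
have [C hC] := smooth_bounded (Num.max 1 M + `|((y, r) : spacetime R)|) (smooth_kernel kth m).
have bf x t : cell x -> `]0, M[%classic t -> `|f (x, t)| <= C.
  move=> cx It; rewrite /f normrM -[leRHS]mul1r ler_pM//.
    rewrite /cutoff patchE; case: ifP => _; last by rewrite normr0.
    by have /andP[h0 h1] := ez01 (x, t); rewrite ger0_norm.
  apply: hC; apply: le_trans (ler_normB _ _) _; rewrite lerD2r.
  by apply: cylinder_norm; split.
have := bounded_Fubini1 (m1 := leb3) (m2 := leb1) mC (mI M) fC (fI M) mf bf.
rewrite /moll /conv => ->.
apply: eq_Rintegral => x /set_mem cx.
transitivity (\int[leb1]_(t in `]0, M[)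
   (e x * (k m (x.1.1 - y.1.1) * k m (x.1.2 - y.1.2) * k m (x.2 - y.2)) * th m (t - r))).
  apply: eq_Rintegral => t /set_mem It.
  rewrite /f /cutoff patchE mem_set; last by split.
  by rewrite /ez patchE mem_set// /kernel /tensor /= !mulrA.
rewrite RintegralZl ?th_mass1 ?mulr1//.
have cth := smooth1_continuous (th_smooth kth m).
have mth : measurable_fun setT (fun t : line => th m (t - r)).
  apply: (measurableT_comp (continuous_measurable_fun cth)).
  exact: (@measurable_funB _ _ _ _ (@id line) (cst r)).
have [C2 hC2] := continuous_bounded (M + `|r|) cth.
apply: (bounded_integrable (mI M) (fI M) _ (C := C2)); first exact: measurable_funTS.
move=> t /=; rewrite in_itv/= => /andP[t0 tM].
apply: hC2; rewrite (le_trans (ler_normB _ _))// lerD2r.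
by rewrite ger0_norm; exact: ltW.
Qed.

Let mE m : measurable_fun (cell : set SP) (fun y : SP => moll k th M m ez (y, 0)).
Proof.
apply: measurable_funTS.
have := regular_measurable (regular_moll M kth stationary_locally_L2 m).
exact: measurable_fun_pair1.
Qed.

Lemma moll_stationary_cvg :
  vanishes (fun m => L1_dist leb3 cell (fun y => moll k th M m ez (y, 0)) e).
Proof.
have c0 : (0 : R) <= (M - 1)^-1 by rewrite invr_ge0 subr_ge0 ltW.
apply: (vanishes_le _ (vanishesZ c0 (moll_cvg_L1 kth M1 stationary_locally_L2))).
near=> m; rewrite le_eqVlt; apply/orP; left; apply/eqP; rewrite /L1_dist.
have M10 : 0 < M - 1 by rewrite subr_gt0.
pose a y := moll k th M m ez (y, 0).
have a01 y : cell y -> `|a y - e y| <= 1.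
  move=> cy; have := e01 cy.
  have : 0 <= a y <= 1 by apply: (moll_bounds kth M1 stationary_locally_L2).
  by move=> /andP[h1 h2] /andP[h3 h4]; rewrite ler_norml; lra.
have ezE x t : cell x -> ez (x, t) = e x by move=> cx; rewrite /ez patchE mem_set.
pose F (z : ST) : R := `|moll k th M m ez z - ez z|.
have mF : measurable_fun setT F.
  apply: measurableT_comp => //.
  apply: measurable_funB => //.
  exact: regular_measurable (regular_moll M kth stationary_locally_L2 m).
have bF x t : cell x -> `]0, M - 1[%classic t -> `|F (x, t)| <= 1.
  move=> cx /=; rewrite in_itv/= => /andP[t0 tM].
  rewrite /F moll_stationary; [|exact: ltW|by rewrite -lerBrDr ltW].
  by rewrite normr_id ezE//; exact: a01.
have := bounded_Fubini1 (m1 := leb3) (m2 := leb1) mC (mI _) fC (fI _) mF bF.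
have iF : leb4.-integrable Q (EFin \o F).
  apply: (@bounded_integrable _ _ _ _ _ _ 1).
  - exact: measurable_cylinder.
  - exact: leb4_cylinder_fin.
  - exact: measurable_funTS.
  - by move=> [x t] [cx It]; exact: bF.
rewrite -(EFin_Rintegral _ iF); last exact: measurable_cylinder.
have ia : leb3.-integrable cell (EFin \o (fun y => `|a y - e y|)).
  apply: (bounded_integrable mC fC _ (C := 1)).
    apply: measurableT_comp => //.
    by apply: measurable_funB => //; exact: mE.
  by move=> y cy; rewrite normr_id a01.
rewrite -(EFin_Rintegral mC ia) /leb4 => ->; rewrite -EFinM; congr EFin.
transitivity ((M - 1)^-1 * \int[leb3]_(y in cell) ((M - 1) * `|a y - e y|)).
  rewrite RintegralZl// mulrA mulVf ?mul1r//; exact: lt0r_neq0.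
congr (_ * _); apply: eq_Rintegral => y /set_mem cy.
transitivity (\int[leb1]_(t in `]0, M - 1[) (cst `|a y - e y| t)).
  have L : leb1 `]0%R, (M - 1)%R[%classic = (M - 1)%:E.
    by rewrite lebesgue_measure_itv/= lte_fin M10 sube0.
  by rewrite (Rintegral_cst _ (mI (M - 1))) mulrC [X in fine X]L.
apply: eq_Rintegral => t /set_mem /=; rewrite in_itv/= => /andP[t0 tM].
rewrite /F moll_stationary; [|exact: ltW|by rewrite -lerBrDr ltW].
by rewrite ezE.
Unshelve. all: end_near. Qed.

End Stationary.

Variables (c : spacetime R -> R) (c0 : position R -> R).
Hypothesis c2 : locally_L2 c.
Hypothesis c01 : forall z, cylinder `]0, +oo[ z -> 0 <= c z <= 1.
Hypothesis mc0 : measurable_fun (cell : set SP) (c0 : SP -> R).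
Hypothesis c001 : forall x, cell x -> 0 <= c0 x <= 1.
Hypothesis c_c0 : forall e : R, 0 < e -> exists2 d : R, 0 < d &
  forall t, 0 < t < d -> \int[leb3]_(x in cell) `|c (x, t) - c0 x| <= e.

Let ez (z : spacetime R) : R := (c0 \_ cell) z.1.
Let ez2 : locally_L2 ez. Proof. exact: stationary_locally_L2. Qed.

(* The distance to the initial value, the latter being seen as a stationary
   function of space and time. *)
Let G (z : ST) : R := `|cutoff M c z - cutoff M ez z|.

Let mcut f : locally_L2 f -> measurable_fun setT (cutoff M f : ST -> R).
Proof. by move=> /(_ M)[mf _]; apply/(measurable_restrictT _ mD). Qed.

Let mG : measurable_fun setT G.
Proof.
apply: measurableT_comp => //.
by apply: measurable_funB => //; exact: mcut.
Qed.

Let GE x t : cell x -> 0 < t < M -> G (x, t) = `|c (x, t) - c0 x|.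
Proof.
move=> cx tM; rewrite /G /cutoff !patchE mem_set; last by split; rewrite //= in_itv.
by rewrite /ez patchE mem_set.
Qed.

Let bG z : D z -> `|G z| <= 1.
Proof.
move: z => [x t] Dz; have Dz' := Dz; case: Dz' => [cx] /=; rewrite in_itv/= => tM.
rewrite GE// normr_id; have /andP[h1 h2] := c01 (cylinder_unbounded Dz); have /andP[h3 h4] := c001 cx.
by rewrite ler_norml; apply/andP; split; lra.
Qed.

Let mh m : measurable_fun setT (fun p : ST * ST => h m ((p.1 : spacetime R) - p.2)).
Proof. exact: (measurable_kernel_difference kth). Qed.

Let moll_difference m y : `|moll k th M m c (y, 0) - moll k th M m ez (y, 0)| <=
  \int[leb4]_(z in D) (G z * h m (z - (y, 0))).
Proof.
have ic f : locally_L2 f -> leb4.-integrable D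
    (EFin \o (fun z => cutoff M f z * h m (z - (y, 0)))).
  move=> f2; apply: integrable_conv; first exact: mcut.
    have := integrable_locally_L2 M f2; apply: eq_integrable => // z /set_mem Dz.
    by rewrite /= /cutoff patchE mem_set.
  exact: smooth_kernel.
rewrite /moll /conv -RintegralB//; [|exact: ic|exact: ic].
apply: le_trans (le_normr_Rintegral mD _) _.
  have := integrableB mD (ic _ c2) (ic _ ez2).
  by apply: eq_integrable.
rewrite le_eqVlt; apply/orP; left; apply/eqP; apply: eq_Rintegral => z _.
by rewrite -mulrBl normrM (ger0_norm (kernel_ge0 kth _ _)).
Qed.

Let P m (p : SP * ST) : R := G p.2 * h m ((p.2 : spacetime R) - (p.1, 0)).

Let mP m : measurable_fun setT (P m).
Proof.
apply: measurable_funM; first exact: (measurableT_comp mG measurable_snd).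
have mp : measurable_fun setT (fun p : SP * ST => (p.2, ((p.1, 0) : ST))).
  by apply: measurable_fun_pair => //; apply: measurable_fun_pair.
exact: (measurableT_comp (mh m) mp).
Qed.

Let bP m : exists C, forall y z, cell y -> D z -> `|P m (y, z)| <= C.
Proof.
have [C hC] := smooth_bounded (Num.max 1 M + Num.max 1 M) (smooth_kernel kth m).
exists C => y z cy Dz; rewrite /P /= normrM -[leRHS]mul1r ler_pM//; first exact: bG.
apply: hC; apply: le_trans (ler_normB _ _) _; apply: lerD; first exact: cylinder_norm.
by rewrite (le_trans (cell_norm cy))// le_max lexx.
Qed.
Let iG : leb4.-integrable D (EFin \o G).
Proof. by apply: (bounded_integrable mD fD _ bG); exact: measurable_funTS. Qed.

(** Integrating the kernel over the space variable of its second point leaves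
    the time bump alone. *)
Let swap m : \int[leb3]_(y in cell) conv M G (h m) (y, 0) =
  \int[leb4]_(z in D) (G z * th m z.2).
Proof.
have [C hC] := bP m.
have F1 := bounded_Fubini1 (m1 := leb3) (m2 := leb4) mC mD fC fD (mP m) hC.
have F2 := bounded_Fubini2 (m1 := leb3) (m2 := leb4) mC mD fC fD (mP m) hC.
transitivity (\int[leb3]_(y in cell) \int[leb4]_(z in D) P m (y, z)).
  exact: eq_Rintegral.
rewrite -F1 F2; apply: eq_Rintegral => z /set_mem Dz; rewrite /P /=.
rewrite RintegralZl//; first by rewrite (kernel_trace kth) subr0.
have [C' hC'] := smooth_bounded (`|z| + Num.max 1 M) (smooth_kernel kth m).
apply: (bounded_integrable mC fC (C := C')).
  apply: measurable_funTS.
  have mp : measurable_fun setT (fun y : SP => (z : ST, ((y, 0) : ST))).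
    by apply: measurable_fun_pair => //; apply: measurable_fun_pair.
  exact: (measurableT_comp (mh m) mp).
move=> y cy; apply: hC'; apply: le_trans (ler_normB _ _) _; rewrite lerD2l.
by rewrite (le_trans (cell_norm cy))// le_max lexx.
Qed.

Let cth m : continuous (th m). Proof. exact: (smooth1_continuous (th_smooth kth m)). Qed.

Let mth m : measurable_fun setT (fun z : ST => th m z.2).
Proof.
exact: (measurableT_comp (continuous_measurable_fun (@cth m)) measurable_snd).
Qed.

Let bth m : exists C : R, forall z, D z -> `|th m z.2| <= C.
Proof.
have [C hC] := continuous_bounded M (@cth m); exists C => z [_] /=.
by rewrite in_itv/= => /andP[t0 tM]; apply: hC; rewrite ger0_norm; exact: ltW.
Qed.

Let ith m : leb4.-integrable D (EFin \o (fun z : ST => th m z.2)).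
Proof.
have [C hC] := bth m.
by apply: (bounded_integrable mD fD _ hC); exact: measurable_funTS.
Qed.

Let iGth m : leb4.-integrable D (EFin \o (fun z : ST => G z * th m z.2)).
Proof.
have [C hC] := bth m; apply: (bounded_integrable mD fD (C := C)).
  by apply: measurable_funTS; exact: measurable_funM.
by move=> z Dz; rewrite normrM -[leRHS]mul1r ler_pM//; [exact: bG|exact: hC].
Qed.

Let th_mass m : \int[leb4]_(z in D) th m z.2 = 1.
Proof.
have c1 : continuous (cst 1 : R -> R) by exact: cst_continuous.
transitivity (\int[leb4]_(z in D) tensor (cst 1) (cst 1) (cst 1) (th m) z).
  by apply: eq_Rintegral => z _; rewrite /tensor /= !mul1r.
have L : leb1 `[0%R, 1%R[%classic = 1%E.
  by rewrite lebesgue_measure_itv/= lte_fin ltr01 sube0.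
have I1 : \int[leb1]_(x in `[0, 1[) (cst 1 x : R) = 1.
  by rewrite Rintegral_cst// mul1r [X in fine X]L.
rewrite (integral_tensor c1 c1 c1 (@cth m)) I1 !mul1r.
rewrite -[RHS](th_mass1 m (lexx 0)) ?add0r ?ltW//.
by apply: eq_Rintegral => t _; rewrite subr0.
Qed.

(** The kernel only sees times between 0 and 1/(m+1), when [c] is close to its
    initial value. *)
Let small e : 0 < e ->
  \forall m \near \oo, \int[leb4]_(z in D) (G z * th m z.2) <= e.
Proof.
move=> e0; have [d d0 hd] := c_c0 e0.
have [n0 _ hn] := near_infty_natSinv_lt (PosNum d0).
exists n0 => // m /= /hn /= hm.
suff : 0 <= \int[leb4]_(z in D) ((e - G z) * th m z.2).
  under eq_Rintegral do rewrite mulrBl.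
  have ie : leb4.-integrable D (EFin \o (fun z : ST => e * th m z.2)).
    have [C hC] := bth m; apply: (bounded_integrable mD fD (C := e * C)).
      by apply: measurable_funTS; exact: measurable_funM.
    by move=> z Dz; rewrite normrM gtr0_norm// ler_pM2l//; exact: hC.
  rewrite RintegralB// RintegralZl// th_mass mulr1 subr_ge0.
  by [].
have [C hC] := bth m.
have mf : measurable_fun setT (fun z : ST => (e - G z) * th m z.2).
  by apply: measurable_funM => //; exact: measurable_funB.
have bf x t : cell x -> `]0, M[%classic t -> `|(e - G (x, t)) * th m t| <= (e + 1) * C.
  move=> cx It; have Dz : D (x, t) by split.
  rewrite normrM ler_pM//; last exact: (hC _ Dz).
  by rewrite (le_trans (ler_normB _ _))// gtr0_norm// lerD2l bG.
have := bounded_Fubini2 (m1 := leb3) (m2 := leb1) mC (mI M) fC (fI M) mf bf.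
rewrite /leb4 => ->; apply: Rintegral_ge0 => t /= It.
have [->|/(th_support kth)/andP[t0 tm]] := eqVneq (th m t) 0.
  apply: Rintegral_ge0 => x _; by rewrite mulr0.
have {}t0 : 0 < t by apply: lt_trans t0; rewrite invr_gt0 mulr_gt0.
have mGt : measurable_fun setT (fun x : SP => G (x, t)) by exact: measurable_fun_pair1.
have iGt : leb3.-integrable cell (EFin \o (fun x => G (x, t))).
  apply: (bounded_integrable mC fC (C := 1)); first exact: measurable_funTS.
  by move=> x cx; apply: bG; split.
have ie : leb3.-integrable cell (EFin \o (cst e : position R -> R)).
  by apply: (bounded_integrable mC fC (C := `|e|)) => // x cx.
rewrite RintegralZr//; last first.
  by have := integrableB mC ie iGt; apply: eq_integrable.
rewrite mulr_ge0 ?(th_ge0 kth)// RintegralB// (Rintegral_cst _ mC)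
  [X in fine X]leb3_cell mulr1 subr_ge0.
apply: le_trans (hd t _); last by rewrite t0 (lt_trans tm).
rewrite le_eqVlt; apply/orP; left; apply/eqP; apply: eq_Rintegral => x /set_mem cx.
by rewrite GE//; move: It; rewrite in_itv.
Qed.

Let difference m : (L1_dist leb3 cell (fun y => moll k th M m c (y, 0%R))
    (fun y => moll k th M m ez (y, 0%R)) <= (\int[leb4]_(z in D) (G z * th m z.2)%R)%:E)%E.
Proof.
have rc := regular_moll M kth c2 m; have re := regular_moll M kth ez2 m.
have i1 : leb3.-integrable cell
    (EFin \o (fun y => `|moll k th M m c (y, 0) - moll k th M m ez (y, 0)|)).
  have := integrable_norm (integrableB mC (trace_integrable rc) (trace_integrable re)).
  by apply: eq_integrable.
rewrite -swap /L1_dist -(EFin_Rintegral mC i1) lee_fin; apply: le_Rintegral => //.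
  by apply: trace_integrable; apply: regular_conv => //; exact: smooth_kernel.
by move=> y cy; exact: moll_difference.
Qed.

(** Compare with the mollification of the stationary extension of the initial
    value: the difference only involves times before 1/(m+1), and the
    mollified stationary function converges. *)
Lemma moll_initial :
  vanishes (fun m => L1_dist leb3 cell (fun y => moll k th M m c (y, 0)) c0).
Proof.
apply: vanishes_approx => e e0.
exists (fun m => L1_dist leb3 cell (fun y => moll k th M m ez (y, 0)) c0).
  exact: moll_stationary_cvg.
apply: filterS (small e0) => m hm.
rewrite addeC; apply: le_trans (leeD2r _ (le_trans (difference m) _)); last by rewrite lee_fin.
have mc := trace_measurable (regular_moll M kth c2 m).
have me := trace_measurable (regular_moll M kth ez2 m).
exact: (L1_triangle leb3 mC mc me mc0).
Qed.

End InitialTrace.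

(** * The renormalized equation *)
Section ShiftedLimit.
Context d (T : measurableType d) (R : realType).
Variables (mu : {measure set T -> \bar R}) (D : set T).
Hypotheses (mD : measurable D) (fD : (mu D < +oo)%E).

Lemma L1_shift (f : nat -> T -> R) (g : T -> R) :
  (forall m, measurable_fun D (f m)) -> measurable_fun D g ->
  vanishes (fun m => L1_dist mu D (f m) g) ->
  vanishes (fun m => L1_dist mu D (fun x => f m x + m.+1%:R^-1) g).
Proof.
move=> mf mg V.
have V1 : vanishes (fun m => ((fine (mu D))%:E * (m.+1%:R^-1 : R)%:E)%E).
  apply: vanishesZ; first exact: fine_ge0.
  move=> e e0; have [n _ hn] := near_infty_natSinv_lt (PosNum e0).
  by exists n => // m /= /hn /= /ltW; rewrite lee_fin.
apply: vanishes_le (vanishesD V1 V); near=> m.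
have mfm : measurable_fun D (fun x => f m x + m.+1%:R^-1) by exact: measurable_funD.
apply: le_trans (L1_triangle mu mD mfm (mf m) mg) _; apply: leeD2r.
rewrite /L1_dist.
under eq_integral do rewrite addrAC subrr add0r ger0_norm//.
by rewrite integral_cst// muleC fineK// ge0_fin_numE.
Unshelve. all: end_near. Qed.

End ShiftedLimit.

Section SquareIntegrableProduct.
Context d (T : measurableType d) (R : realType).
Variables (mu : {measure set T -> \bar R}) (D : set T).
Hypotheses (mD : measurable D).

Lemma integrable_product (f g : T -> R) : measurable_fun D f -> measurable_fun D g ->
  mu.-integrable D (EFin \o (fun x => f x ^+ 2)) ->
  mu.-integrable D (EFin \o (fun x => g x ^+ 2)) ->
  mu.-integrable D (EFin \o (fun x => f x * g x)).
Proof.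
move=> mf mg if2 ig2; apply: (le_integrable mD _ _ (integrableD mD if2 ig2)).
  by apply/measurable_EFinP; exact: measurable_funM.
move=> x _ /=; rewrite lee_fin normrM [leRHS]ger0_norm ?addr_ge0 ?sqr_ge0//.
rewrite -[f x ^+ 2]real_normK ?num_real// -[g x ^+ 2]real_normK ?num_real//.
have := sqr_ge0 (`|f x| - `|g x|); have := normr_ge0 (f x); have := normr_ge0 (g x).
by nra.
Qed.

End SquareIntegrableProduct.

Section Renormalization.
Variable R : realType.
Notation line := (measurableTypeR R).
Notation SP := (line * line * line)%type.
Notation ST := (line * line * line * line)%type.
Variables (c : spacetime R -> R) (c0 : position R -> R).
Variables (J G : 'I_3 -> spacetime R -> R) (b b1 b2 : R -> R).
Hypotheses (c2 : locally_L2 c) (J2 : forall i, locally_L2 (J i)).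
Hypothesis G2 : forall i, locally_L2 (G i).
Hypothesis c01 : forall z, cylinder `]0, +oo[ z -> 0 <= c z <= 1.
Hypothesis mc0 : measurable_fun (cell : set SP) (c0 : SP -> R).
Hypothesis c001 : forall x, cell x -> 0 <= c0 x <= 1.
Hypothesis c_c0 : forall e : R, 0 < e -> exists2 d : R, 0 < d &
  forall t, 0 < t < d -> \int[leb3]_(x in cell) `|c (x, t) - c0 x| <= e.
Hypothesis cG : has_gradient c G.
Hypothesis weak : forall phi, test_function `[0, +oo[ phi ->
    \int[leb3]_(x in cell) (c0 x * phi (x, 0)) +
    \int[leb4]_(z in cylinder `]0, +oo[) (c z * dt phi z) +
    \int[leb4]_(z in cylinder `]0, +oo[) (\sum_i J i z * partial (Some i) phi z) = 0.
Hypothesis hb : C2_halfline b b1 b2.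

Section MollifiedIdentity.
Variables (k th : nat -> R -> R) (M : R) (phi : spacetime R -> R).
Hypotheses (kth : bumps k th) (M1 : 1 < M).
Hypotheses (sphi : smooth phi) (pphi : periodic_in_space phi).
Hypothesis phi0 : forall x, phi (x, M - 1) = 0.
Notation Q := (cylinder `]0, M - 1[ : set (spacetime R)).
Variable m : nat.
Let C := moll k th M m c.
Let Jm i := moll k th M m (J i).
Let Gm i := moll k th M m (G i).
Let dphi o := partial o phi.
(* The shift makes the argument of [b] positive: [b] is differentiable on the
   open half-line only. *)
Let U w := C w + m.+1%:R^-1.

Let D z : cylinder `]0, M[ z -> 0 <= c z <= 1.
Proof. by move=> /cylinder_unbounded; exact: c01. Qed.

Let C01 w : 0 <= C w <= 1. Proof. exact: (moll_bounds kth M1 c2). Qed.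

Let eps0 : 0 < m.+1%:R^-1 :> R. Proof. by rewrite invr_gt0. Qed.
Let eps1 : m.+1%:R^-1 <= 1 :> R. Proof. by rewrite invf_le1// ler1n. Qed.

Let U0 w : 0 < U w.
Proof. by have /andP[h _] := C01 w; rewrite /U ltr_wpDl. Qed.

Let regphi : regular phi. Proof. exact: smooth_regular. Qed.
Let regdphi o : regular (dphi o). Proof. exact/smooth_regular/smooth_partial. Qed.
Let regJ i : regular (Jm i). Proof. exact: regular_moll. Qed.
Let regG i : regular (Gm i). Proof. exact: regular_moll. Qed.
Let regU : regular U.
Proof. by apply: regularD; [exact: regular_moll|exact: regular_cst]. Qed.

Let regcomp (a : R -> R) : {within `[0, +oo[, continuous a} -> regular (fun w => a (U w)).
Proof.
move=> ca; pose e : R := m.+1%:R^-1; have [e0 e1] : 0 < e /\ e <= 1 by split; [exact: eps0|exact: eps1].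
apply: (@regular_comp _ U a (e / 2) 3) => //.
- lra.
- by move=> w; rewrite /U -/e; have /andP[? ?] := C01 w; apply/andP; split; lra.
apply: continuous_subspaceW ca => x /=; rewrite !in_itv/= andbT => /andP[h _].
by apply: le_trans h; rewrite divr_ge0// ltW.
Qed.

Let regdC (f : spacetime R -> R) o : locally_L2 f ->
  regular (fun w => - conv M (cutoff M f) (partial o (kernel k th m)) w).
Proof.
move=> f2; have sh := smooth_partial o (smooth_kernel kth m).
exact: (regularN (regular_conv_cutoff M f2 sh)).
Qed.

Let dU o w : is_derive w (axis R o) U
  (- conv M (cutoff M c) (partial o (kernel k th m)) w).
Proof.
have d1 := is_derive_moll M kth c2 m o w.
have := is_deriveD d1 (is_derive_cst (m.+1%:R^-1 : R) w (axis R o)).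
by rewrite addr0.
Qed.

(** The mollified equation is an equation between smooth functions, in which
    the chain rule is available. *)
Lemma mollified_renormalization :
  \int[leb3]_(x in cell) (b (U (x, 0)) * phi (x, 0))
  + \int[leb4]_(z in Q) (b (U z) * dphi None z)
  + \int[leb4]_(z in Q) (b1 (U z) * \sum_i Jm i z * dphi (Some i) z)
  + \int[leb4]_(z in Q) (b2 (U z) * ((\sum_i Gm i z * Jm i z) * phi z)) = 0.
Proof.
have [cb cb1 cb2 db db1] := hb.
have rb := regcomp cb; have rb1 := regcomp cb1; have rb2 := regcomp cb2.
pose dC o w := - conv M (cutoff M c) (partial o (kernel k th m)) w.
pose dJ i w := - conv M (cutoff M (J i)) (partial (Some i) (kernel k th m)) w.
have rdC o : regular (dC o) by exact: regdC.
have rdJ i : regular (dJ i) by exact: regdC.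
pose Ft w := b (U w) * phi w.
pose Ft' w := b (U w) * dphi None w + phi w * (b1 (U w) * dC None w).
have rFt : regular Ft by exact: regularM.
have rFt' : regular Ft'.
  exact: (regularD (regularM rb (regdphi None)) (regularM regphi (regularM rb1 (rdC None)))).
have dFt w : is_derive w (axis R None) Ft (Ft' w).
  have d1 := is_derive_along_comp (dU None w) (db _ (U0 w)).
  exact: is_deriveM d1 (smooth_is_derive None w sphi).
pose Fi i w := b1 (U w) * Jm i w * phi w.
pose Fi' i w := b1 (U w) * Jm i w * dphi (Some i) w +
  phi w * (b1 (U w) * dJ i w + Jm i w * (b2 (U w) * dC (Some i) w)).
have rFi' i : regular (Fi' i).
  exact: (regularD (regularM (regularM rb1 (regJ i)) (regdphi (Some i)))
    (regularM regphi (regularD (regularM rb1 (rdJ i))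
      (regularM (regJ i) (regularM rb2 (rdC (Some i))))))).
have dFi i w : is_derive w (axis R (Some i)) (Fi i) (Fi' i w).
  have d1 := is_derive_along_comp (dU (Some i) w) (db1 _ (U0 w)).
  have d2 := is_derive_moll M kth (J2 i) m (Some i) w.
  exact: is_deriveM (is_deriveM d1 d2) (smooth_is_derive (Some i) w sphi).
have pFi i : periodic_in_space (Fi i).
  move=> t j x; rewrite /Fi (pphi t j x) /U /C /Jm.
  by rewrite (periodic_moll M kth c m t j x) (periodic_moll M kth (J i) m t j x).
have M10 : 0 < M - 1 by rewrite subr_gt0.
have It := time_derivative_integral M10 rFt rFt' dFt.
have Ii i := periodic_derivative_integral (M - 1) (rFi' i) (dFi i) (pFi i).
have mQ : measurable (Q : set ST) by exact: measurable_cylinder.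
have int F : regular F -> leb4.-integrable Q (EFin \o F) by exact: regular_integrable.
have [Is iS] := Rintegral_sum (index_enum 'I_3) mQ (fun i => int _ (rFi' i)).
pose A w := b (U w) * dphi None w.
pose B w := b1 (U w) * \sum_i Jm i w * dphi (Some i) w.
pose E w := b2 (U w) * ((\sum_i Gm i w * Jm i w) * phi w).
have iA : leb4.-integrable Q (EFin \o A) by exact: int (regularM rb (regdphi None)).
have iB : leb4.-integrable Q (EFin \o B).
  exact: int (regularM rb1 (regular_sum _ (fun i => regularM (regJ i) (regdphi (Some i))))).
have iE : leb4.-integrable Q (EFin \o E).
  exact: int (regularM rb2 (regularM (regular_sum _ (fun i => regularM (regG i) (regJ i)))
    regphi)).
have iBE : leb4.-integrable Q (EFin \o (fun w => B w + E w)).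
  by have := integrableD mQ iB iE; apply: eq_integrable.
rewrite -/A -/B -/E -!addrA -(RintegralD mQ iB iE) -(RintegralD mQ iA iBE).
have -> : \int[leb4]_(w in Q) (A w + (B w + E w)) =
    \int[leb4]_(w in Q) (Ft' w + \sum_i Fi' i w).
  apply: eq_Rintegral => w /set_mem Qw.
  rewrite /Ft' {1}/dC (moll_divergence kth m weak J2 Qw).
  have -> : \sum_i Fi' i w = B w + E w + phi w * b1 (U w) * \sum_i dJ i w.
    rewrite /B /E mulr_sumr mulr_suml mulr_sumr mulr_sumr -!big_split /=.
    apply: eq_bigr => i _; rewrite /Fi'.
    have -> : dC (Some i) w = Gm i w by exact: (moll_gradient kth m i cG Qw).
    ring.
  rewrite /dJ sumrN /A; ring.
rewrite (RintegralD mQ (int _ rFt') iS) Is It big1 ?addr0; last by move=> i _; exact: Ii.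
have -> : \int[leb3]_(x in cell) Ft (x, M - 1) = 0.
  rewrite (_ : Rintegral _ _ _ = \int[leb3]_(x in cell) (cst 0 x)).
    by rewrite (Rintegral_cst _ (@measurable_cell R)) mul0r.
  by apply: eq_Rintegral => x _; rewrite /Ft phi0 mulr0.
by rewrite sub0r subrr.
Qed.

End MollifiedIdentity.

Lemma gradient_flux_integrable (F : spacetime R -> R) (T : R) : regular F ->
  leb4.-integrable (cylinder `]0, T[)
    (EFin \o (fun z => b2 (c z) * ((\sum_i G i z * J i z) * F z))).
Proof.
move=> rF; pose Q : set (spacetime R) := cylinder `]0, T[.
have mQ : measurable (Q : set ST) by exact: measurable_cylinder.
have iN i : leb4.-integrable Q (EFin \o (fun z => G i z * J i z)).
  have [mG iG] := G2 i T; have [mJ iJ] := J2 i T.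
  exact: (integrable_product mQ mG mJ iG iJ).
have [_ iS] := Rintegral_sum (index_enum 'I_3) mQ iN.
have [C hC] := regular_bounded_on T rF.
have [mc _] := c2 T; have [_ _ cb2 _ _] := hb.
apply: (integrable_composition mQ (p := 0) (q := 1) ler01 _ mc).
- by apply: continuous_subspaceW cb2 => x /=; rewrite !in_itv/= andbT => /andP[].
- by move=> z /cylinder_unbounded; exact: c01.
exact: (integrable_mulr_bounded mQ iS (regular_measurable_on (T := T) rF) hC).
Qed.

(** The mollified identity passes to the limit: concentrations converge in L1
    and stay in a compact interval, fluxes and gradients converge in L2, so
    their products converge in L1; the initial term uses the convergence of
    the traces. *)
Lemma renormalization phi : test_function `[0, +oo[ phi ->
  \int[leb3]_(x in cell) (b (c0 x) * phi (x, 0))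
  + \int[leb4]_(z in cylinder `]0, +oo[) (b (c z) * dt phi z)
  + \int[leb4]_(z in cylinder `]0, +oo[) (b1 (c z) * \sum_i J i z * partial (Some i) phi z)
  + \int[leb4]_(z in cylinder `]0, +oo[) (b2 (c z) * ((\sum_i G i z * J i z) * phi z)) = 0.
Proof.
move=> tphi; have [sphi pphi _] := tphi.
have pos : `]0, +oo[ `<=` (`[0, +oo[ : set R).
  by move=> t /=; rewrite !in_itv/= !andbT => /ltW.
have [T T0 phi0] := test_function_vanishes pos tphi.
have dphi0 := partial_eq0_late phi0.
(* One unit of time for the window of the kernel, one to contain the support
   of the test function strictly. *)
pose M := T + 2.
have M1 : 1 < M by rewrite /M; lra.
have TM : T < M - 1 by rewrite /M; lra.
pose Q : set (spacetime R) := cylinder `]0, M - 1[.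
have mQ : measurable (Q : set ST) by exact: measurable_cylinder.
have fQ : (leb4 Q < +oo)%E by exact: leb4_cylinder_fin.
have late (f : spacetime R -> R) : (forall x t, M - 1 <= t -> f (x, t) = 0) ->
  \int[leb4]_(z in cylinder `]0, +oo[) f z = \int[leb4]_(z in Q) f z.
  exact: Rintegral_late.
have {}dphi0 o x t : M - 1 <= t -> partial o phi (x, t) = 0.
  by move=> Mt; apply: dphi0; exact: lt_le_trans Mt.
have {}phi0 x t : M - 1 <= t -> phi (x, t) = 0.
  by move=> Mt; apply: phi0; apply: le_trans Mt; exact: ltW.
rewrite late; last by move=> x t Mt; rewrite [dt phi _]dphi0 ?mulr0.
rewrite late; last first.
  by move=> x t Mt; rewrite big1 ?mulr0// => i _; rewrite dphi0 ?mulr0.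
rewrite late; last by move=> x t Mt; rewrite phi0 ?mulr0.
have [k [th kth]] := bumps_exist R.
have cQ z : Q z -> 0 <= c z <= 1 by move=> /cylinder_unbounded; exact: c01.
have cD z : cylinder `]0, M[ z -> 0 <= c z <= 1 by move=> /cylinder_unbounded; exact: c01.
have up (x : R) : 0 <= x <= 1 -> 0 <= x <= 2.
  by move=> /andP[x0 x1]; rewrite x0 (le_trans x1)// ler1n.
pose Cm m := moll k th M m c.
pose U m w := Cm m w + m.+1%:R^-1.
have U02 m w : 0 <= U m w <= 2.
  have /andP[h0 h1] : 0 <= Cm m w <= 1 by exact: (moll_bounds kth M1 c2).
  have e0 : 0 <= m.+1%:R^-1 :> R by rewrite invr_ge0.
  have e1 : m.+1%:R^-1 <= 1 :> R by rewrite invf_le1// ler1n.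
  by rewrite /U addr_ge0// (_ : 2 = 1 + 1)// lerD.
pose Jm m i := moll k th M m (J i); pose Gm m i := moll k th M m (G i).
have E m := mollified_renormalization kth M1 sphi pphi (fun x => phi0 x _ (lexx _)) m.
have rC m : regular (Cm m) by exact: regular_moll.
have rJ m i : regular (Jm m i) by exact: regular_moll.
have rG m i : regular (Gm m i) by exact: regular_moll.
have rp : regular phi by exact: smooth_regular.
have rdp o : regular (partial o phi) by apply: smooth_regular; exact: smooth_partial.
have ms F : regular F -> measurable_fun (Q : set ST) (F : ST -> R).
  exact: regular_measurable_on.
have it F : regular F -> leb4.-integrable Q (EFin \o F) by exact: regular_integrable.
have [mc _] := c2 (M - 1).
have mJ i : measurable_fun (Q : set ST) (J i : ST -> R) by have [] := J2 i (M - 1).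
have mG i : measurable_fun (Q : set ST) (G i : ST -> R) by have [] := G2 i (M - 1).
have iJ i : leb4.-integrable Q (EFin \o (fun z => J i z ^+ 2)).
  by have [] := J2 i (M - 1).
have iG i : leb4.-integrable Q (EFin \o (fun z => G i z ^+ 2)).
  by have [] := G2 i (M - 1).
have bdp o : exists C : R, forall w, Q w -> `|partial o phi w| <= C.
  exact: regular_bounded_on.
have [Cp hCp] := regular_bounded_on (M - 1) rp.
have rU m : regular (U m) by apply: regularD => //; exact: regular_cst.
have mU m := ms _ (rU m).
have UL1 : vanishes (fun m => L1_dist leb4 Q (U m) c).
  exact: (L1_shift mQ fQ (fun m => ms _ (rC m)) mc (moll_cvg_L1 kth M1 c2)).
have [cb cb1 cb2 _ _] := hb.
have within02 (a : R -> R) : {within `[0, +oo[, continuous a} ->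
    {within `[0, 2], continuous a}.
  by apply: continuous_subspaceW => x /=; rewrite !in_itv/= andbT => /andP[].
have {}cb := within02 _ cb; have {}cb1 := within02 _ cb1; have {}cb2 := within02 _ cb2.
have p02 : (0 : R) <= 2 by rewrite ler0n.
have upc z (Qz : Q z) := up _ (cQ z Qz).
have upU m z (_ : Q z) := U02 m z.
pose P i z := J i z * partial (Some i) phi z.
pose Pm i m z := Jm m i z * partial (Some i) phi z.
pose N i z := G i z * J i z.
pose Nm i m z := Gm m i z * Jm m i z.
have rPm i m : regular (Pm i m) by exact: (regularM (rJ m i) (rdp (Some i))).
have rNm i m : regular (Nm i m) by exact: (regularM (rG m i) (rJ m i)).
have mP i : measurable_fun (Q : set ST) (P i : ST -> R).
  by apply: measurable_funM; [exact: mJ|exact: ms].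
have mN i : measurable_fun (Q : set ST) (N i : ST -> R).
  by apply: measurable_funM; [exact: mG|exact: mJ].
have iP i : leb4.-integrable Q (EFin \o P i).
  have [C hC] := bdp (Some i).
  exact: (integrable_mulr_bounded mQ (integrable_locally_L2 (M - 1) (J2 i)) (ms _ (rdp _)) hC).
have iN i : leb4.-integrable Q (EFin \o N i).
  exact: (integrable_product mQ (mG i) (mJ i) (iG i) (iJ i)).
have PL1 i : vanishes (fun m => L1_dist leb4 Q (Pm i m) (P i)).
  have [C hC] := bdp (Some i).
  exact: (L1_mulr_bounded mQ (fun m => ms _ (rJ m i)) (mJ i) (ms _ (rdp _)) hC
    (moll_cvg_L1 kth M1 (J2 i))).
have NL1 i : vanishes (fun m => L1_dist leb4 Q (Nm i m) (N i)).
  exact: (L1_product mQ (fun m => ms _ (rG m i)) (fun m => ms _ (rJ m i)) (mG i) (mJ i)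
    (iG i) (iJ i) (moll_cvg_L2 kth M1 (G2 i)) (moll_cvg_L2 kth M1 (J2 i))).
pose S z := \sum_i P i z; pose Sm m z := \sum_i Pm i m z.
pose V z := (\sum_i N i z) * phi z; pose Vm m z := (\sum_i Nm i m z) * phi z.
have [_ iS] := Rintegral_sum (index_enum 'I_3) mQ iP.
have [_ iSN] := Rintegral_sum (index_enum 'I_3) mQ iN.
have iV : leb4.-integrable Q (EFin \o V).
  exact: (integrable_mulr_bounded mQ iSN (ms _ rp) hCp).
have rSm m : regular (Sm m) by exact: (regular_sum _ (fun i => rPm i m)).
have rSN m : regular (fun z => \sum_i Nm i m z) by exact: (regular_sum _ (fun i => rNm i m)).
have rVm m : regular (Vm m) by exact: (regularM (rSN m) rp).
have mSN : measurable_fun (Q : set ST) (fun z : ST => \sum_i N i z).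
  by have /integrableP[/measurable_EFinP] := iSN.
have SL1 : vanishes (fun m => L1_dist leb4 Q (Sm m) S).
  exact: (L1_sum mQ (index_enum 'I_3) (fun i m => ms _ (rPm i m)) mP PL1).
have SNL1 : vanishes (fun m => L1_dist leb4 Q (fun z => \sum_i Nm i m z) (fun z => \sum_i N i z)).
  exact: (L1_sum mQ (index_enum 'I_3) (fun i m => ms _ (rNm i m)) mN NL1).
have VL1 : vanishes (fun m => L1_dist leb4 Q (Vm m) V).
  exact: (L1_mulr_bounded mQ (fun m => ms _ (rSN m)) mSN (ms _ rp) hCp SNL1).
have rdt := rdp None.
have X1 := Rintegral_cvg_L1 mQ
  (fun m => integrable_composition mQ p02 cb (mU m) (upU m) (it _ rdt))
  (integrable_composition mQ p02 cb mc upc (it _ rdt))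
  (nonlinear_limit mQ p02 cb mU mc upU upc (fun=> ms _ rdt) (it _ rdt) UL1 (L1_refl _ _ _)).
have X2 := Rintegral_cvg_L1 mQ
  (fun m => integrable_composition mQ p02 cb1 (mU m) (upU m) (it _ (rSm m)))
  (integrable_composition mQ p02 cb1 mc upc iS)
  (nonlinear_limit mQ p02 cb1 mU mc upU upc (fun m => ms _ (rSm m)) iS UL1 SL1).
have X3 := Rintegral_cvg_L1 mQ
  (fun m => integrable_composition mQ p02 cb2 (mU m) (upU m) (it _ (rVm m)))
  (integrable_composition mQ p02 cb2 mc upc iV)
  (nonlinear_limit mQ p02 cb2 mU mc upU upc (fun m => ms _ (rVm m)) iV UL1 VL1).
have mC : measurable (cell : set SP) by exact: measurable_cell.
have fC : (leb3 (@cell R) < +oo)%E by exact: leb3_cell_fin.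
have IL1 : vanishes (fun m => L1_dist leb3 cell (fun y => U m (y, 0)) c0).
  exact: (L1_shift mC fC (fun m => trace_measurable (rC m)) mc0
    (moll_initial kth M1 c2 c01 mc0 c001 c_c0)).
have up0 y (cy : cell y) := up _ (c001 cy).
have X0 := Rintegral_cvg_L1 mC
  (fun m => integrable_composition mC p02 cb (trace_measurable (rU m)) (fun y _ => U02 m (y, 0)) (trace_integrable rp))
  (integrable_composition mC p02 cb mc0 up0 (trace_integrable rp))
  (nonlinear_limit mC p02 cb (fun m => trace_measurable (rU m)) mc0 (fun m y _ => U02 m (y, 0)) up0
    (fun=> trace_measurable rp) (trace_integrable rp) IL1 (L1_refl _ _ _)).
have X := cvgD (cvgD (cvgD X0 X1) X2) X3.
have L := cvg_lim (@Rhausdorff R) (X _ _ _).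
rewrite -[LHS]L; apply: cvg_lim; first exact: Rhausdorff.
rewrite [X in X @ _](_ : _ = cst 0); first exact: cvg_cst.
by apply/funext => m; exact: E.
Qed.

End Renormalization.

(** * The equation for a weak solution *)
Lemma ae_imply d (T : measurableType d) (R : realType) (mu : {measure set T -> \bar R})
  (P Q : T -> Prop) : (forall x, P x -> Q x) -> {ae mu, forall x, P x} -> {ae mu, forall x, Q x}.
Proof. by move=> PQ; apply: filterS. Qed.

Section Species.
Variable R : realType.
Notation line := (measurableTypeR R).
Notation SP := (line * line * line)%type.
Notation ST := (line * line * line * line)%type.

Lemma Lfun2_locally_L2 (g : spacetime R -> 'rV[R]_3) (k : 'I_3) : L2_finite_times g ->
  locally_L2 (fun z => g z 0 k).
Proof.
move=> g2.
have pos T : 0 < T -> measurable_fun (cylinder `]0, T[ : set ST) (fun z : ST => g z 0 k : line) /\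
    leb4.-integrable (cylinder `]0, T[) (EFin \o (fun z => g z 0 k ^+ 2)).
  move=> T0; have mQ : measurable (cylinder `]0, T[ : set ST) by exact: measurable_cylinder.
  have gL := g2 T T0 k; have i2 := Lfun2_integrable_sqr gL.
  split.
    apply/(measurable_restrictT _ mQ).
    by move: gL; rewrite inE => /andP[mg _]; move: mg; rewrite inE/=.
  apply: eq_integrable (integrableS measurableT mQ (@subsetT _ _) i2) => // z /set_mem Qz.
  by rewrite /= patchE mem_set.
move=> T; have T0 : 0 < Num.max 1 T by rewrite lt_max ltr01.
have [h1 h2] := pos (Num.max 1 T) T0.
have sub : cylinder `]0, T[ `<=` (cylinder `]0, Num.max 1 T[ : set (spacetime R)).
  by apply: cylinder_le; rewrite le_max lexx orbT.
have mQ (S : R) : measurable (cylinder `]0, S[ : set ST) by exact: measurable_cylinder.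
split; first exact: measurable_funS h1.
exact: integrableS h2.
Qed.

Variables (n : nat) (c0 : 'I_n -> position R -> R) (c : 'I_n -> spacetime R -> R)
  (u : 'I_n -> spacetime R -> 'rV[R]_3) (i : 'I_n) (g : spacetime R -> 'rV[R]_3).

Hypothesis mc : measurable_fun (cylinder `]0, +oo[ : set ST) (c i : ST -> R).
Hypothesis c01 : {ae leb4, forall z, cylinder `]0, +oo[ z -> 0 <= c i z <= 1}.
Hypothesis mc0 : measurable_fun (cell : set SP) (c0 i : SP -> R).
Hypothesis c001 : {ae leb3, forall x, cell x -> 0 <= c0 i x <= 1}.
Hypothesis sg : weak_gradient (sqrt_conc c i) g.
Hypotheses (g2 : L2_finite_times g) (v2 : L2_finite_times (sqrt_flux c u i)).
Hypothesis weak : forall phi, test_function `[0, +oo[ phi ->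
  \int[leb3]_(x in cell) (c0 i x * phi (x, 0))
  + \int[leb4]_(z in cylinder `]0, +oo[) (c i z * dt phi z)
  + \int[leb4]_(z in cylinder `]0, +oo[) dot (flux c u i z) (grad phi z) = 0.
Hypothesis c_c0 : (\int[leb3]_(x in cell) `|c i (x, t) - c0 i x|%:E)%E
  @[t --> 0^'+] --> 0%E.

Let K := clamp (0 : R) 1.
Let K01 x : 0 <= K x <= 1. Proof. by apply: clamp_itv; exact: ler01. Qed.
Let KE x : 0 <= x <= 1 -> K x = x. Proof. by apply: clamp_id; exact: ler01. Qed.

(* Clamping changes the concentration on a null set only, and makes the bounds
   and the identity c = r^2 hold everywhere. *)
Let cb z := K (c i z).
Let c0b x := K (c0 i x).
Let r z := Num.sqrt (cb z).
Let v k z := sqrt_flux c u i z 0 k.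
Let gk k z := g z 0 k.

Let mK : measurable_fun setT (K : line -> line).
Proof. by apply: measurable_clamp; exact: ler01. Qed.

Let mcb : measurable_fun (cylinder `]0, +oo[ : set ST) (cb : ST -> R).
Proof. exact: (measurableT_comp mK mc). Qed.

Let mQ T : measurable (cylinder `]0, T[ : set ST). Proof. exact: measurable_cylinder. Qed.
Let mQoo : measurable (cylinder `]0, +oo[ : set ST). Proof. exact: measurable_cylinder. Qed.

Let bounded_locally_L2 (f : spacetime R -> R) :
  measurable_fun (cylinder `]0, +oo[ : set ST) (f : ST -> R) -> (forall z, 0 <= f z <= 1) ->
  locally_L2 f.
Proof.
move=> mf f01 T; have mfT : measurable_fun (cylinder `]0, T[ : set ST) (f : ST -> R).
  exact: measurable_funS (@cylinder_unbounded R T) mf.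
split=> //; apply: (bounded_integrable (mQ T) (leb4_cylinder_fin T) _ (C := 1)).
  exact: measurable_funX.
by move=> z _; have /andP[f0 f1] := f01 z; rewrite ger0_norm ?exprn_ge0// expr_le1.
Qed.

Let r01 z : 0 <= r z <= 1.
Proof.
have /andP[h0 h1] := K01 (c i z).
by rewrite sqrtr_ge0 -(@sqrtr1 R) ler_sqrt.
Qed.

Let r2 : locally_L2 r.
Proof.
apply: bounded_locally_L2 => //.
have ms := continuous_measurable_fun (@sqrt_continuous R).
exact: (measurableT_comp ms mcb).
Qed.

Let cb2 : locally_L2 cb.
Proof. by apply: bounded_locally_L2 => // z; exact: K01. Qed.

Let r_times (f : spacetime R -> R) : locally_L2 f -> locally_L2 (fun z => r z * f z).
Proof.
move=> f2 T; have [mf i2] := f2 T; have [mr _] := r2 T.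
split; first exact: measurable_funM.
apply: (le_integrable (mQ T) _ _ i2).
  by apply/measurable_EFinP; apply: measurable_funX; exact: measurable_funM.
move=> z _ /=; rewrite lee_fin !ger0_norm ?sqr_ge0// exprMn.
have /andP[h0 h1] := r01 z.
by rewrite ler_piMl ?sqr_ge0// expr_le1.
Qed.

Let vL2 k : locally_L2 (v k). Proof. exact: Lfun2_locally_L2. Qed.
Let gL2 k : locally_L2 (gk k). Proof. exact: Lfun2_locally_L2. Qed.

Let J k z := r z * v k z.
Let G k z := 2 * r z * gk k z.

Let J2 k : locally_L2 (J k). Proof. exact: r_times. Qed.

Let G2 k : locally_L2 (G k).
Proof.
move=> T; have [mf i2] := r_times (gL2 k) T; split.
  have -> : G k = (fun z => 2 * (r z * gk k z)) by apply/funext => z; rewrite mulrA.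
  exact: measurable_funM.
move: (integrableZl (mQ T) (4 : R) i2); apply: eq_integrable => // z _.
by rewrite /= -EFinM /G -mulrA [in RHS]exprMn; congr (_ * _)%:E; rewrite -natrX.
Qed.

Let cE : {ae leb4, forall z, cylinder `]0, +oo[ z -> c i z = cb z}.
Proof. by apply: (@ae_imply _ ST R leb4 _ _ _ c01) => z h /h /KE /esym. Qed.

Let c0E : {ae leb3, forall x, cell x -> c0 i x = c0b x}.
Proof. by apply: (@ae_imply _ SP R leb3 _ _ _ c001) => x h /h /KE /esym. Qed.

Let rr z : r z * r z = cb z.
Proof. by rewrite -expr2 sqr_sqrtr//; have /andP[] := K01 (c i z). Qed.

Let cG : has_gradient cb G.
Proof.
have rg : has_gradient r gk.
  move=> phi tphi k; have [_ _ /(_ phi tphi k) <-] := sg.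
  by apply: ae_congr_Rintegral; apply: (@ae_imply _ ST R leb4 _ _ _ cE) => z h /h cz; rewrite /sqrt_conc cz.
have := gradient_sqr r2 gL2 (fun z _ => r01 z) rg.
by rewrite (_ : (fun z => r z ^+ 2) = cb)//; apply/funext => z; rewrite expr2 rr.
Qed.

Let dot_grad (a : 'rV[R]_3) phi z : dot a (grad phi z) =
  \sum_k a 0 k * partial (Some k) phi z.
Proof. by apply: eq_bigr => k _; rewrite mxE. Qed.

Let weakb phi : test_function `[0, +oo[ phi ->
  \int[leb3]_(x in cell) (c0b x * phi (x, 0)) +
  \int[leb4]_(z in cylinder `]0, +oo[) (cb z * dt phi z) +
  \int[leb4]_(z in cylinder `]0, +oo[) (\sum_k J k z * partial (Some k) phi z) = 0.
Proof.
move=> tphi; rewrite -[RHS](weak tphi); congr (_ + _ + _); apply: ae_congr_Rintegral.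
- by apply: (@ae_imply _ SP R leb3 _ _ _ c0E) => x h /h ->.
- by apply: (@ae_imply _ ST R leb4 _ _ _ cE) => z h /h ->.
apply: (@ae_imply _ ST R leb4 _ _ _ cE) => z h /h cz; rewrite dot_grad; apply: eq_bigr => k _.
congr (_ * _); rewrite /J /v /sqrt_flux /flux /r /sqrt_conc -cz !mxE mulrA.
by congr (_ * _); rewrite cz rr.
Qed.

Let mcell : measurable (cell : set SP). Proof. exact: measurable_cell. Qed.

Lemma measurable_section (f : spacetime R -> R) t :
  measurable_fun (cylinder `]0, +oo[ : set ST) (f : ST -> R) -> 0 < t ->
  measurable_fun (cell : set SP) (fun x : SP => f (x, t)).
Proof.
move=> mf t0; have mfr := (measurable_restrictT _ mQoo).1 mf.
apply: (eq_measurable_fun (fun x : SP => (f \_ (cylinder `]0, +oo[)) (x, t))).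
  move=> x /set_mem cx; rewrite patchE mem_set//; split => //=.
  by rewrite in_itv/= t0.
by apply: measurable_funTS; exact: (measurable_fun_pair1 t mfr).
Qed.

Let mc0b : measurable_fun (cell : set SP) (c0b : SP -> R).
Proof. exact: (measurableT_comp mK mc0). Qed.

Let near_initial (P : R -> Prop) : (\forall t \near 0^'+, P t) ->
  exists2 d : R, 0 < d & forall t, 0 < t < d -> P t.
Proof.
move=> /nbhs_ballP[d /= d0 hd]; exists d => // t /andP[t0 td]; apply: hd => //=.
by rewrite /ball /= sub0r normrN gtr0_norm.
Qed.

Lemma initial_distance e : 0 < e -> exists2 d : R, 0 < d & forall t, 0 < t < d ->
  (\int[leb3]_(x in cell) `|c i (x, t) - c0 i x|%:E <= e%:E)%E.
Proof.
move=> e0; apply: near_initial.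
have /fine_cvgP[fin /cvgrPdist_le /(_ e e0) cv] := c_c0.
apply: filterS2 fin cv => t tf; rewrite sub0r normrN => te.
by rewrite -(fineK tf) lee_fin (le_trans (ler_norm _)).
Qed.

Let cc0b e : 0 < e -> exists2 d : R, 0 < d & forall t, 0 < t < d ->
  \int[leb3]_(x in cell) `|cb (x, t) - c0b x| <= e.
Proof.
move=> e0; have [d d0 hd] := initial_distance e0; exists d => // t td.
have t0 : 0 < t by have /andP[] := td.
have h : (\int[leb3]_(x in cell) `|cb (x, t) - c0b x|%:E <= e%:E)%E.
  apply: le_trans (hd t td); apply: ge0_le_integral => //.
  - by apply: measurable_dist => //; exact: measurable_section mcb t0.
  - by apply: measurable_dist => //; exact: measurable_section mc t0.
  - by move=> x _; rewrite lee_fin; apply: clamp_lip; exact: ler01.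
have f : (\int[leb3]_(x in cell) `|cb (x, t) - c0b x|%:E)%E \is a fin_num.
  rewrite ge0_fin_numE; first by rewrite (le_lt_trans h) ?ltry.
  by apply: integral_ge0 => x _; rewrite lee_fin.
by rewrite -lee_fin /Rintegral fineK.
Qed.

(** The flux is r v and the gradient of c is 2 r g, where r is the root of c
    and g its gradient; the products in the renormalized equation are those of
    the general one, up to null sets. *)
Lemma renormalized_equation phi b b1 b2 :
  test_function `[0, +oo[ phi -> C2_halfline b b1 b2 ->
  \int[leb3]_(x in cell) (b (c0 i x) * phi (x, 0))
  + \int[leb4]_(z in cylinder `]0, +oo[) (b (c i z) * dt phi z)
  + \int[leb4]_(z in cylinder `]0, +oo[)
      (sqrt_conc c i z * b1 (c i z) * dot (sqrt_flux c u i z) (grad phi z))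
  + 2 * \int[leb4]_(z in cylinder `]0, +oo[)
      (c i z * b2 (c i z) * dot (g z) (sqrt_flux c u i z) * phi z) = 0.
Proof.
move=> tphi hb; have [sphi _ _] := tphi.
have cb01 z : cylinder `]0, +oo[ z -> 0 <= cb z <= 1 by move=> _; exact: K01.
have c0b01 x : cell x -> 0 <= c0b x <= 1 by move=> _; exact: K01.
rewrite -[RHS](renormalization cb2 J2 G2 cb01 mc0b c0b01 cc0b cG weakb hb tphi).
congr (_ + _ + _ + _).
- by apply: ae_congr_Rintegral; apply: (@ae_imply _ SP R leb3 _ _ _ c0E) => x h /h ->.
- by apply: ae_congr_Rintegral; apply: (@ae_imply _ ST R leb4 _ _ _ cE) => z h /h ->.
- apply: ae_congr_Rintegral; apply: (@ae_imply _ ST R leb4 _ _ _ cE) => z h /h cz.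
  rewrite dot_grad /sqrt_conc cz -/(r z) mulrC mulr_suml [RHS]mulr_sumr.
  by apply: eq_bigr => k _; rewrite /J /v; ring.
have pos : `]0, +oo[ `<=` (`[0, +oo[ : set R).
  by move=> t /=; rewrite !in_itv/= !andbT => /ltW.
have [T _ phi0] := test_function_vanishes pos tphi.
have iE := gradient_flux_integrable cb2 J2 G2 cb01 hb T (smooth_regular sphi).
rewrite [RHS](Rintegral_late (T := T)); last by move=> x t Tt; rewrite phi0 ?mulr0.
rewrite [X in _ * X](Rintegral_late (T := T)); last by move=> x t Tt; rewrite phi0 ?mulr0.
have two : (2 : R) != 0 by rewrite pnatr_eq0.
rewrite -[RHS](mulVKf two); congr (_ * _).
rewrite -(RintegralZl _ (mQ T) iE).
apply: ae_congr_Rintegral; apply: (@ae_imply _ ST R leb4 _ _ _ cE) => z h /cylinder_unbounded /h cz.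
rewrite cz /dot [RHS]mulrA [RHS]mulrA; congr (_ * _).
rewrite [LHS]mulr_sumr [RHS]mulr_sumr; apply: eq_bigr => k _.
by rewrite /G /J /v /gk -rr; field.
Qed.

End Species.

(** * Continuity at the initial time *)
Section EveryTime.
Variable R : realType.
Notation leb1 := (@lebesgue_measure R).
Notation line := (measurableTypeR R).
Notation SP := (line * line * line)%type.
Notation ST := (line * line * line * line)%type.
Variable c : spacetime R -> R.
Hypothesis mc : measurable_fun (cylinder `]0, +oo[ : set ST) (c : ST -> R).
Hypothesis c01 : {ae leb4, forall z, cylinder `]0, +oo[ z -> 0 <= c z <= 1}.
Hypothesis cc : continuous_L2 c.

Notation K := (clamp (0 : R) 1).

Let mcell : measurable (cell : set SP). Proof. exact: measurable_cell. Qed.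
Let mQoo : measurable (cylinder `]0, +oo[ : set ST). Proof. exact: measurable_cylinder. Qed.

(* The L1 distance at time [t] of the concentration to the functions with
   values in [0, 1]. *)
Let excess t := L1_dist leb3 cell (fun x => c (x, t)) (fun x => K (c (x, t))).

(** By Fubini, a bound that holds almost everywhere in space and time holds
    almost everywhere in space at almost every time. *)
Let excess_ae : {ae leb1, forall t : line, 0 < t -> excess t = 0%E}.
Proof.
pose f (z : ST) : R := ((fun z => `|c z - K (c z)|) \_ (cylinder `]0, +oo[)) z.
have mf : measurable_fun setT (fun z : ST => (f z)%:E).
  apply/measurable_EFinP; apply/(measurable_restrictT _ mQoo).
  apply: measurableT_comp => //.
  by apply: measurable_funB => //; exact: (measurableT_comp (measurable_clamp ler01) mc).
have f0 (z : ST) : (0 <= (f z)%:E)%E by rewrite lee_fin /f patchE; case: ifP.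
have I0 : (\int[leb4]_z (f z)%:E = 0)%E.
  transitivity (\int[leb4]_(z in [set: ST]) (cst 0 z : \bar R))%E; last exact: integral0.
  apply: ae_congr_integral; apply: (@ae_imply _ ST R leb4 _ _ _ c01) => z h _.
  rewrite /f patchE; case: ifP => // /set_mem /h cz.
  by rewrite clamp_id ?ler01// subrr normr0.
have F2 := fubini_tonelli2 (m1 := leb3) (m2 := leb1) _ mf f0.
have mG := measurable_fun_fubini_tonelli_G (m1 := leb3) _ mf f0.
have G0 t : (0 <= fubini_G leb3 (fun z => (f z)%:E) t)%E.
  by apply: integral_ge0 => x _; exact: f0.
have : (\int[leb1]_(t in [set: line]) `|fubini_G leb3 (fun z => (f z)%:E) t| = 0)%E.
  under eq_integral do rewrite gee0_abs//.
  by rewrite -F2 -[RHS]I0.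
move/(ae_eq_integral_abs leb1 measurableT mG).
apply: filterS => t /(_ Logic.I) /= Gt t0; rewrite -[RHS]Gt /excess /L1_dist /fubini_G.
rewrite integral_mkcond; apply: eq_integral => x _.
rewrite /f !patchE; have [/set_mem cx|ncx] := boolP (x \in cell).
  by rewrite mem_set//; split => //=; rewrite in_itv/= t0.
by rewrite memNset// => -[cx _]; move/negP: ncx; apply; exact: mem_set.
Qed.

Let null_complement (a b : R) : a < b -> 0 <= a -> exists2 t, a < t < b & excess t = 0%E.
Proof.
move=> ab a0; apply: contrapT => nex.
have [N [mN N0 sN]] := excess_ae.
have sub : `]a, b[ `<=` N.
  move=> t /=; rewrite in_itv/= => tab; apply: sN => /= h; apply: nex.
  by exists t => //; apply: h; have /andP[at_ _] := tab; exact: le_lt_trans at_.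
have : (leb1 `]a%R, b%R[%classic <= leb1 N)%E by apply: le_measure => //; rewrite inE.
by rewrite N0 lebesgue_measure_itv/= lte_fin ab -EFinD lee_fin subr_le0 leNgt ab.
Qed.

Let N2 t s := ('N[leb3]_2%:E[EFin \o ((fun x => (c (x, t) - c (x, s))%R) \_ cell)])%E.

Let L2_N2 t s : (N2 t s `^ 2 = L2_dist leb3 cell (fun x => c (x, t)) (fun x => c (x, s)))%E.
Proof.
rewrite /N2 poweR_Lnorm ?pnatr_eq0// /L2_dist [RHS]integral_mkcond.
apply: eq_integral => x _; rewrite /= !patchE; case: ifP => _.
  by rewrite powR_mulrn// real_normK ?num_real.
by rewrite normr0 powR0// pnatr_eq0.
Qed.

(** A set of full measure is dense, and the excess is continuous in time because
    clamping is a contraction and convergence in L2 implies convergence in L1. *)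
Let excess0 t0 : 0 < t0 -> excess t0 = 0%E.
Proof.
move=> t00; have [_ /(_ t0 (ltW t00)) ct] := cc.
have pick m : exists t, [/\ 0 < t, excess t = 0%E & (N2 t t0 <= (m.+1%:R^-1 : R)%:E)%E].
  have /fine_cvgP[fin /cvgrPdist_le /(_ (m.+1%:R^-1))] := ct.
  rewrite invr_gt0 => /(_ (ltr0Sn _ _)) cv.
  have : \forall t \near within `[0, +oo[ (nbhs t0),
    N2 t t0 \is a fin_num /\ `|0 - fine (N2 t t0)| <= m.+1%:R^-1.
  exact: filterI fin cv.
rewrite near_withinE => /nbhs_ballP[d /= d0 hd].
  have td : t0 < t0 + d by rewrite ltrDl.
  have [t /andP[t1 t2] et] := null_complement td (ltW t00).
  exists t; have tpos : 0 < t by exact: lt_trans t1.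
  have [] := hd t _ _.
  - by rewrite /ball /= ltr0_norm ?subr_lt0// opprB ltrBlDl.
  - by rewrite /= in_itv/= andbT ltW.
  move=> tf; rewrite sub0r normrN => te; split => //.
  by rewrite -(fineK tf) lee_fin (le_trans (ler_norm _)).
have [s hs] := choice pick.
have ms t : 0 < t -> measurable_fun (cell : set SP) (fun x : SP => c (x, t)).
  by move=> tp; exact: (measurable_section mc tp).
have mK t : 0 < t -> measurable_fun (cell : set SP) (fun x : SP => K (c (x, t))).
  by move=> tp; exact: (measurableT_comp (measurable_clamp ler01) (ms t tp)).
have V2 : vanishes (fun m => L2_dist leb3 cell (fun x => c (x, s m)) (fun x => c (x, t0))).
  move=> e e0; have [n _ hn] := near_infty_natSinv_lt (PosNum e0).
  exists n => // m /= /hn /= me; have [_ _ Nm] := hs m.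
  rewrite -L2_N2; apply: (@le_trans _ _ ((m.+1%:R^-1 : R)%:E `^ 2)%E).
    apply: gt0_ler_poweR => //; rewrite in_itv/= ?leey ?andbT ?Lnorm_ge0//.
  rewrite poweR_EFin lee_fin powR_mulrn// expr2.
  have e1 : m.+1%:R^-1 <= 1 :> R by rewrite invf_le1// ler1n.
  by rewrite (le_trans _ (ltW me))// ler_piMl.
have sp m : 0 < s m by have [] := hs m.
have fC : (leb3 (@cell R) < +oo)%E by exact: leb3_cell_fin.
have V1 : vanishes (fun m => L1_dist leb3 cell (fun x => c (x, s m)) (fun x => c (x, t0))).
  exact: (L1_of_L2 mcell fC (fun m => ms _ (sp m)) (ms _ t00) V2).
suff h e : 0 < e -> (excess t0 <= e%:E)%E.
  apply/eqP; rewrite eq_le; apply/andP; split; last exact: integral_ge0.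
  by apply/lee_addgt0Pr => e /h; rewrite add0e.
move=> e0; have e2 : 0 < e / 2 by rewrite divr_gt0.
have [m _ /(_ m (leqnn _)) hm] := V1 _ e2.
have T1 := L1_triangle leb3 mcell (ms _ t00) (ms _ (sp m)) (mK _ t00).
have T2 := L1_triangle leb3 mcell (ms _ (sp m)) (mK _ (sp m)) (mK _ t00).
have sym (f g : SP -> R) : L1_dist leb3 cell f g = L1_dist leb3 cell g f.
  by apply: eq_integral => x _; rewrite distrC.
have lip : (L1_dist leb3 cell (fun x => K (c (x, s m))) (fun x => K (c (x, t0))) <=
    L1_dist leb3 cell (fun x => c (x, s m)) (fun x => c (x, t0)))%E.
  apply: ge0_le_integral => //.
  - by apply: measurable_dist; exact: mK.
  - by apply: measurable_dist; exact: ms.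
  - by move=> x _; rewrite lee_fin; apply: clamp_lip; exact: ler01.
have [_ es _] := hs m.
apply: (le_trans T1); rewrite (splitr e) EFinD; apply: leeD.
  by rewrite sym; exact: hm.
apply: (le_trans T2); rewrite -/(excess (s m)) es add0e.
exact: le_trans lip hm.
Qed.

(** The initial continuity of b(c) concerns every small time and needs [c] to be
    nonnegative there, as nothing is known of [b] on the negative numbers; the
    given bounds only hold almost everywhere in space and time. *)
Lemma bounds_at_every_time t : 0 < t -> {ae leb3, forall x, cell x -> 0 <= c (x, t) <= 1}.
Proof.
move=> t0; have ms := measurable_section mc t0.
have mK : measurable_fun (cell : set SP) (fun x : SP => K (c (x, t))).
  exact: (measurableT_comp (measurable_clamp ler01) ms).
have := excess0 t0; rewrite /excess /L1_dist => E0.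
have /(ae_eq_integral_abs leb3 mcell) : measurable_fun (cell : set SP)
    (fun x : SP => (`|c (x, t) - K (c (x, t))|)%:E) by exact: measurable_dist.
move=> [/(_ _)h _].
have h' : ae_eq leb3 cell (fun x : SP => (`|c (x, t) - K (c (x, t))|)%:E) (cst 0%E).
  by apply: h; rewrite -[RHS]E0; apply: eq_integral => x _; rewrite abse_EFin normr_id.
apply: (@ae_imply _ SP R leb3 _ _ _ h') => x hx /hx [] /eqP.
by rewrite normr_eq0 subr_eq0 => /eqP ->; apply: clamp_itv; exact: ler01.
Qed.

End EveryTime.

Section InitialContinuity.
Variable R : realType.
Notation line := (measurableTypeR R).
Notation SP := (line * line * line)%type.
Notation ST := (line * line * line * line)%type.
Variables (n : nat) (c0 : 'I_n -> position R -> R) (c : 'I_n -> spacetime R -> R) (i : 'I_n).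
Hypothesis mc : measurable_fun (cylinder `]0, +oo[ : set ST) (c i : ST -> R).
Hypothesis c01 : {ae leb4, forall z, cylinder `]0, +oo[ z -> 0 <= c i z <= 1}.
Hypothesis mc0 : measurable_fun (cell : set SP) (c0 i : SP -> R).
Hypothesis c001 : {ae leb3, forall x, cell x -> 0 <= c0 i x <= 1}.
Hypothesis cc : continuous_L2 (c i).
Hypothesis c_c0 : (\int[leb3]_(x in cell) `|c i (x, t) - c0 i x|%:E)%E
  @[t --> 0^'+] --> 0%E.

Notation K := (clamp (0 : R) 1).

Let mcell : measurable (cell : set SP). Proof. exact: measurable_cell. Qed.

(** On [0, 1] the function [b] is Lipschitz up to a small error. *)
Lemma renormalized_initial_continuity b b1 b2 : C2_halfline b b1 b2 ->
  (\int[leb3]_(x in cell) `|b (c i (x, t)) - b (c0 i x)|%:E)%E @[t --> 0^'+] --> 0%E.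
Proof.
move=> [cb _ _ _ _].
have {}cb : {within `[0, 1], continuous b}.
  by apply: continuous_subspaceW cb => x /=; rewrite !in_itv/= andbT => /andP[].
have main e : 0 < e -> \forall t \near 0^'+,
    (\int[leb3]_(x in cell) `|b (c i (x, t)) - b (c0 i x)|%:E <= e%:E)%E.
  move=> e0; have e2 : 0 < e / 2 by rewrite divr_gt0.
  have [C C0 hC] := continuity_modulus ler01 cb e2.
  have C1 : 0 < C + 1 by rewrite ltr_wpDl.
  have [d d0 hd] := initial_distance c_c0 (divr_gt0 e2 C1).
  near=> t.
  have t0 : 0 < t by [].
  have td : t < d by near: t; exact: nbhs_right_lt.
  have ms := measurable_section mc t0.
  have mb : measurable_fun setT (b \o K : line -> line).
    exact: (continuous_measurable_fun (continuous_clamp ler01 cb)).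
  rewrite (_ : integral _ _ _ =
      \int[leb3]_(x in cell) `|b (K (c i (x, t))) - b (K (c0 i x))|%:E)%E; last first.
    apply: ae_congr_integral.
    have [A B] := (bounds_at_every_time mc c01 cc t0, c001).
    have AB : {ae leb3, forall x : SP, (cell x -> 0 <= c i (x, t) <= 1) /\
        (cell x -> 0 <= c0 i x <= 1)} by exact: filterI.
    apply: (@ae_imply _ SP R leb3 _ _ _ AB) => x [h1 h2] cx.
    by rewrite !clamp_id// ?ler01 ?h1 ?h2.
  apply: (@le_trans _ _ (\int[leb3]_(x in cell)
      ((e / 2)%:E + C%:E * `|c i (x, t) - c0 i x|%:E))%E).
    apply: ge0_le_integral => //.
    - apply: measurable_dist; first exact: (measurableT_comp mb ms).
      exact: (measurableT_comp mb mc0).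
    - apply: emeasurable_funD => //; apply: measurable_funeM; exact: measurable_dist.
    - move=> x _; rewrite -EFinM -EFinD lee_fin.
      apply: le_trans (hC _ _ _ _) _; [exact: (clamp_itv ler01)|exact: (clamp_itv ler01)|].
      by rewrite lerD2l ler_wpM2l// clamp_lip// ler01.
  rewrite ge0_integralD//; last 3 first.
  - by move=> x _; rewrite lee_fin ltW.
  - by move=> x _; rewrite mule_ge0// lee_fin.
  - by apply: measurable_funeM; exact: measurable_dist.
  rewrite ge0_integralZl//; last exact: measurable_dist.
  rewrite integral_cst// [X in (_ * X + _)%E]leb3_cell mule1 [in leRHS](splitr e) EFinD leeD2l//.
  have h : 0 < t < d by rewrite t0.
  apply: le_trans (lee_wpmul2l _ (hd t h)) _ => //.
  rewrite -EFinM lee_fin mulrA ler_pdivrMr// mulrC ler_wpM2l ?(ltW e2)//.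
  by rewrite lerDl.
have I0 t : (0 <= \int[leb3]_(x in cell) `|b (c i (x, t)) - b (c0 i x)|%:E)%E.
  by apply: integral_ge0 => x _; rewrite lee_fin.
apply/fine_cvgP; split.
  apply: filterS (main 1 ltr01) => t h.
  by rewrite ge0_fin_numE// (le_lt_trans h) ?ltry.
apply/cvgrPdist_le => e e0; apply: filterS (main e e0) => t h.
rewrite sub0r normrN ger0_norm ?fine_ge0//.
by rewrite -lee_fin fineK// ge0_fin_numE// (le_lt_trans h) ?ltry.
Unshelve. all: end_near. Qed.

End InitialContinuity.

Section InitialData.
Variables (R : realType) (n : nat) (c0 : 'I_n -> position R -> R).
Notation line := (measurableTypeR R).
Notation SP := (line * line * line)%type.
Hypothesis c0_init : initial_data c0.

Lemma initial_measurable i : measurable_fun (cell : set SP) (c0 i : SP -> R).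
Proof.
have [_ /(_ i) + _ _ _] := c0_init.
rewrite inE => /andP[+ _]; rewrite inE/= => m0.
by apply/(measurable_restrictT _ (@measurable_cell R)).
Qed.

Lemma initial_bounds i : {ae leb3, forall x, cell x -> 0 <= c0 i x <= 1}.
Proof.
have [_ _ pos tot _] := c0_init.
have all : {ae leb3, forall x, forall j, cell x -> 0 <= c0 j x}.
  exact: filter_forall.
have both : {ae leb3, forall x : SP, (forall j, cell x -> 0 <= c0 j x) /\
  (cell x -> \sum_(j < n) c0 j x = 1)} by exact: filterI.
apply: ae_imply both => x [h1 h2] cx; rewrite h1//=.
by rewrite -(h2 cx) (bigD1 i)//= lerDl sumr_ge0// => j _; exact: h1.
Qed.

End InitialData.

Theorem theorem3 (R : realType) (n : nat) (hn : (2 <= n)%N)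
  (D : 'I_n -> 'I_n -> R)
  (D_sym : forall i j, i != j -> D i j = D j i)
  (D_pos : forall i j, i != j -> (0 < D i j)%R)
  (c0 : 'I_n -> position R -> R)
  (c : 'I_n -> spacetime R -> R)
  (u : 'I_n -> spacetime R -> 'rV[R]_3)
  (c0_init : initial_data c0)
  (c_torus : forall i, periodic_in_space (c i))
  (u_torus : forall i, periodic_in_space (u i))
  (c_weak : weak_solution D c0 c u)
  (c_cont : forall i, continuous_L2 (c i))
  (u_L2 : forall i, L2_finite_times (sqrt_flux c u i)) :
  renormalized_solution D c0 c u.
Proof.
have [vol sq weak rel lim] := c_weak; have [mc c01 _] := vol.
have mc0 := initial_measurable c0_init; have c001 := initial_bounds c0_init.
split => //.
- move=> i; split => //; have [[g sg g2] _] := sq i.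
  exists g; split => // phi b b1 b2.
  exact: (renormalized_equation (mc i) (c01 i) (mc0 i) (c001 i) sg g2 (u_L2 i) (weak i) (lim i)).
move=> i b b1 b2.
exact: (renormalized_initial_continuity (mc i) (c01 i) (mc0 i) (c001 i) (c_cont i) (lim i)).
Qed.
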